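(* Let $n$ and $k$ be integers with $k$ odd and $2<k<n-3$. There exists a deterministic distributed protocol for $k$ anonymous, oblivious, disoriented robots with local weak multiplicity detection on an anonymous unoriented ring of $n$ nodes, executed under the asynchronous non-atomic CORDA model with a fair scheduler, such that from every initial configuration in which each node hosts at most one robot (no tower) and which is not periodic, the robots achieve gathering within $O(n^2)$ asynchronous rounds.
   Context: Ring and robots: the network is an anonymous, unoriented, undirected ring of $n$ nodes $u_0,\dots,u_{n-1}$, $u_i$ adjacent to $u_{i-1}$ and $u_{i+1}$ (indices mod $n$); nodes and edges carry no labels. $k$ robots occupy nodes. Robots are identical (run the same program, no identifiers), oblivious (no memory between cycles), have no common sense of direction, and cannot communicate. Each robot repeatedly executes cycles of Look (take a snapshot of robot positions), Compute (decide, based only on the snapshot, either to stay or to move to one of its two neighboring nodes), and Move (move to that neighbor; moves are instantaneous, so snapshots always show robots on nodes). CORDA model with fair asynchronous scheduling: an adversarial scheduler activates robots, each robot is activated infinitely often, and phases of different robots may be arbitrarily interleaved, so a robot may move based on an outdated snapshot. A node hosting more than one robot is a tower. View: if the occupied nodes, read around the ring starting at the robot's node $u_1$ in one direction, define consecutive segments of lengths (numbers of edges) $D_1,\dots,D_w$ between successive occupied nodes, the robot's snapshot is $(\max\{(D_1,\dots,D_w),(D_w,\dots,D_1)\}, m)$ with the maximum in lexicographic order, where $m$ is true iff the robot's own node is a tower (local weak multiplicity detection: a robot cannot tell whether other occupied nodes host one or several robots). If the two sequences are equal (symmetric view), the robot cannot distinguish its two incident edges, and if it decides to move the scheduler chooses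 the direction. A tower-free configuration is periodic if its cyclic sequence of segment lengths is a concatenation of at least two copies of a shorter sequence (i.e., invariant under a nontrivial rotation of the ring). Gathering: all $k$ robots reach a single node (not fixed in advance) and remain there forever afterwards. An asynchronous round is a shortest fragment of an execution in which every robot performs a Move phase at least once. *)

(* Defs.v *)
From mathcomp Require Import all_boot.
Set Implicit Arguments. Unset Strict Implicit. Unset Printing Implicit Defensive.

Fixpoint lex_lt (s t : seq nat) : bool :=
  match s, t with
  | [::], [::] => false
  | [::], _ => true
  | _, [::] => false
  | a :: s', b :: t' => (a < b) || ((a == b) && lex_lt s' t')
  end.

Section Ring.
Variables (n k : nat).

(* A configuration: the node occupied by each robot. Nodes are 'I_n, node u_i
   is adjacent to u_{i+1 mod n} (ordS) and u_{i-1 mod n} (ord_pred). *)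
Definition config := 'I_k -> 'I_n.

Definition occ_at (c : config) (u : 'I_n) (j : nat) : bool :=
  [exists r, (c r : nat) == (u + j) %% n].

Definition occ_dists (c : config) (u : 'I_n) : seq nat :=
  [seq j <- iota 0 n | occ_at c u j].

Definition cw_segs (c : config) (u : 'I_n) : seq nat :=
  let d := occ_dists c u in pairmap (fun a b => b - a) 0 (rcons (behead d) n).

(* local weak multiplicity detection: the robot's own node is a tower *)
Definition is_tower (c : config) (r : 'I_k) : bool :=
  [exists r', (r' != r) && (c r' == c r)].

Definition view (c : config) (r : 'I_k) : seq nat * bool :=
  let s := cw_segs c (c r) in
  let s' := rev s in
  (if lex_lt s s' then s' else s, is_tower c r).

Definition periodic (c : config) : Prop :=
  exists r : 'I_k, exists m (s : seq nat),
    1 < m /\ cw_segs c (c r) = flatten (nseq m s).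

End Ring.

(* Decisions of a robot, relative to its view: stay, move towards the first
   segment of its (maximal) reading, or towards the last one. When the view is
   symmetric, the direction of a move is chosen by the scheduler. *)
Inductive decision := Stay | Front | Back.

Definition protocol := seq nat -> bool -> decision.

Section Exec.
Variables (n k : nat) (P : protocol).

(* Pending move of a robot: None = idle (next phase is Look);
   Some None = will stay; Some (Some true) = will move to u+1;
   Some (Some false) = will move to u-1. *)
Record state := State { spos : config n k; spend : 'I_k -> option (option bool) }.

(* Look+Compute of robot r; b is the scheduler's choice of direction used
   when the view is symmetric. *)
Definition compute_move (c : config n k) (r : 'I_k) (b : bool) : option bool :=
  let s := cw_segs c (c r) in
  let s' := rev s in
  let front := if lex_lt s' s then true else if lex_lt s s' then false else b in
  match P (view c r).1 (view c r).2 with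
  | Stay => None
  | Front => Some front
  | Back => Some (~~ front)
  end.

Definition apply_move (u : 'I_n) (m : option bool) : 'I_n :=
  match m with None => u | Some true => ordS u | Some false => ord_pred u end.

Definition step (st : state) (rb : 'I_k * bool) : state :=
  let (r, b) := rb in
  match spend st r with
  | None => State (spos st)
      (fun r' => if r' == r then Some (compute_move (spos st) r b) else spend st r')
  | Some m => State (fun r' => if r' == r then apply_move (spos st r) m else spos st r')
      (fun r' => if r' == r then None else spend st r')
  end.

Definition schedule := nat -> 'I_k * bool.

Fixpoint exec (c0 : config n k) (sc : schedule) (t : nat) : state :=
  match t with
  | 0 => State c0 (fun _ => None)
  | t'.+1 => step (exec c0 sc t') (sc t')
  end.

Definition fair (sc : schedule) : Prop :=
  forall (r : 'I_k) (t : nat), exists t', t <= t' /\ (sc t').1 = r.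

Definition is_move (c0 : config n k) (sc : schedule) (t : nat) (r : 'I_k) : Prop :=
  (sc t).1 = r /\ spend (exec c0 sc t) r <> None.

Definition covers (c0 : config n k) (sc : schedule) (a b : nat) : Prop :=
  forall r : 'I_k, exists t, a <= t < b /\ is_move c0 sc t r.

Definition rounds_done_by (c0 : config n k) (sc : schedule) (R t : nat) : Prop :=
  exists ts : nat -> nat, ts 0 = 0 /\ ts R <= t /\
    forall i, i < R -> covers c0 sc (ts i) (ts i.+1).

Definition gathered_from (c0 : config n k) (sc : schedule) (t : nat) : Prop :=
  exists v : 'I_n, forall t', t <= t' -> forall r, spos (exec c0 sc t') r = v.

End Exec.

(* Main.v *)
(* While the robots occupy distinct nodes, a configuration is the cyclic word of the gaps between
   consecutive robots.  The rule lets the robots outside the longest blocks of adjacent robots walk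
   across a gap towards a nearest longest block; an arrival makes the maximal length of a block
   grow, until all robots form one block.  Since a move may rest on an outdated snapshot, the
   argument is an invariant on pending moves: a pending move is still aimed at a longest block, or,
   while there is only one longest block, it may be aimed at one block that has been overtaken; the
   rule then avoids the departures that would let such a late arrival create a symmetry.  Block
   length, uniqueness of the longest block and distances to it form a quadratic potential.  An
   ambiguous choice is made by a canonical word: the configuration being non-periodic and [k] being
   odd, a reflection fixes exactly one robot, and at most two mirror robots are selected.
   From a single block, the two neighbours of the central robot merge with it, the two arms close
   up, and so on.  The enabled moves then stay enabled until they are executed, and the tower bit
   only serves on the last two nodes. *)
Require Import Defs.
From Stdlib Require Import FunctionalExtensionality.
From mathcomp Require Import all_boot all_algebra zify.
Set Implicit Arguments. Unset Strict Implicit. Unset Printing Implicit Defensive.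

(** * Flags and runs *)

(** Canonical choices are safe only while nothing but chosen robots can be in motion. They are
    therefore confined to configurations in which every pending move is itself enabled ([fresh]).
    Once these are left, [tracked] holds, excludes [fresh], and lasts until a single block is
    formed.

    The obstacle inside [tracked] is that a join makes the longest block unique and may turn any
    other pending move into a late arrival. With two longest blocks all of these aim at the one
    rival; with more, a bound of two pending or nearest robots leaves only one of them. A late
    arrival matters only if it ties the record, and a tie is harmful only if the robot at the far
    end of the tied block is leaving it or may still decide to: [safe] and [axial] exist to exclude
    this.

    Oddness acts through halving: every rotation is the square of a rotation, and two equal blocks
    never contain all robots. The bound [k < n - 3] keeps the outer gap longer than 2 during the
    folding, where all other segments are 1 or 2. The number of segments equal to 1 in a reading
    tells a robot which stage it is in. *)

Section Flags.
Variable k' : nat.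
Notation K := k'.+3.
Notation I := 'I_K.

(* A robot with a direction: [adv j f] is the [j]-th next robot in that direction, [edge f] the
   gap in front of [f], [opp f] the robot across this gap looking back at [f]. *)
Definition flag := (I * bool)%type.
Implicit Types (f x y h : flag) (a : I -> nat) (i j m : nat).

Definition adv j f : flag := (f.1 + (if f.2 then 1 else -1) *+ j, f.2)%R.
Definition flip f : flag := (f.1, ~~ f.2).
Definition opp f : flag := flip (adv 1 f).
Definition bwd f : flag := flip (adv 1 (flip f)).
Definition edge f : I := if f.2 then f.1 else (f.1 - 1)%R.
Definition g a f := a (edge f).

Lemma advE j f : (adv j f).2 = f.2. Proof. by []. Qed.
Lemma flipE f : (flip f).2 = ~~ f.2. Proof. by []. Qed.

Lemma adv0 f : adv 0 f = f.
Proof. by case: f => i p; rewrite /adv /= GRing.mulr0n GRing.addr0. Qed.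

Lemma advD i j f : adv i (adv j f) = adv (i + j) f.
Proof. by rewrite /adv /= -GRing.addrA -GRing.mulrnDr addnC. Qed.

Lemma flipK : involutive flip.
Proof. by case=> i p; rewrite /flip /= negbK. Qed.

Lemma adv_flip j f : adv j (flip (adv j f)) = flip f.
Proof.
rewrite /adv /flip /=; congr pair; case: f.2 => /=.
  by rewrite GRing.mulNrn GRing.addrK.
by rewrite GRing.mulNrn GRing.subrK.
Qed.

Lemma adv_flip_le i j f : i <= j -> adv i (flip (adv j f)) = flip (adv (j - i) f).
Proof. by move=> le_ij; rewrite -{1}(subnKC le_ij) -advD adv_flip. Qed.

Lemma adv1_opp f : adv 1 (opp f) = flip f. Proof. exact: adv_flip. Qed.

Lemma oppK : involutive opp.
Proof. by move=> f; rewrite {1}/opp adv1_opp flipK. Qed.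

Lemma adv1_bwd f : adv 1 (bwd f) = f.
Proof. by rewrite /bwd adv_flip flipK. Qed.

Lemma bwd_adv1 f : bwd (adv 1 f) = f.
Proof. by rewrite /bwd -[flip (adv 1 f)]/(opp f) adv1_opp flipK. Qed.

Lemma opp_flip f : opp (flip f) = bwd f. Proof. by []. Qed.

Lemma bwdE f : (bwd f).2 = f.2.
Proof. by rewrite /bwd flipE advE flipE negbK. Qed.

Lemma bwd_adv j f : bwd (adv j.+1 f) = adv j f.
Proof. by rewrite -add1n -advD bwd_adv1. Qed.

Lemma edge_opp f : edge (opp f) = edge f.
Proof. by rewrite /edge /opp /=; case: f.2 => /=; rewrite GRing.mulr1n ?GRing.addrK. Qed.

Lemma edge_inj x y : edge x = edge y -> x = y \/ x = opp y.
Proof.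
case: x y => [i p] [j q]; rewrite /edge /opp /adv /flip /=.
case: p q => [] [] /=; rewrite ?GRing.mulr1n => E.
- by left; rewrite E.
- by right; rewrite E.
- by right; rewrite -E GRing.subrK.
- by left; move/(congr1 (fun z => z + 1)%R): E; rewrite !GRing.subrK => ->.
Qed.

Lemma edge_eq x y : (edge x == edge y) = (x == y) || (x == opp y).
Proof.
apply/eqP/orP => [/edge_inj[->|->]|[/eqP->|/eqP->]]; rewrite ?eqxx ?edge_opp ?orbT //.
  by left.
by right.
Qed.

Lemma mulrn_K (z : I) : (z *+ K = 0)%R.
Proof.
by apply: val_inj; rewrite Zp_mulrn /= modnMl.
Qed.

Lemma advK f : adv K f = f.
Proof. by case: f => i p; rewrite /adv /= mulrn_K GRing.addr0. Qed.

Lemma oneZ j : ((1 : I) *+ j = inZp j)%R.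
Proof. by rewrite -Zp_nat. Qed.

Lemma adv_inj i j f : i < K -> j < K -> adv i f = adv j f -> i = j.
Proof.
move=> ltiK ltjK /(congr1 fst) /GRing.addrI E.
have: ((1 : I) *+ i = 1 *+ j)%R.
  by move: E; case: f.2 => //; rewrite !GRing.mulNrn => /GRing.oppr_inj.
by rewrite !oneZ => /(congr1 val) /=; rewrite !modn_small.
Qed.

Lemma adv_neq j f : 0 < j < K -> adv j f <> f.
Proof.
move=> /andP[j0 jK]; rewrite -{2}(adv0 f) => /adv_inj E.
by move: j0; rewrite E.
Qed.

Lemma adv_surj f x : exists2 j, j < K & x = adv j f \/ x = flip (adv j f).
Proof.
pose d := (if f.2 then x.1 - f.1 else f.1 - x.1)%R : I.
exists (val d); first exact: ltn_ord.
have dE : ((1 : I) *+ val d = d)%R by rewrite oneZ; apply: val_inj; rewrite /= modn_small.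
have E1 : (adv (val d) f).1 = x.1.
  rewrite /adv /d /= in dE *; case: f.2 in dE *; rewrite ?GRing.mulNrn dE.
    by rewrite GRing.addrC GRing.subrK.
  by rewrite GRing.opprB GRing.addrC GRing.subrK.
have E3 : (adv (val d) f).2 = f.2 by [].
move: (adv _ f) E1 E3 => [i p] /= -> ->.
case: (boolP (x.2 == f.2)) => [/eqP <-|E2]; first by left; case: (x).
by right; rewrite /flip /=; case: x E2 {d dE} => j q /=; case: q; case: f.2.
Qed.

Lemma opp_neq f : opp f <> f.
Proof. by case: f => i []; rewrite /opp /flip /adv /=; case. Qed.

Lemma flip_neq f : flip f <> f.
Proof. by case: f => i []. Qed.

Lemma g_opp a f : g a (opp f) = g a f.
Proof. by rewrite /g edge_opp. Qed.

(* [upd a f]: the gaps after robot [f.1] has moved one node in direction [f.2] *)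
Definition upd a f : I -> nat := fun e =>
  if e == edge f then (a e).-1 else if e == edge (flip f) then (a e).+1 else a e.

Lemma opp_flip_neq f : opp f <> flip f.
Proof. by move/(congr1 flip); rewrite flipK /opp flipK; apply: adv_neq. Qed.

Lemma edge_flip f : edge f != edge (flip f).
Proof.
rewrite edge_eq; apply/norP; split; apply/eqP => E.
  by case: (flip_neq (esym E)).
move/(congr1 opp): E; rewrite oppK; exact: opp_flip_neq.
Qed.

Lemma g_upd a f x : g (upd a f) x =
  if (x == f) || (x == opp f) then (g a x).-1
  else if (x == flip f) || (x == bwd f) then (g a x).+1 else g a x.
Proof. by rewrite /g /upd edge_eq (edge_eq x (flip f)). Qed.

(* [x] and the next [m] robots are adjacent: a block of [m.+1] robots *)
Definition R a x m := all (fun j => g a (adv j x) == 1) (iota 0 m).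

Lemma RP a x m : reflect (forall j, j < m -> g a (adv j x) = 1) (R a x m).
Proof.
apply: (iffP allP) => [H j jm|H j]; first by apply/eqP/H; rewrite mem_iota.
by rewrite mem_iota => jm; apply/eqP/H.
Qed.

Lemma R0 a x : R a x 0. Proof. by []. Qed.

Lemma R_le a x m m' : m' <= m -> R a x m -> R a x m'.
Proof. by move=> le /RP H; apply/RP => j jm; apply: H; apply: leq_trans le. Qed.

Lemma R_cat a x m m' : R a x (m + m') = R a x m && R a (adv m x) m'.
Proof.
apply/RP/andP => [H|[/RP H1 /RP H2]].
  split; apply/RP => j jm; first by apply: H; lia.
  by rewrite advD; apply: H; lia.
move=> j jm; case: (ltnP j m) => [|le]; first exact: H1.
by rewrite -(subnK le) -advD; apply: H2; lia.
Qed.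

Lemma R1 a x : R a x 1 = (g a x == 1). Proof. by rewrite /R /= adv0 andbT. Qed.

Lemma R_S a x m : R a x m.+1 = (g a x == 1) && R a (adv 1 x) m.
Proof. by rewrite -add1n R_cat R1. Qed.

Lemma R_Sr a x m : R a x m.+1 = R a x m && (g a (adv m x) == 1).
Proof. by rewrite -addn1 R_cat R1. Qed.

Lemma R_rev a x m : R a (flip (adv m x)) m = R a x m.
Proof.
have H y : R a y m -> R a (flip (adv m y)) m.
  move=> /RP H; apply/RP => j jm; rewrite adv_flip_le ?(ltnW jm) //.
  have -> : m - j = (m - j).-1.+1 by lia.
  rewrite -add1n -advD -/(opp _) g_opp; apply: H; lia.
apply/idP/idP => [/H|]; last exact: H.
by rewrite adv_flip flipK.
Qed.

(** Only the gap in front of [f] can become 1, and the gap behind [f] is then at least 2; so a run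
    that did not exist before starts or ends at [f]. *)
Lemma R_upd_from a f x m : (forall e, 0 < a e) -> 1 < g a f -> R (upd a f) x m ->
  R a x m \/ [/\ g a f = 2, 0 < m, R a (adv 1 f) m.-1 & (x = f \/ x = flip (adv m f))].
Proof.
move=> a0 gf.
have gup y : y = bwd f \/ y = flip f -> 1 < g (upd a f) y.
  move=> Hy; rewrite g_upd.
  have -> : (y == f) || (y == opp f) = false.
    apply: negbTE; rewrite -edge_eq; case: Hy => ->; rewrite -?opp_flip ?edge_opp eq_sym; exact: edge_flip.
  have -> : (y == flip f) || (y == bwd f) by case: Hy => ->; rewrite eqxx ?orbT.
  by rewrite ltnS; apply: a0.
have hitf y j : R (upd a f) y m -> j < m -> adv j y = f ->
    [/\ g a f = 2, 0 < m, R a (adv 1 f) m.-1 & y = f].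
  move=> /RP H jm E.
  have j0 : j = 0.
    case: j jm E => // j jm E; have := gup (bwd f) (or_introl erefl).
    have -> : bwd f = adv j y by apply: etrans (bwd_adv j y); rewrite E.
    by rewrite H //; apply: ltnW.
  move: jm E; rewrite j0 adv0 => m0 E; rewrite E in H *.
  have g2 : g a f = 2.
    by have := H 0 m0; rewrite adv0 g_upd eqxx /=; lia.
  split=> //; apply/RP => j' jm; rewrite advD addn1.
  have := H j'.+1; rewrite g_upd => /(_ _) Hj.
  have {Hj} := Hj ltac:(lia).
  case: eqP => [E1|_] /=.
    move=> _; have := gup (bwd f) (or_introl erefl).
    have -> : bwd f = adv j' f by apply: etrans (bwd_adv j' f); rewrite E1.
    by rewrite H //; lia.
  case: eqP => [/(congr1 snd) /=|_]; first by case: f.2.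
  by case: ifP => // _ Hj; move: (a0 (edge (adv j'.+1 f))); rewrite /g in Hj *; lia.
move=> HR; have HR' := HR; rewrite -R_rev in HR'.
case: (boolP (has (fun j => adv j x == f) (iota 0 m))) => [/hasP[j]|/hasPn H1].
  rewrite mem_iota => /= jm /eqP E; right.
  by have [? ? ? ->] := hitf _ _ HR jm E; split=> //; left.
case: (boolP (has (fun j => adv j (flip (adv m x)) == f) (iota 0 m))) => [/hasP[j]|/hasPn H2].
  rewrite mem_iota => /= jm /eqP E; right.
  have [? ? ? E'] := hitf _ _ HR' jm E; split=> //; right.
  by rewrite -E' adv_flip flipK.
left; apply/RP => j jm; move/RP: HR => /(_ j jm); rewrite g_upd.
case: eqP => [E|_].
  by have := H1 j; rewrite mem_iota => /(_ jm); rewrite E eqxx.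
case: eqP => [E|_] /=.
  have := H2 (m - j.+1); rewrite mem_iota => /(_ ltac:(lia)).
  rewrite adv_flip_le; last by lia.
  have -> : m - (m - j.+1) = 1 + j by lia.
  by rewrite -advD -/(opp _) E oppK eqxx.
case: ifP => // _ H; move: (a0 (edge (adv j x))); rewrite /g in H *; lia.
Qed.

(** The gap in front of [f] exceeds 1 and lies in no run, so a run containing the gap behind [f] has
    [f] as an end looking outwards. The two exclusions are the two readings of that situation. *)
Lemma R_upd_to2 a f x m : 1 < g a f -> x <> flip f -> adv m x <> f ->
  R a x m -> R (upd a f) x m.
Proof.
move=> gf n1 n2 HR; apply/RP => j jm; rewrite g_upd.
have Hj : g a (adv j x) = 1 by move/RP: HR; apply.
case: ifP => [/orP[]/eqP E|_].
- by move: gf; rewrite -E Hj.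
- by move: gf; rewrite -(g_opp a f) -E Hj.
case: ifP => // /orP[]/eqP E.
  case: n1; case: j jm Hj E => [|j] jm Hj E; first by rewrite -E adv0.
  move: gf.
    rewrite -(g_opp a f); have <- : adv j x = opp f by rewrite -(bwd_adv j x) E /bwd flipK.
    by move/RP: HR => /(_ j) ->; lia.
case: n2; have jm' : j.+1 = m.
  apply/eqP; rewrite eqn_leq jm /= leqNgt; apply/negP => lt; move: gf.
  by rewrite -(adv1_bwd f) -E advD; move/RP: HR => /(_ j.+1 lt); rewrite add1n => ->.
by rewrite -jm' -(adv1_bwd f) -E advD add1n.
Qed.

Lemma R_upd_to a f x m : 1 < g a f -> ~~ R a (flip f) m -> R a x m -> R (upd a f) x m.
Proof.
move=> gf nR HR; apply: R_upd_to2 => // E; case/negP: nR; first by rewrite -E.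
by rewrite -E R_rev.
Qed.

End Flags.

(** * Longest blocks and the effect of one move on them *)

Section Runs.
Variable k' : nat.
Notation K := k'.+3.
Notation I := 'I_K.
Notation flag := (flag k').
Implicit Types (f x y h : flag) (a : I -> nat) (i j m : nat).

Definition wf a := (forall e, 0 < a e) /\ exists e, 1 < a e.

Lemma g_flip_adv a j x : g a (flip (adv j.+1 x)) = g a (adv j x).
Proof. by rewrite -add1n -advD -/(opp _) g_opp. Qed.

Lemma R_ltK a x m : wf a -> R a x m -> m < K.
Proof.
move=> [_ [e ae]] HR; rewrite ltnNge; apply/negP => leK.
have {HR} /RP H := R_le leK HR.
have : 1 < g a (e, true) by [].
have [j jK [->|->]] := adv_surj x (e, true); first by rewrite H.
case: j jK => [|j] jK; last by rewrite g_flip_adv H // ltnW.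
by rewrite adv0 -(advK x) g_flip_adv H.
Qed.

(** A longest block has [(run a).+1] robots. The value 0 means that no two robots are adjacent;
    every flag then counts as an end of a longest block. *)
Definition run a : nat := \max_(o < K | [exists x, R a x (o : 'I_K)]) (o : 'I_K).

Lemma run_max a x m : wf a -> R a x m -> m <= run a.
Proof.
move=> wa HR; have mK := R_ltK wa HR.
have Hm : [exists x, R a x (Ordinal mK)] by apply/existsP; exists x.
exact: (@leq_bigmax_cond 'I_K (fun o : 'I_K => [exists x, R a x o]) (fun o : 'I_K => o : nat) _ Hm).
Qed.

Lemma run_ex a : exists x, R a x (run a).
Proof.
have [|m /existsP[x Hx] E] := @eq_bigmax_cond 'I_K (fun o : 'I_K => [exists x, R a x o]) (fun o : 'I_K => o : nat).
  by apply/card_gt0P; exists ord0; rewrite unfold_in /=; apply/existsP; exists (ord0, true).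
by exists x; rewrite /run E.
Qed.

Lemma run_lt a : wf a -> run a < K.
Proof. by move=> wa; have [x /R_ltK] := run_ex a; apply. Qed.

Lemma run_eq a x m : wf a -> R a x m -> (forall y, ~~ R a y m.+1) -> run a = m.
Proof.
move=> wa Hx Hy; apply/eqP; rewrite eqn_leq (run_max wa Hx) andbT leqNgt.
apply/negP => lt; have [y /(R_le lt) H] := run_ex a.
by move: (Hy y); rewrite H.
Qed.

Lemma run_S a y : wf a -> ~~ R a y (run a).+1.
Proof. by move=> wa; apply/negP => /(run_max wa); rewrite ltnn. Qed.

Definition longest a x := R a x (run a).

Lemma longest_rev a x : longest a (flip (adv (run a) x)) = longest a x.
Proof. exact: R_rev. Qed.

Lemma longest_gap a x : wf a -> longest a x -> 1 < g a (adv (run a) x).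
Proof.
move=> wa Hx; have := run_S x wa; rewrite R_Sr -/(longest a x) Hx /=.
by case: wa => /(_ (edge (adv (run a) x))); rewrite /g; lia.
Qed.

Lemma longest_bwd_gap a x : wf a -> longest a x -> 1 < g a (bwd x).
Proof.
move=> wa; rewrite -longest_rev => /(longest_gap wa).
by rewrite adv_flip -(g_opp a (flip x)) opp_flip.
Qed.

Section Effect.
Variables (a : I -> nat) (f : flag).
Hypotheses (wa : wf a) (gf : 1 < g a f).

Lemma wf_upd : wf (upd a f).
Proof.
split=> [e|]; rewrite /upd.
  case: eqP => [->|_]; first by move: gf; rewrite /g; lia.
  by case: eqP => // _; case: wa => /(_ e).
by exists (edge (flip f)); rewrite eq_sym (negPf (edge_flip f)) eqxx ltnS; apply: wa.1.
Qed.

Lemma R_upd_eq x m : 0 < m -> ~~ R a (flip f) m ->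
  (2 < g a f) || ~~ R a (adv 1 f) m.-1 -> R (upd a f) x m = R a x m.
Proof.
move=> m0 nR Hd; apply/idP/idP => [|]; last exact: R_upd_to.
case/(R_upd_from wa.1 gf) => // -[g2 _ H _].
by move: Hd; rewrite g2 H.
Qed.

(** The record survives because [f] does not leave a longest block. It is not reached elsewhere
    because [f] stays at a distance or joins fewer than [run a] robots, while a longest block has
    [(run a).+1]. *)
Lemma run_stay : 0 < run a -> ~~ longest a (flip f) ->
  (2 < g a f) || ~~ R a (adv 1 f) (run a).-1 -> run (upd a f) = run a.
Proof.
move=> b0 nm Hd; have [x Hx] := run_ex a.
apply: (run_eq (x := x) wf_upd); first by rewrite R_upd_eq.
move=> y; apply/negP => /(R_upd_from wa.1 gf)[|[g2 _ H _]].
  by apply/negP/run_S.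
by move: Hd; rewrite g2 /= (R_le _ H) // leq_pred.
Qed.

Lemma longest_stay x : 0 < run a -> ~~ longest a (flip f) ->
  (2 < g a f) || ~~ R a (adv 1 f) (run a).-1 -> longest (upd a f) x = longest a x.
Proof. by move=> b0 nm Hd; rewrite /longest run_stay // R_upd_eq. Qed.

Lemma R_upd_ahead m : m.+1 < K -> R a (adv 1 f) m -> R (upd a f) (adv 1 f) m.
Proof.
move=> mK; apply: R_upd_to2 => //; first by move/(congr1 snd) => /=; case: f.2.
by rewrite advD addn1; apply: adv_neq.
Qed.

Lemma R_upd_join m : m.+1 < K -> g a f = 2 -> R a (adv 1 f) m -> R (upd a f) f m.+1.
Proof. by move=> mK g2 H; rewrite R_S g_upd eqxx g2 /=; apply: R_upd_ahead. Qed.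

Section Join.
Hypotheses (bK : (run a).+1 < K) (g2 : g a f = 2) (maf : longest a (adv 1 f)).

Lemma run_join : run (upd a f) = (run a).+1.
Proof.
apply: (run_eq (x := f) wf_upd); first exact: R_upd_join.
move=> y; apply/negP => /(R_upd_from wa.1 gf)[|[_ _ H' _]].
  by move/(R_le (leqnSn _)); apply/negP/run_S.
by move: H'; apply/negP/run_S.
Qed.

(** Earlier runs have at most [run a] gaps, so only the run created at [f] reaches the new record: a
    join always leaves one longest block, seen here from its two ends. *)
Lemma longest_join x : longest (upd a f) x = (x == f) || (x == flip (adv (run a).+1 f)).
Proof.
rewrite /longest run_join //; apply/idP/orP.
  case/(R_upd_from wa.1 gf) => [H'|[_ _ _ [->|->]]].
  - by case/negP: (run_S x wa).
  - by left.
  - by right.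
by have HJ := R_upd_join bK g2 maf; case=> /eqP->; rewrite ?R_rev.
Qed.
End Join.

Lemma run_tie : 0 < run a -> ~~ longest a (flip f) -> g a f = 2 -> R a (adv 1 f) (run a).-1 ->
  ~~ longest a (adv 1 f) -> run (upd a f) = run a.
Proof.
move=> b0 nm g2 H nma; have [x Hx] := run_ex a.
apply: (run_eq (x := x) wf_upd); first exact: R_upd_to.
move=> y; apply/negP => /(R_upd_from wa.1 gf)[|[_ _ H' _]].
  by apply/negP/run_S.
by case/negP: nma.
Qed.

Lemma longest_tie x : 0 < run a -> ~~ longest a (flip f) -> g a f = 2 -> R a (adv 1 f) (run a).-1 ->
  ~~ longest a (adv 1 f) ->
  longest (upd a f) x = [|| longest a x, x == f | x == flip (adv (run a) f)].
Proof.
move=> b0 nm g2 H nma; rewrite /longest run_tie //; apply/idP/or3P.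
  case/(R_upd_from wa.1 gf) => [H'|[_ _ _ [->|->]]]; rewrite ?eqxx.
  - by apply: Or31.
  - by apply: Or32.
  - by apply: Or33.
have HJ : R (upd a f) f (run a).
  by rewrite -(prednK b0); apply: R_upd_join => //; have := run_lt wa; lia.
case=> [H'|/eqP->|/eqP->]; rewrite ?R_rev //; exact: R_upd_to.
Qed.

End Effect.
End Runs.

(** * The rule on distinct nodes *)

Section Rule.
Variable k' : nat.
Notation K := k'.+3.
Notation I := 'I_K.
Notation flag := (flag k').
Implicit Types (f x y h : flag) (a : I -> nat) (i j m : nat).

(* [f] is outside the longest blocks and one of them lies across the gap in front of [f] *)
Definition faces a f := [&& 1 < g a f, longest a (adv 1 f) & ~~ longest a (flip f)].
(* Unsafe: [f] leaves a block one robot short of the longest ones while a robot of a smaller block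
   waits two nodes behind; the join of that robot, if it is pending, would create a tie. *)
Definition safe a f := ~~ [&& R a (flip f) (run a).-1, g a (adv (run a).-1 (flip f)) == 2
                            & ~~ R a (adv (run a) (flip f)) (run a).-1].
(* counts both ends of each block, hence twice the number of longest blocks *)
Definition nlong a := #|[pred f | longest a f]|.
(** The safety filter applies only beside a unique longest block and is dropped when it would reject
    everybody, so that some robot can always move. *)
Definition cand a f :=
  faces a f && ((nlong a == 2) ==> safe a f || ~~ [exists h, faces a h && safe a h]).
Definition nearest a f := cand a f && [forall h, cand a h ==> (g a f <= g a h)].
Definition word a f := mkseq (fun j => g a (adv j f)) K.
Definition mirror a f := word a f == word a (flip f).
Definition mirrored a := [exists f, mirror a f].
(* an axis of reflection crosses the gap behind the block targeted by [f] *)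
Definition axial a f := word a (adv (run a).+1 f) == word a (opp (adv (run a).+1 f)).
(* Three kinds of configurations require breaking a symmetry: no two robots are adjacent; all blocks
   have the same length; more than two robots are nearest to more than two longest blocks. *)
Definition eligible a f :=
  if run a == 0 then (if mirrored a then mirror a f else [forall h, g a f <= g a h])
  else if [exists h, faces a h] then nearest a f && ~~ axial a f
  else (1 < g a f) && (mirrored a ==> (word a f == word a (adv (run a) (flip f)))).
Definition fresh a :=
  [|| run a == 0, ~~ [exists h, faces a h] | (4 < nlong a) && (2 < #|[pred f | nearest a f]|)].
(* the code of the word of [f] is the canonical, hence equivariant, tie-break *)
Definition selected a f := eligible a f && [forall h, eligible a h ==> (pickle (word a f) <= pickle (word a h))].
Definition enabled a f := if fresh a then selected a f else nearest a f.

(** * Invariance of the rule under rotations and reflections *)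

Section Equivariance.
Variables (u v : flag -> flag) (a' a : I -> nat).
Hypotheses (uK : cancel u v) (vK : cancel v u).
Hypotheses (u_adv : forall j x, adv j (u x) = u (adv j x)) (u_flip : forall x, flip (u x) = u (flip x)).
Hypothesis g_u : forall x, g a' x = g a (u x).

Let ex_u (P P' : pred flag) : (forall x, P' x = P (u x)) -> [exists x, P' x] = [exists x, P x].
Proof.
move=> H; apply/existsP/existsP => -[x Hx]; first by exists (u x); rewrite -H.
by exists (v x); rewrite H vK.
Qed.

Let all_u (P P' : pred flag) : (forall x, P' x = P (u x)) -> [forall x, P' x] = [forall x, P x].
Proof.
move=> H; apply/forallP/forallP => Hx x; last by rewrite H.
by rewrite -(vK x) -H.
Qed.

Let card_u (P P' : pred flag) : (forall x, P' x = P (u x)) -> #|[pred x | P' x]| = #|[pred x | P x]|.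
Proof.
move=> H; rewrite -(card_image (can_inj uK)); apply: eq_card => x; rewrite !inE.
apply/imageP/idP => [[y Hy ->]|Hx]; first by move: Hy; rewrite inE H.
by exists (v x); rewrite ?inE ?H vK.
Qed.

Lemma R_equiv x m : R a' x m = R a (u x) m.
Proof. by apply: eq_all => j; rewrite g_u u_adv. Qed.

Lemma run_equiv : run a' = run a.
Proof. by apply: eq_bigl => o; apply: ex_u => x; rewrite R_equiv. Qed.

Lemma longest_equiv x : longest a' x = longest a (u x).
Proof. by rewrite /longest run_equiv R_equiv. Qed.

Lemma faces_equiv x : faces a' x = faces a (u x).
Proof. by rewrite /faces g_u !longest_equiv u_adv u_flip. Qed.

Lemma safe_equiv x : safe a' x = safe a (u x).
Proof. by rewrite /safe run_equiv !R_equiv g_u !u_flip !u_adv. Qed.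

Lemma nlong_equiv : nlong a' = nlong a.
Proof. by apply: card_u => x; rewrite longest_equiv. Qed.

Lemma cand_equiv x : cand a' x = cand a (u x).
Proof.
rewrite /cand nlong_equiv faces_equiv safe_equiv; congr (_ && (_ ==> (_ || ~~ _))).
by apply: ex_u => h; rewrite faces_equiv safe_equiv.
Qed.

Lemma nearest_equiv x : nearest a' x = nearest a (u x).
Proof.
by rewrite /nearest cand_equiv; congr (_ && _); apply: all_u => h; rewrite cand_equiv !g_u.
Qed.

Lemma word_equiv x : word a' x = word a (u x).
Proof. by apply: eq_mkseq => j; rewrite g_u u_adv. Qed.

Lemma mirror_equiv x : mirror a' x = mirror a (u x).
Proof. by rewrite /mirror !word_equiv u_flip. Qed.

Lemma mirrored_equiv : mirrored a' = mirrored a.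
Proof. exact: ex_u mirror_equiv. Qed.

Lemma face_equiv : [exists h, faces a' h] = [exists h, faces a h].
Proof. exact: ex_u faces_equiv. Qed.

Lemma eligible_equiv x : eligible a' x = eligible a (u x).
Proof.
rewrite /eligible run_equiv mirrored_equiv face_equiv mirror_equiv nearest_equiv g_u !word_equiv u_flip u_adv.
rewrite (@all_u (fun h => g a (u x) <= g a h)); last by move=> h; rewrite g_u.
by rewrite /axial run_equiv !word_equiv /opp !u_adv !u_flip.
Qed.

Lemma fresh_equiv : fresh a' = fresh a.
Proof. by rewrite /fresh run_equiv face_equiv nlong_equiv (card_u nearest_equiv). Qed.

Lemma enabled_equiv x : enabled a' x = enabled a (u x).
Proof.
rewrite /enabled fresh_equiv nearest_equiv /selected eligible_equiv; congr (if _ then _ && _ else _).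
by apply: all_u => h; rewrite eligible_equiv !word_equiv.
Qed.
End Equivariance.

(* the gaps of a configuration in which robot 0 reads [s] *)
Definition conf (s : seq nat) : I -> nat := fun e => nth 0 s e.

(** The rotation or reflection that carries robot 0, looking in the positive direction, to [f]. *)
Definition place f x : flag := ((adv x.1 f).1, x.2 == f.2).
Definition unplace f x : flag :=
  ((if f.2 then x.1 - f.1 else f.1 - x.1)%R, x.2 == f.2).

Lemma mulZ (o : I) : ((1 : I) *+ val o = o)%R.
Proof. by rewrite oneZ; apply: val_inj; rewrite /= modn_small. Qed.

Lemma place1 f (o : I) : (adv o f).1 = (if f.2 then f.1 + o else f.1 - o)%R.
Proof. by rewrite /adv /=; case: f.2; rewrite ?GRing.mulNrn mulZ. Qed.

Lemma placeK f : cancel (place f) (unplace f).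
Proof.
case=> o p; rewrite /place /unplace place1 /=; congr pair; last by case: p; case: f.2.
case: f.2; first by rewrite GRing.addrC GRing.addKr.
by rewrite GRing.opprB GRing.addrC GRing.subrK.
Qed.

Lemma unplaceK f : cancel (unplace f) (place f).
Proof.
case=> o p; rewrite /place /unplace place1 /=; congr pair; last by case: p; case: f.2.
case: f.2; first by rewrite GRing.addrC GRing.subrK.
by rewrite GRing.opprB GRing.addrC GRing.subrK.
Qed.

Lemma place_adv f j x : adv j (place f x) = place f (adv j x).
Proof.
case: x => o p; rewrite /place !place1 /adv /= ; congr pair.
case: f.2; case: p => /=; rewrite ?GRing.mulNrn ?GRing.opprD ?GRing.opprK ?GRing.addrA //.
Qed.

Lemma place_flip f x : flip (place f x) = place f (flip x).
Proof. by case: x => o p; rewrite /place /flip /=; congr pair; case: p; case: f.2. Qed.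

Lemma g_place a f x : g (conf (word a f)) x = g a (place f x).
Proof.
have H o : conf (word a f) o = g a (adv o f) by rewrite /conf nth_mkseq.
have Hg (o : I) : g (conf (word a f)) (o, true) = g a (place f (o, true)).
  by rewrite [LHS]H; congr g; rewrite /place /=; case: f {H} => i q /=; case: q.
case: x => o []; first exact: Hg.
rewrite -[RHS]g_opp /opp place_adv place_flip -Hg.
by rewrite /adv /flip /= GRing.mulr1n.
Qed.

Definition Dec (s : seq nat) : bool := enabled (conf s) (ord0, true).

(** A robot does not know its index, so the rule is evaluated in the configuration where it would be
    robot 0; equivariance along [place f] makes the answer agree with the global one. *)
Lemma DecE a f : Dec (word a f) = enabled a f.
Proof.
rewrite /Dec (enabled_equiv (placeK f) (unplaceK f) (place_adv f) (place_flip f) (g_place a f)).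
by congr enabled; rewrite /place adv0 /=; case: f => i q /=; case: q.
Qed.
End Rule.

(** * The invariant on pending moves *)

Section Tracking.
Variable k' : nat.
Notation K := k'.+3.
Notation I := 'I_K.
Notation flag := (flag k').
Implicit Types (f x y h : flag) (a : I -> nat) (i j m : nat) (PD : I -> option bool).

Definition pending PD f := PD f.1 == Some f.2.
Definition unpend PD (o : I) : I -> option bool := fun e => if e == o then None else PD e.
Definition aimed a f := longest a (adv 1 f).
(* a pending move towards a block that is no longer a longest one *)
Definition stray a PD f := pending PD f && ~~ aimed a f.
Definition block a x m := [&& R a x m, 1 < g a (bwd x) & 1 < g a (adv m x)].
(** While the longest blocks do not change, these are exactly the moves that bring their robot
    closer to the nearest longest block it faces; a robot between two such blocks may be pending
    towards the farther one. *)
Definition direct a f := faces a f && (faces a (flip f) ==> (g a f <= g a (flip f))).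

(** The first two conditions keep the robots on distinct nodes: no pending move enters an occupied
    node and no gap is crossed from both sides at once. The third keeps longest blocks intact. *)
Definition legal a PD :=
  forall f, pending PD f -> [/\ 1 < g a f, ~~ pending PD (opp f) & ~~ longest a (flip f)].

(* All stray moves aim at the ends of one block; if there are several of them, no other block is
   just one robot short of the longest one. *)
Definition loser a PD x0 m :=
  [/\ block a x0 m,
      forall f, stray a PD f -> adv 1 f = x0 \/ adv 1 f = flip (adv m x0)
    & (forall f h, stray a PD f -> stray a PD h -> f = h) \/
      (forall x, block a x (run a).-1 -> m = (run a).-1 /\ (x = x0 \/ x = flip (adv m x0)))].

(* Required when the next step of the stray [f] ties its target with the longest block: the last
   robot of the target is not leaving it, and is not enabled to do so because it is unsafe. *)
Definition guard a PD f :=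
  ~~ pending PD (adv (run a) f) /\
  (longest a (adv (run a).+1 f) -> forall y, faces a y -> y <> adv (run a) f -> safe a y).

Definition stale_ok a PD :=
  [/\ 1 < run a,
      forall f, stray a PD f -> ~~ R a (flip f) (run a).-1,
      exists x0 m, loser a PD x0 m
    & forall f, stray a PD f -> g a f = 2 -> R a (adv 1 f) (run a).-1 -> guard a PD f].

(** With more than two longest blocks this bound leaves at most one stray after a join. Flags that
    are merely [nearest] are counted too, so that the bound survives a Look. *)
Definition few a PD :=
  #|[pred f | nearest a f || pending PD f]| <= 2 /\ forall f, pending PD f -> direct a f.

(** Since [nlong] is twice the number of longest blocks, strays are tolerated only beside a unique
    one. Two longest blocks need no bound on the number of pending moves, the loser of the next join
    being known. *)
Definition tracked a PD :=
  [/\ [/\ 0 < run a, (run a).+1 < K, [exists h, faces a h] & legal a PD],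
      nlong a != 2 -> forall f, pending PD f -> aimed a f,
      4 < nlong a -> few a PD
    & nlong a == 2 -> (forall f, ~~ stray a PD f) \/ stale_ok a PD].

Lemma pending_unpend PD (o : I) h : pending (unpend PD o) h = (h.1 != o) && pending PD h.
Proof. by rewrite /pending /unpend; case: (h.1 == o). Qed.

Lemma longest_g a x : 0 < run a -> longest a x -> g a x = 1.
Proof. by move=> b0; rewrite /longest -(prednK b0) R_S => /andP[/eqP]. Qed.

Lemma card_flag_le2 (P : pred flag) f h x : #|[pred y | P y]| <= 2 -> P f -> P h -> f <> h -> P x ->
  x = f \/ x = h.
Proof.
move=> c2 Pf Ph nfh Px; case: (eqVneq x f) => [|nxf]; first by left.
case: (eqVneq x h) => [|nxh]; first by right.
have /card_uniqP /= E3 : uniq [:: f; h; x].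
  by rewrite /= !inE (eq_sym f x) (eq_sym h x) (negPf nxf) (negPf nxh) !orbF !andbT; apply/eqP.
suff : 3 <= 2 by [].
rewrite -{1}E3; apply: leq_trans c2; apply: subset_leq_card; apply/subsetP => y.
by rewrite !inE => /or3P[] /eqP->.
Qed.

(** * Moves that leave the set of longest blocks unchanged *)

Section Stay.
Variables (a : I -> nat) (f : flag).
Hypotheses (wa : wf a) (gf : 1 < g a f) (b0 : 0 < run a) (nm : ~~ longest a (flip f)).
Hypothesis (hd : (2 < g a f) || ~~ R a (adv 1 f) (run a).-1).
Let a' := upd a f.

Lemma run_st : run a' = run a. Proof. exact: run_stay. Qed.
Lemma longest_st x : longest a' x = longest a x. Proof. exact: longest_stay. Qed.
Lemma nlong_st : nlong a' = nlong a.
Proof. by apply: eq_card => x; rewrite !inE longest_st. Qed.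

Lemma nmf : ~~ longest a f.
Proof. by apply/negP => /(longest_g b0) H; move: gf; rewrite H. Qed.

(** The delicate gap is the one behind [f]: if it opens from 1 to 2, the robots behind [f] cannot
    form a longest block, since together with [f] they would have formed a longer one. *)
Lemma faces_st x : faces a' x = faces a x.
Proof.
rewrite /faces !longest_st g_upd; case: ifP => [/orP[]/eqP->|_].
- case/orP: hd => [g3|nR]; first by rewrite gf; congr (_ && _); lia.
  have -> : longest a (adv 1 f) = false; last by rewrite !andbF.
  by apply/negbTE; apply: contra nR; apply: R_le; apply: leq_pred.
- by rewrite adv1_opp (negPf nm) /= !andbF.
case: ifP => // /orP[]/eqP->; last by rewrite adv1_bwd (negPf nmf) !andbF.
case: (ltnP 1 (g a (flip f))) => [g2|g1]; first by rewrite ltnS (ltnW g2).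
suff -> : longest a (adv 1 (flip f)) = false by rewrite !andbF.
apply/negbTE/negP => H; have := run_S (flip f) wa; rewrite R_S -/(longest a (adv 1 (flip f))) H andbT.
by case/eqP; have := wa.1 (edge (flip f)); rewrite /g in g1 *; lia.
Qed.

Lemma face_st : [exists h, faces a' h] = [exists h, faces a h].
Proof. by apply: eq_existsb => h; rewrite faces_st. Qed.

Lemma g_faces_st x : faces a x -> x <> f -> x <> flip f -> g a' x = g a x.
Proof.
move=> cx nf nff; rewrite g_upd.
case: ifP => [/orP[]/eqP E|_] //.
  by move: cx; rewrite E /faces adv1_opp (negPf nm) /= !andbF.
case: ifP => // /orP[]/eqP E //.
by move: cx; rewrite E /faces adv1_bwd (negPf nmf) !andbF.
Qed.

Lemma g_f_st : g a' f = (g a f).-1.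
Proof. by rewrite g_upd eqxx. Qed.

Lemma g_flip_st : g a' (flip f) = (g a (flip f)).+1.
Proof.
rewrite g_upd; have /negPf -> : ~~ ((flip f == f) || (flip f == opp f)).
  apply/norP; split; apply/eqP; first exact: flip_neq.
  by move=> E; apply: (@opp_flip_neq _ f).
by rewrite eqxx.
Qed.

Lemma direct_st h : h.1 != f.1 -> direct a' h = direct a h.
Proof.
move=> ne; rewrite /direct !faces_st; case: (boolP (faces a h)) => //= ch.
have hf : h <> f by move=> E; rewrite E eqxx in ne.
have hff : h <> flip f by move=> E; rewrite E eqxx in ne.
rewrite (g_faces_st ch) //; case: (boolP (faces a (flip h))) => //= cfh.
rewrite (g_faces_st cfh) //; first by move=> E; apply: hff; rewrite -(flipK h) E.
by move/(can_inj (@flipK _)).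
Qed.
End Stay.

Section StayKT.
Variables (a : I -> nat) (PD : I -> option bool) (f : flag).
Hypotheses (wa : wf a) (b0 : 0 < run a) (le : legal a PD) (pf : pending PD f).
Hypothesis (hd : (2 < g a f) || ~~ R a (adv 1 f) (run a).-1).
Let a' := upd a f.
Let PD' := unpend PD f.1.
Let gf : 1 < g a f. Proof. by have [] := le pf. Qed.
Let nm : ~~ longest a (flip f). Proof. by have [] := le pf. Qed.

Lemma pending'P h : pending PD' h -> [/\ h.1 <> f.1, pending PD h, h <> f, h <> flip f & h <> opp f].
Proof.
rewrite pending_unpend => /andP[/eqP ne ph]; split=> //.
- by move=> E; case: ne; rewrite E.
- by move=> E; case: ne; rewrite E.
- by move=> E; have [_] := le pf; rewrite -E ph.
Qed.

Lemma g_pending' h : pending PD' h -> g a h <= g a' h.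
Proof.
case/pending'P => _ _ n1 n2 n3; rewrite g_upd; case: ifP => [/orP[]/eqP//|_].
by case: ifP => // _; rewrite leqnSn.
Qed.

Lemma legal_st : legal a' PD'.
Proof.
move=> h ph; have [ne ph0 n1 n2 n3] := pending'P ph; have [l1 l2 l3] := le ph0.
rewrite longest_st // l3; split=> //; first exact: leq_trans (g_pending' ph).
by apply: contra l2; rewrite pending_unpend => /andP[].
Qed.

Lemma aimed_st h : aimed a' h = aimed a h.
Proof. by rewrite /aimed longest_st. Qed.

Lemma stray_st h : stray a' PD' h -> stray a PD h /\ h.1 <> f.1.
Proof. by rewrite /stray aimed_st => /andP[/pending'P[n1 p1 _ _ _] na]; rewrite p1. Qed.

Lemma candE x : nlong a != 2 -> cand a x = faces a x.
Proof. by move=> /negPf E; rewrite /cand E /= andbT. Qed.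

Lemma nearestP x : nlong a != 2 -> nearest a x -> faces a x /\ forall h, faces a h -> g a x <= g a h.
Proof.
move=> m2; rewrite /nearest candE // => /andP[cx /forallP H]; split=> // h ch.
by move/(_ h)/implyP: H; apply; rewrite candE.
Qed.

Lemma nearestI x : nlong a != 2 -> faces a x -> (forall h, faces a h -> g a x <= g a h) -> nearest a x.
Proof.
move=> m2 cx H; rewrite /nearest candE // cx /=; apply/forallP => h; apply/implyP.
by rewrite candE //; apply: H.
Qed.
End StayKT.

Section StayKT2.
Variables (a : I -> nat) (PD : I -> option bool) (f : flag).
Hypotheses (wa : wf a) (b0 : 0 < run a) (le : legal a PD) (pf : pending PD f).
Hypothesis (hd : (2 < g a f) || ~~ R a (adv 1 f) (run a).-1).
Let a' := upd a f.
Let PD' := unpend PD f.1.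
Let gf : 1 < g a f. Proof. by have [] := le pf. Qed.
Let nm : ~~ longest a (flip f). Proof. by have [] := le pf. Qed.

(** After a direct step the new minimum is at most [g a f - 1]. Only flags that were already
    strictly nearer than [f] can compete with [f], and the opposite flag has moved away. *)
Lemma nearest_st x : nlong a != 2 -> direct a f -> nearest a' x -> x <> f -> nearest a x.
Proof.
move=> m2 /andP[cf /implyP cff].
have m2' : nlong a' != 2 by rewrite nlong_st.
case/(nearestP m2') => cx Hx nf; rewrite faces_st // in cx.
have Hf : g a' x <= (g a f).-1 by rewrite -(g_f_st a f); apply: Hx; rewrite faces_st.
have nff : x <> flip f.
  move=> E; move: Hf; rewrite E g_flip_st; move: cff; rewrite -E => /(_ cx); lia.
rewrite (g_faces_st gf b0 nm cx nf nff) in Hx Hf.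
apply: nearestI => // h ch; case: (eqVneq h f) => [->|/eqP nhf]; first by apply: leq_trans Hf (leq_pred _).
case: (eqVneq h (flip f)) => [E|/eqP nhff].
  by move: cff; rewrite -E => /(_ ch); lia.
by have := Hx h; rewrite faces_st // (g_faces_st gf b0 nm ch) //; apply.
Qed.

Lemma nearest_st_min x : nlong a != 2 -> nearest a f -> nearest a' x -> x = f.
Proof.
move=> m2 mf; have m2' : nlong a' != 2 by rewrite nlong_st.
have [cf Hf] := nearestP m2 mf; case/(nearestP m2') => cx Hx; rewrite faces_st // in cx.
apply/eqP; apply/negPn/negP => /eqP nf.
have : g a' x <= (g a f).-1 by rewrite -(g_f_st a f); apply: Hx; rewrite faces_st.
case: (eqVneq x (flip f)) => [E|/eqP nff].
  by rewrite E g_flip_st; have := Hf (flip f); rewrite -E => /(_ cx); lia.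
by rewrite (g_faces_st gf b0 nm cx nf nff); have := Hf x cx; lia.
Qed.

Lemma few_st : nlong a != 2 -> few a PD -> few a' PD'.
Proof.
move=> m2 [c2 Hnd]; split.
  apply: leq_trans c2; apply: subset_leq_card; apply/subsetP => x; rewrite !inE.
  case/orP => [Hm|/(pending'P le pf)[_ -> _ _ _]]; last by rewrite orbT.
  case: (eqVneq x f) => [->|/eqP nf]; first by rewrite pf orbT.
  by rewrite (nearest_st m2 (Hnd f pf) Hm nf).
by move=> h /(pending'P le pf)[ne ph _ _ _]; rewrite direct_st ?Hnd //; apply/eqP.
Qed.

(** The value 0 stands for a robot that faces no longest block; by [faces_st] this status is
    constant as long as the longest blocks are. *)
Definition near (b : I -> nat) (o : I) :=
  let x := (o, true) in let y := (o, false) in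
  if faces b x then (if faces b y then minn (g b x) (g b y) else g b x)
  else if faces b y then g b y else 0.

Lemma nearE b x : near b x.1 =
  if faces b x then (if faces b (flip x) then minn (g b x) (g b (flip x)) else g b x)
  else if faces b (flip x) then g b (flip x) else 0.
Proof.
case: x => o []; rewrite /near /flip //=.
by case: (faces b (o, true)); case: (faces b (o, false)); rewrite // minnC.
Qed.

Definition nearsum (b : I -> nat) := \sum_(o : I) near b o.
Definition ndetour (b : I -> nat) (P : I -> option bool) := #|[pred h | pending P h && ~~ direct b h]|.

Lemma near_other o : o != f.1 -> near a' o = near a o.
Proof.
move=> ne; rewrite /near !faces_st //.
have G p : faces a (o, p) -> g a' (o, p) = g a (o, p).
  by move=> c; apply: g_faces_st => // /(congr1 fst) E; case/eqP: ne.
case: (boolP (faces a (o, true))) => [/G->|_]; case: (boolP (faces a (o, false))) => [/G->|_] //.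
Qed.

Lemma nearsum_st : nearsum a' + (if direct a f then 1 else 0) <= nearsum a + (if direct a f then 0 else 1).
Proof.
rewrite /nearsum (bigD1 f.1) //= [X in _ <= X + _](bigD1 f.1) //=.
rewrite (eq_bigr (near a)); last by move=> o; apply: near_other.
suff : near a' f.1 + (if direct a f then 1 else 0) <= near a f.1 + (if direct a f then 0 else 1) by lia.
rewrite !nearE !faces_st // g_f_st g_flip_st /direct.
case: (boolP (faces a f)) => cf; case: (boolP (faces a (flip f))) => cff /=; try case: ifP; lia.
Qed.

Lemma ndetour_st : ndetour a' PD' + (if direct a f then 0 else 1) <= ndetour a PD.
Proof.
rewrite /ndetour; have [nf|nf] := boolP (direct a f).
  rewrite addn0; apply: subset_leq_card; apply/subsetP => x; rewrite !inE.
  by case/andP => /(pending'P le pf)[/eqP ne -> _ _ _]; rewrite direct_st.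
rewrite (cardD1 f [pred h | pending PD h && ~~ direct a h]) inE pf nf /= addnC leq_add2l.
apply: subset_leq_card; apply/subsetP => x; rewrite !inE.
case/andP => /(pending'P le pf)[ne -> /eqP-> _ _]; rewrite direct_st //; last by apply/eqP.
Qed.

(** A direct step lowers [nearsum] by one. Any other step raises it by at most one but disappears
    from [ndetour], whose factor 2 repays this. *)
Lemma potential_st : nearsum a' + 2 * ndetour a' PD' < nearsum a + 2 * ndetour a PD.
Proof. by have := nearsum_st; have := ndetour_st; case: ifP; lia. Qed.

End StayKT2.
End Tracking.

(** * Late arrivals at an overtaken block *)

Section Stale.
Variable k' : nat.
Notation K := k'.+3.
Notation I := 'I_K.
Notation flag := (flag k').
Implicit Types (f x y h : flag) (a : I -> nat) (i j m : nat) (PD : I -> option bool).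

Lemma self_flip_adv j f : flip (adv j f) <> f.
Proof. by move/(congr1 snd) => /=; case: f.2. Qed.

Lemma advS j f : adv j.+1 f = adv j (adv 1 f).
Proof. by rewrite advD addn1. Qed.

Lemma adv_flip_neq j f : adv j (flip f) <> f.
Proof. by move/(congr1 snd) => /=; case: f.2. Qed.

Lemma adv_opp_neq j f : j.+1 < K -> adv j (flip f) <> opp f.
Proof.
move=> jK; rewrite -(adv1_opp f) advD addn1; exact: adv_neq.
Qed.

Lemma block_rev a x m : block a (flip (adv m x)) m = block a x m.
Proof.
rewrite /block R_rev adv_flip -(g_opp a (flip x)) opp_flip /bwd flipK -/(opp _) g_opp.
by rewrite [_ && (1 < g a (bwd x))]andbC.
Qed.

Lemma block_max a x m m' : block a x m -> R a x m' -> m' <= m.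
Proof.
case/and3P => _ _ gm /RP H; rewrite leqNgt; apply/negP => lt.
by move: gm; rewrite H.
Qed.

Lemma loser_swap a PD x0 m : loser a PD x0 m -> loser a PD (flip (adv m x0)) m.
Proof.
case=> b0 t s; split; first by rewrite block_rev.
  by move=> f /t; rewrite adv_flip flipK => -[->|->]; [right|left].
case: s => [s|s]; [by left|right] => x /s[-> [->|->]]; split=> //.
  by right; rewrite adv_flip flipK.
by left.
Qed.

Section Upd.
Variables (a : I -> nat) (f : flag).
Hypotheses (wa : wf a) (gf : 1 < g a f).
Let a' := upd a f.

Lemma g_up y : y <> f -> y <> opp f -> g a y <= g a' y.
Proof.
move=> n1 n2; rewrite g_upd; case: ifP => [/orP[]/eqP//|_].
by case: ifP => // _; apply: leqnSn.
Qed.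

Lemma block_upd x m : block a x m -> x <> flip f -> adv m x <> f ->
  (g a f = 2 -> adv 1 f <> x /\ adv 1 f <> flip (adv m x)) -> block a' x m.
Proof.
case/and3P => HR g1 g2 n1 n2 n3.
have gf3 : adv 1 f = x \/ adv 1 f = flip (adv m x) -> 1 < g a' f.
  move=> E; rewrite g_upd eqxx /=; have : g a f <> 2 by move=> /n3[? ?]; case: E.
  by lia.
apply/and3P; split; first exact: R_upd_to2.
  case: (eqVneq (bwd x) f) => [E|/eqP ne].
    by rewrite E; apply: gf3; left; rewrite -E adv1_bwd.
  apply: leq_trans g1 (g_up ne _) => E; apply: n1.
  by rewrite -(adv1_bwd x) E adv1_opp.
case: (eqVneq (adv m x) (opp f)) => [E|/eqP ne]; last exact: leq_trans g2 (g_up n2 ne).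
by rewrite E g_opp; apply: gf3; right; rewrite E /opp flipK.
Qed.

Lemma block_exit m : m.+1 < K -> 0 < m -> block a (flip f) m -> block a' (adv 1 (flip f)) m.-1.
Proof.
move=> mK m0 /and3P[HR g1 g2].
have E : m = m.-1.+1 by rewrite prednK.
apply/and3P; split.
- apply: R_upd_to2 => //; first by apply: adv_neq.
    by rewrite advD; apply: adv_flip_neq.
  by move: HR; rewrite E R_S => /andP[].
- rewrite bwd_adv1 g_upd; case: eqP => [/flip_neq//|_].
  by case: eqP => [/esym/opp_flip_neq//|_]; rewrite eqxx /= ltnS; apply: wa.1.
rewrite advD addn1 -E; apply: leq_trans g2 (g_up _ _); first exact: adv_flip_neq.
exact: adv_opp_neq.
Qed.

Lemma block_move1 : 2 < g a f -> block a' (flip f) 0.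
Proof.
move=> g3; rewrite /block R0 adv0 /= /bwd flipK -/(opp f) g_opp g_upd eqxx /=.
apply/andP; split; first by lia.
rewrite g_upd; case: eqP => [/flip_neq//|_].
by case: eqP => [/esym/opp_flip_neq//|_]; rewrite eqxx /= ltnS; apply: wa.1.
Qed.

(** A block one robot short of the record appears by an arrival or by a departure; a departure would
    be from a longest block, which the hypothesis on [flip f] excludes. *)
Lemma block_back x : 1 < run a -> ~~ longest a (flip f) -> block a' x (run a).-1 ->
  block a x (run a).-1 \/
  [/\ g a f = 2, R a (adv 1 f) (run a).-2, block a' x (run a).-1 & (x = f \/ x = flip (adv (run a).-1 f))].
Proof.
move=> b1 nm Hb; have /and3P[HR g1 g2] := Hb.
have nf : ~~ longest a f.
  by apply/negP => /longest_g H; move: gf; rewrite H //; lia.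
case: (R_upd_from wa.1 gf HR) => [HR0|[? _ ? ?]]; last by right; split.
left.
have wit y : R a y (run a).-1 -> 1 < g a' (bwd y) -> 1 < g a (bwd y).
  move=> Hy gy; rewrite ltnNge; apply/negP => le.
  have gy1 : g a (bwd y) = 1 by have := wa.1 (edge (bwd y)); rewrite /g in le *; lia.
  have Hm : longest a (bwd y).
    have b1' : run a = (run a).-1.+1 by lia.
    by rewrite /longest b1' R_S gy1 adv1_bwd.
  move: gy; rewrite g_upd; case: ifP => [_|_]; first by rewrite gy1.
  case: ifP => [/orP[]/eqP E|_]; last by rewrite gy1.
    by case/negP: nm; rewrite -E.
  case/negP: nf; rewrite -{1}(adv1_bwd f) -E adv1_bwd.
  have : R a (bwd y) 2 by apply: R_le Hm.
  have Ey : y = f by rewrite -(adv1_bwd y) E adv1_bwd.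
  by rewrite R_S R1 adv1_bwd Ey => /andP[_ /eqP gf1]; move: gf; rewrite gf1.
apply/and3P; split=> //; first exact: wit.
have bf z : bwd (flip z) = opp z by rewrite /bwd flipK.
by have := wit (flip (adv (run a).-1 x)); rewrite R_rev bf !g_opp; apply.
Qed.
End Upd.

Lemma adv1_inj x y : adv 1 x = adv 1 y -> x = y.
Proof. by move=> E; rewrite -(bwd_adv1 x) E bwd_adv1. Qed.

Lemma nlong2P a w x : nlong a == 2 -> longest a w -> longest a x -> x = w \/ x = flip (adv (run a) w).
Proof.
move=> /eqP m2 mw; apply: card_flag_le2 => //; first by rewrite -/(nlong a) m2.
  by rewrite longest_rev.
by move=> E; apply: (@self_flip_adv (run a) w).
Qed.

Section StaleStay.
Variables (a : I -> nat) (PD : I -> option bool) (f : flag).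
Hypotheses (wa : wf a) (bK : (run a).+1 < K) (le : legal a PD) (pf : pending PD f).
Hypothesis (hd : (2 < g a f) || ~~ R a (adv 1 f) (run a).-1).
Let a' := upd a f.
Let PD' := unpend PD f.1.
Let gf : 1 < g a f. Proof. by have [] := le pf. Qed.
Let nm : ~~ longest a (flip f). Proof. by have [] := le pf. Qed.

(** An arrival that changes no longest block joins a block at least two robots below the record, so
    its target is not a longest one. *)
Lemma stray_f : g a f = 2 -> stray a PD f.
Proof.
move=> g2; rewrite /stray pf /=; move: hd; rewrite g2 /=; apply: contra.
exact: R_le (leq_pred _).
Qed.

Lemma loser_other x0 m h : loser a PD x0 m -> stray a PD f -> adv 1 f = x0 ->
  stray a PD h -> h <> f -> adv 1 h = flip (adv m x0).
Proof.
case=> _ t _ _ E bh nh; case: (t h bh) => // E'; case: nh.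
by rewrite -(bwd_adv1 h) E' -E bwd_adv1.
Qed.

Lemma pending_opp_f h : pending PD h -> h <> opp f.
Proof. by move=> ph E; have [_] := le pf; rewrite -E ph. Qed.

Hypothesis so : stale_ok a PD.
Hypothesis m2 : nlong a == 2.
Let b1 : 1 < run a. Proof. by case: so. Qed.
Let b0 : 0 < run a. Proof. exact: ltnW. Qed.

Lemma btyS h : stray a' PD' h -> [/\ stray a PD h, h.1 <> f.1 & h <> f].
Proof.
case/(stray_st wa b0 le pf hd) => bh ne; split=> //.
by move=> E; case: ne; rewrite E.
Qed.

(** The overtaken block is followed through the step: it grows when [f] arrives, shrinks when [f] is
    one of its ends walking away, and is untouched otherwise. *)
Lemma loser_st : (exists h, stray a' PD' h) -> exists x0 m, loser a' PD' x0 m.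
Proof.
move=> [h0 /btyS[bh0 ne0 nf0]].
case: so => _ B0 [x0 [m L]] _.
have bE : run a' = run a by exact: run_st.
have mK : m.+1 < K.
  have [/and3P[HR _ _] _ _] := L.
  by apply: leq_trans bK; rewrite ltnS ltnS; apply: run_max HR.
(* transfer of the last clause of [loser] when [f] closes no gap *)
have small_keep y0 y1 m1 : 2 < g a f -> block a y0 m ->
    (m = (run a).-1 -> (m1 = m /\ y1 = y0) \/ ~~ R a' y0 m) ->
    (forall f h : flag, stray a PD f -> stray a PD h -> f = h) \/
    (forall x : flag, block a x (run a).-1 -> m = (run a).-1 /\ (x = y0 \/ x = flip (adv m y0))) ->
    (forall f h : flag, stray a' PD' f -> stray a' PD' h -> f = h) \/
    (forall x : flag, block a' x (run a').-1 -> m1 = (run a').-1 /\ (x = y1 \/ x = flip (adv m1 y1))).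
  move=> g3 bl Hx [s|s]; first by left=> y z /btyS[? _ _] /btyS[? _ _]; apply: s.
  right=> x; rewrite bE => Hb; have /and3P[HR _ _] := Hb.
  case: (block_back wa gf b1 nm Hb) => [Ha|[g2 _ _ _]]; last by rewrite g2 in g3.
  have [Em Ex] := s x Ha.
  case: (Hx Em) => [[-> ->] //|/negP[]].
  by rewrite -Em in HR; case: Ex HR => -> //; rewrite R_rev.
have [g2|g3] : g a f = 2 \/ 2 < g a f by lia.
  have bf := stray_f g2.
  have {L} [x1 [L Ex]] : exists x1, loser a PD x1 m /\ adv 1 f = x1.
    have [_ t _] := L; case: (t f bf) => E; first by exists x0.
    by exists (flip (adv m x0)); split=> //; apply: loser_swap.
  have [/and3P[HR gb ga] t s] := L.
  have nbm : m < (run a).-1.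
    rewrite ltnNge; apply/negP => le1; move: hd; rewrite g2 /=; case/negP.
    by apply: R_le le1 _; rewrite Ex.
  exists f, m.+1; split.
  - apply/and3P; split; first by apply: R_upd_join; rewrite ?Ex.
      apply: leq_trans (_ : 1 < (g a (bwd f)).+1) _; first by rewrite ltnS; apply: wa.1.
      rewrite g_upd; case: eqP => [E|_]; first by case: (@adv_neq _ 1 f); rewrite // -{1}E adv1_bwd.
      case: eqP => [E|_] /=; first by have := congr1 snd E; rewrite bwdE /=; case: f.2.
      by rewrite eqxx orbT.
    rewrite advS Ex; apply: (leq_trans ga); apply: g_up.
      by rewrite -Ex advD addn1; apply: adv_neq; lia.
    by move/(congr1 snd); rewrite -Ex /=; case: f.2.
  - move=> h /btyS[bh _ nh]; right; rewrite (loser_other L bf Ex bh nh).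
    by rewrite advS Ex.
  case: s => [s|s]; first by left=> y z /btyS[? _ _] /btyS[? _ _]; apply: s.
  right=> x; rewrite bE => Hb; case: (block_back wa gf b1 nm Hb) => [Ha|[_ HR2 _ Hx]].
    by have [Em _] := s x Ha; rewrite Em ltnn in nbm.
  have Em : m.+1 = (run a).-1.
    apply/eqP; rewrite eqn_leq nbm /=.
    have bl : block a x1 m by case: L.
    have := @block_max a x1 m (run a).-2 bl; rewrite -Ex => /(_ HR2).
    by move: b1; case: (run a) => [|[]].
  by split=> //; case: Hx => ->; [left|right]; rewrite ?Em.
have gff : 1 < g a' (flip f) by rewrite g_flip_st ltnS; apply: wa.1.
have [[x1 [L1 Ex]]|[n1 n2]] : (exists x1, loser a PD x1 m /\ x1 = flip f) \/
    (x0 <> flip f /\ adv m x0 <> f).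
  case: (eqVneq x0 (flip f)) => [E|/eqP n1]; first by left; exists x0.
  case: (eqVneq (adv m x0) f) => [E|/eqP n2]; last by right.
  by left; exists (flip (adv m x0)); split; [apply: loser_swap|rewrite E].
  have [bl t s] := L1; rewrite Ex in bl t s.
  have [m0|m0] := posnP m.
    exists (flip f), 0; split; first exact: block_move1.
      by move=> h /btyS[bh _ _]; have := t h bh; rewrite m0.
    by apply: small_keep g3 bl _ s; rewrite m0; lia.
  exists (adv 1 (flip f)), m.-1; split; first exact: block_exit.
    move=> h /btyS[bh _ _]; right; rewrite -advS prednK //.
    case: (t h bh) => // E; case: (@pending_opp_f h); first by case/andP: bh.
    by rewrite -(bwd_adv1 h) E /bwd flipK.
  apply: small_keep g3 bl _ s => _; right; rewrite -(prednK m0) R_S.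
  by case: eqP gff => // ->.
have [bl t s] := L; exists x0, m; split.
- by apply: block_upd => // g2; rewrite g2 in g3.
- by move=> h /btyS[bh _ _]; apply: t.
by apply: small_keep g3 bl _ s; left.
Qed.

Lemma stale_st : (exists h, stray a' PD' h) -> stale_ok a' PD'.
Proof.
move=> ex; have Ls := loser_st ex.
have bE : run a' = run a by exact: run_stay.
have mE x : longest a' x = longest a x by exact: longest_stay.
have [_ B0 [x0 [m L]] G] := so.
have [bl t s] := L.
have B0' h : stray a' PD' h -> ~~ R a' (flip h) (run a').-1.
  move=> /btyS[bh ne nh]; rewrite bE; apply/negP.
  case/(R_upd_from wa.1 gf) => [|[g2 _ _ [E|E]]]; first exact/negP/B0.
    by case: ne; rewrite -E.
  have bf := stray_f g2.
  have Eh : h = adv (run a).-1 f by apply: (can_inj (@flipK _)).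
  have dh : h.2 = f.2 by rewrite Eh.
  (* The loser has one end for each direction, so two strays with the same direction aim at the same
     end and coincide. *)
  have tf := t f bf; have th := t h bh.
  have dx : (flip (adv m x0)).2 <> x0.2 by move=> /=; case: x0.2.
  have : (adv 1 h).2 = (adv 1 f).2 by rewrite !advE.
  case: tf th => Ef [] Eh'; rewrite ?Ef ?Eh' => Ed.
  - by apply: nh; apply: adv1_inj; rewrite Ef.
  - by case: dx.
  - by case: dx.
  - by apply: nh; apply: adv1_inj; rewrite Ef.
split; rewrite ?bE //; first by move=> h /B0'; rewrite bE.
move=> h bh' g2h HR; have [bh ne nh] := btyS bh'.
have /andP[ph' na'] := bh'.
have /andP[ph na] := bh.
have [lh1 lh2 lh3] := le ph.
have g2h0 : g a h = 2.
  by apply/eqP; rewrite eqn_leq lh1 andbT -g2h; apply: (g_pending' le pf).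
rewrite /guard bE; case/(R_upd_from wa.1 gf): HR => [HR|[g2 _ HR E]].
  have [np ok] := G h bh g2h0 HR.
  split; first by apply: contra np; rewrite pending_unpend => /andP[].
  rewrite mE => mw y; rewrite faces_st // => cy ny.
  have := ok mw y cy ny; rewrite /safe !bE; apply: contra => /and3P[H1 H2 H3].
  have mw' : longest a (adv 1 (adv (run a) h)) by rewrite advD add1n.
  (* With [y] unsafe after the step no [f] is possible. If aimed, it is the guarded far end, which
     is not pending, or [y] itself, which has just opened the gap behind it; if stray, it would be
     leaving the longest block. *)
  case: (boolP (aimed a f)) => [af|naf].
    case: (nlong2P m2 mw' af) => [/adv1_inj Ef|Ef].
      by case/negP: np; rewrite -Ef.
    have /and3P[_ my1 _] := cy.
    case: (nlong2P m2 mw' my1) => [/adv1_inj //|Ey].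
    have Eyf : y = f by apply: adv1_inj; rewrite Ey.
    have Eb : (run a).-1 = (run a).-2.+1 by move: b1; case: (run a) => [|[]].
    move: H1; rewrite Eyf Eb.
    have gff : g a' (flip f) = (g a (flip f)).+1 := g_flip_st a f.
    rewrite R_S gff eqSS => /andP[/eqP g0 _].
    by have := wa.1 (edge (flip f)); rewrite -/(g a (flip f)) g0.
  have bf : stray a PD f by rewrite /stray pf.
  have {t s} [x1 [L1 Eh]] : exists x1, loser a PD x1 m /\ adv 1 h = x1.
    case: (t h bh) => Eh; first by exists x0.
    by exists (flip (adv m x0)); split=> //; apply: loser_swap.
  have [bl1 t1 _] := L1; have /and3P[HRm _ _] := bl1.
  have Em : m = (run a).-1.
    apply/eqP; rewrite eqn_leq (block_max bl1) ?andbT -?Eh //.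
    rewrite -ltnS prednK // ltnNge; apply/negP => lebm.
    by case/negP: na; rewrite /aimed Eh; apply: R_le lebm HRm.
  case: (t1 f bf) => Ef; first by case: nh; apply: adv1_inj; rewrite Eh.
  case/negP: nm; suff -> : flip f = adv 1 (adv (run a) h) by [].
  have -> : f = opp (adv (run a) h).
    by apply: adv1_inj; rewrite adv1_opp Ef -Eh Em -advS prednK.
  by rewrite /opp flipK.
have bf := stray_f g2.
case: E => E.
  have Eh : h = bwd f by rewrite -E bwd_adv1.
  move: g2h; rewrite Eh g_upd; case: eqP => [E'|_].
    by case: nh; rewrite Eh.
  case: eqP => [E'|_] /=.
    by have := @pending_opp_f h ph; rewrite Eh.
  by rewrite eqxx orbT => -[E2]; move: lh1; rewrite Eh E2.
have Ex : adv (run a) h = flip f.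
  have b0' : run a = (run a).-1.+1 by rewrite prednK.
  by rewrite b0' advS E adv_flip.
rewrite Ex; split; first by rewrite pending_unpend eqxx.
move=> _ y cy ny; rewrite /safe !bE; apply/negP => /and3P[H1 /eqP H2 H3].
have /and3P[gy my _] := cy.
have Hb : block a' (flip y) (run a).-1.
  by apply/and3P; split; rewrite ?H2 // /bwd flipK -/(opp y) g_opp.
case: (block_back wa gf b1 nm Hb) => [Ha|[_ _ _ [Ey|Ey]]].
- case: s => [s|s]; first by case: nh; apply: s.
  have [Em _] := s _ Ha; move: hd; rewrite g2 /= => /negP[]; rewrite -Em.
  by have /and3P[HRm _ _] := bl; case: (t f bf) => ->; rewrite ?R_rev.
- by case: ny; rewrite -Ey flipK.
have Eyh : y = opp h by rewrite -(flipK y) Ey -E.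
by move: my; rewrite Eyh adv1_opp mE (negPf lh3).
Qed.
End StaleStay.
End Stale.

(** * Moves that make the longest block grow *)

Section Joins.
Variable k' : nat.
Notation K := k'.+3.
Notation I := 'I_K.
Notation flag := (flag k').
Implicit Types (f x y h : flag) (a : I -> nat) (i j m : nat) (PD : I -> option bool).

Lemma tracked_stay a PD f : wf a -> tracked a PD -> pending PD f ->
  (2 < g a f) || ~~ R a (adv 1 f) (run a).-1 -> tracked (upd a f) (unpend PD f.1).
Proof.
move=> wa [[b0 bK ex le] t2 t4 t1] pf hd.
have [gf _ nm] := le f pf.
split; rewrite ?nlong_st //.
- by rewrite run_st // face_st //; split=> //; apply: legal_st.
- by move=> m2 h /(pending'P le pf)[_ ph _ _ _]; rewrite (aimed_st wa b0 le pf hd); apply: t2.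
- move=> m4; apply: few_st => //; last exact: t4.
  by apply/eqP => E; rewrite E in m4.
move=> m2; case: (boolP [exists h, stray (upd a f) (unpend PD f.1) h]) => [/existsP ex'|]; last first.
  by rewrite negb_exists => /forallP; left.
right; apply: stale_st => //; case: (t1 m2) => // nb.
by case: ex' => h /(stray_st wa b0 le pf hd)[bh _]; move: (nb h); rewrite bh.
Qed.

Section Join.
Variables (a : I -> nat) (PD' : I -> option bool) (f : flag).
Hypotheses (wa : wf a) (b0 : 0 < run a) (bK : (run a).+2 < K).
Hypotheses (g2 : g a f = 2) (mf : longest a (adv 1 f)).
Let a' := upd a f.
Let bK1 : (run a).+1 < K. Proof. exact: ltnW. Qed.
Let gf : 1 < g a f. Proof. by rewrite g2. Qed.

(** What the earlier invariant has to provide: [Hp] is legality without the executed move, [Hm] says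
    that no other pending robot leaves the extended block or a block of the former record length. *)
Hypothesis Hp : forall h, pending PD' h ->
  [/\ h.1 <> f.1, 1 < g a h, h <> opp f & ~~ pending PD' (opp h)].
Hypothesis Hm : forall h, pending PD' h -> h <> adv (run a).+1 f /\ ~~ R a' (flip h) (run a).

Lemma run_j : run a' = (run a).+1. Proof. exact: run_join. Qed.
Lemma longest_j x : longest a' x = (x == f) || (x == flip (adv (run a).+1 f)).
Proof. exact: longest_join. Qed.

Lemma nlong_j : nlong a' = 2.
Proof.
have /card_uniqP /= <- : uniq [:: f; flip (adv (run a).+1 f)].
  by rewrite /= inE andbT; apply/eqP => /esym/self_flip_adv.
by apply: eq_card => x; rewrite !inE; apply: longest_j.
Qed.

Lemma g_pending_j h : pending PD' h -> g a h <= g a' h.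
Proof.
move=> /Hp[n1 _ n2 _]; apply: g_up => // E; by apply: n1; rewrite E.
Qed.

Lemma legal_j : legal a' PD'.
Proof.
move=> h ph; have [n1 gh n2 n3] := Hp ph; split=> //.
  exact: leq_trans gh (g_pending_j ph).
rewrite longest_j; apply/norP; split; apply/eqP => E; first by apply: n1; rewrite -E.
by case: (Hm ph) => n4 _; apply: n4; apply: (can_inj (@flipK _)).
Qed.

Lemma face_j : [exists h, faces a' h].
Proof.
apply/existsP; exists (bwd f); rewrite /faces adv1_bwd !longest_j eqxx /=.
have fb : flip (bwd f) = adv 1 (flip f) by rewrite /bwd flipK.
apply/andP; split.
  rewrite g_upd; case: eqP => [E|_]; first by case: (@adv_neq _ 1 f); rewrite // -{1}E adv1_bwd.
  case: eqP => [E|_] /=; first by have := congr1 snd E; rewrite bwdE /=; case: f.2.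
  by rewrite eqxx orbT ltnS; apply: wa.1.
apply/norP; split; apply/eqP; rewrite fb.
  by move/(congr1 snd) => /=; case: f.2.
move=> E; have := @adv_neq _ (run a).+2 (flip f) => /(_ ltac:(lia)); case.
by rewrite advS E adv_flip.
Qed.

Lemma tracked_join : ((forall f, ~~ stray a' PD' f) \/ stale_ok a' PD') -> tracked a' PD'.
Proof.
move=> t1; split; rewrite ?nlong_j //; split; rewrite ?run_j //.
- exact: face_j.
- exact: legal_j.
Qed.

Lemma old_run_j x : R a' x (run a) ->
  [\/ longest a x, x = f | x = flip (adv (run a) f)].
Proof.
case/(R_upd_from wa.1 gf) => [H|[_ _ _ [->|->]]]; by [apply: Or31|apply: Or32|apply: Or33].
Qed.

Lemma gap_in : g a (adv (run a) f) = 1.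
Proof.
have E : run a = (run a).-1.+1 by rewrite prednK.
rewrite E advS; move/RP: mf; apply; lia.
Qed.

Lemma gap_in' : g a' (adv (run a) f) = 1.
Proof.
have /RP H := R_upd_join gf bK1 g2 mf.
by apply: H.
Qed.

(** Such a block is a former rival: any other run of this length lies in the extended block, where a
    neighbouring gap is 1. *)
Lemma block_j x : block a' x (run a) ->
  [/\ longest a x, x <> adv 1 f & x <> flip (adv (run a).+1 f)].
Proof.
case/and3P => HR gb ga.
have n1 : x <> adv 1 f.
  by move=> E; move: gb; rewrite E bwd_adv1 g_upd eqxx g2.
have n2 : x <> flip (adv (run a).+1 f).
  move=> E; move: ga; rewrite E adv_flip_le ?leqnSn // subSnn.
  by rewrite -/(opp f) g_opp g_upd eqxx g2.
case: (old_run_j HR) => // E.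
  by move: ga; rewrite E gap_in'.
move: gb; rewrite E /bwd flipK -/(opp _) g_opp gap_in' //.
Qed.

Lemma stray_j h : stray a' PD' h ->
  [/\ pending PD' h, adv 1 h <> f & adv 1 h <> flip (adv (run a).+1 f)].
Proof. by case/andP => ph; rewrite /aimed longest_j => /norP[/eqP n1 /eqP n2]. Qed.

Lemma target_j h : stray a' PD' h -> R a' (adv 1 h) (run a) -> longest a (adv 1 h).
Proof.
case/stray_j => ph n1 n2 /old_run_j[//|//|E].
have [_ gh _ _] := Hp ph; move: gh.
have -> : h = opp (adv (run a) f) by apply: adv1_inj; rewrite adv1_opp.
by rewrite g_opp gap_in.
Qed.

Lemma safe_block y : faces a' y -> ~~ safe a' y -> block a' (flip y) (run a')%N.-1.
Proof.
move=> /and3P[gy _ _]; rewrite /safe negbK => /and3P[H1 /eqP H2 _].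
by apply/and3P; split; rewrite ?H2 // /bwd flipK -/(opp y) g_opp.
Qed.

Hypothesis Hq : forall h, pending PD' h -> adv (run a).+1 h <> f.
Hypothesis Ht : forall h, pending PD' h -> longest a (adv 1 h).

Lemma block_target h : stray a' PD' h -> block a' (adv 1 h) (run a).
Proof.
case/stray_j => ph n1 n2; have [nr gh no _] := Hp ph.
apply/and3P; split.
- apply: R_upd_to2 => //; last exact: Ht.
    by move=> E; apply: no; apply: adv1_inj; rewrite adv1_opp -E.
  by rewrite -advS; apply: Hq.
- by rewrite bwd_adv1; apply: leq_trans gh (g_pending_j ph).
apply: (leq_trans (longest_gap wa (Ht ph))); apply: g_up; first by rewrite -advS; apply: Hq.
move=> E; apply: n2; rewrite (advS (run a) f); apply: (can_inj (@flipK _)).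
by rewrite flipK -(adv_flip (run a) (adv 1 h)) E /opp flipK.
Qed.

Lemma far_idle h : stray a' PD' h -> R a' (adv 1 h) (run a) -> ~~ pending PD' (adv (run a).+1 h).
Proof.
move=> bh HR; apply/negP => /Hm[_ /negP[]].
by rewrite advS R_rev; exact: HR.
Qed.

(** A single stray makes the last clause of [loser] immediate, and its target is a former longest
    block left intact by the join. Only the safety half of [guard] has to be supplied. *)
Lemma stale_one : (exists h, stray a' PD' h) ->
  (forall x h, stray a' PD' x -> stray a' PD' h -> x = h) ->
  (forall h, stray a' PD' h -> g a h = 2 -> longest a' (adv (run a).+2 h) ->
    forall y, faces a' y -> y <> adv (run a).+1 h -> safe a' y) ->
  stale_ok a' PD'.
Proof.
move=> [h0 bh0] u1 Hg; split; rewrite ?run_j //=.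
- by move=> h /stray_j[/Hm[]].
- exists (adv 1 h0), (run a); split; first exact: block_target.
    by move=> h bh; left; rewrite (u1 h h0).
  by left.
move=> h bh g2h HR; rewrite /guard run_j; split; first exact: far_idle.
apply: Hg => //; have /stray_j[ph _ _] := bh; have [_ gh _ _] := Hp ph.
by apply/eqP; rewrite eqn_leq gh andbT -g2h; apply: g_pending_j.
Qed.

(** The loser is the only other former longest block, so every stray aims at it and no other block
    is one short of the record. An unsafe robot would be one of its ends: the near end looks at the
    stray, not at a longest block, and [guard] exempts the far end. *)
Lemma stale_two : (exists h, stray a' PD' h) -> nlong a <= 4 -> stale_ok a' PD'.
Proof.
move=> [h0 bh0] m4.
pose w := adv 1 f; pose x0 := adv 1 h0.
have [ph0 n1 n2] := stray_j bh0; have [nr _ _ _] := Hp ph0.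
have n2' : x0 <> flip (adv (run a) w) by rewrite -advS.
have n3 : x0 <> w by move=> /adv1_inj E; apply: nr; rewrite E.
have rv y z : flip (adv (run a) y) = flip (adv (run a) z) -> y = z.
  by move=> E; apply: (can_inj (@flipK _)); rewrite -(adv_flip (run a) y) E adv_flip.
have H4 x : longest a x -> x <> w -> x <> flip (adv (run a) w) -> x = x0 \/ x = flip (adv (run a) x0).
  move=> mxx d1 d2; case: (eqVneq x x0) => [|/eqP d3]; first by left.
  case: (eqVneq x (flip (adv (run a) x0))) => [|/eqP d4]; first by right.
  have /card_uniqP /= E5 : uniq [:: x; w; flip (adv (run a) w); x0; flip (adv (run a) x0)].
    rewrite /= !inE !negb_or andbT; repeat (apply/andP; split); apply/eqP => //.
    - by move/esym/self_flip_adv.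
    - by move/esym.
    - by move=> E; apply: n2'; rewrite E adv_flip flipK.
    - by move/esym.
    - by move/rv/esym.
    - by move/esym/self_flip_adv.
  suff : 5 <= 4 by [].
  rewrite -{1}E5; apply: leq_trans m4; apply: subset_leq_card; apply/subsetP => y.
  have mw : longest a w by [].
  have mx0 : longest a x0 by apply: Ht.
  by rewrite !inE => /orP[/eqP->|/or4P[] /eqP->]; rewrite ?longest_rev.
have tgt h : stray a' PD' h -> adv 1 h = x0 \/ adv 1 h = flip (adv (run a) x0).
  move=> /stray_j[ph m1 m2]; have [nr' _ _ _] := Hp ph.
  apply: H4; first exact: Ht.
    by move=> /adv1_inj E; apply: nr'; rewrite E.
  by rewrite -advS.
have clause x : block a' x (run a) -> x = x0 \/ x = flip (adv (run a) x0).
  by case/block_j => mxx d1 d2; apply: H4; rewrite -?advS.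
split; rewrite ?run_j //=.
- by move=> h /stray_j[/Hm[]].
- exists x0, (run a); split; [exact: block_target | exact: tgt |].
  by right=> x; rewrite run_j /= => /clause.
move=> h bh g2h HR; rewrite /guard run_j; split; first exact: far_idle.
move=> mw' y cy ny; apply: contraT => nok.
have := safe_block cy nok; rewrite run_j /= => /clause Ey.
have [ph _ _] := stray_j bh; have [_ _ lh] := legal_j ph.
have {Ey} [Ey|Ey] : flip y = adv 1 h \/ flip y = flip (adv (run a) (adv 1 h)).
  case: Ey (tgt h bh) => -> [] ->; rewrite ?adv_flip ?flipK; by [left|right].
- have Eyh : y = opp h by rewrite /opp -Ey flipK.
  by move: cy; rewrite Eyh /faces adv1_opp (negPf lh) andbF.
by case: ny; rewrite (advS (run a) h); apply: (can_inj (@flipK _)).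
Qed.

Lemma risky_free y : ~~ longest a (flip f) -> faces a' y -> ~~ safe a' y ->
  let t := opp (adv (run a) (flip y)) in
  [/\ faces a t, g a t = 2, t <> f & adv 1 t = flip (adv (run a) (flip y))].
Proof.
move=> nm cy nok; have := safe_block cy nok; rewrite run_j /= => /block_j[my n1 n2].
move: nok; rewrite /safe negbK run_j /= => /and3P[_ /eqP g2z nR].
have gz := longest_gap wa my.
have gz2 : g a (adv (run a) (flip y)) = 2.
  move: g2z; rewrite g_upd; case: ifP => [/orP[]/eqP->|_]; rewrite ?g_opp ?g2 //.
  by case: ifP => // _ [E]; rewrite E in gz.
have E1 : adv 1 (opp (adv (run a) (flip y))) = flip (adv (run a) (flip y)) by rewrite adv1_opp.
have nf : opp (adv (run a) (flip y)) <> f.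
  by move=> E; apply: n2; rewrite (advS (run a) f) -E E1 adv_flip flipK.
split=> //; last by rewrite g_opp.
rewrite /faces g_opp gz2 E1 longest_rev my /=.
have Ef : flip (opp (adv (run a) (flip y))) = adv (run a).+1 (flip y).
  by rewrite /opp flipK advD add1n.
rewrite Ef; apply: contra nR => HR; apply: R_upd_to2 => //.
  by move=> E; case/negP: nm; rewrite -E.
by move=> E; case/negP: nm; rewrite -E longest_rev.
Qed.
End Join.
End Joins.

Section KTsteps.
Variable k' : nat.
Notation K := k'.+3.
Notation I := 'I_K.
Notation flag := (flag k').
Implicit Types (f x y h : flag) (a : I -> nat) (i j m : nat) (PD : I -> option bool).

Lemma adv_mod j f : adv (j %% K) f = adv j f.
Proof.
rewrite {2}(divn_eq j K) addnC -advD; congr adv; elim: (j %/ K) => [|q IH]; first by rewrite adv0.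
by rewrite mulSn -advD -IH advK.
Qed.

(** An even multiple of the odd number [K] below [2 * K] is 0. Hence two equal blocks never fill the
    ring of robots, and two distinct reflections of the same kind never compose to the identity. *)
Lemma dbl_id j f : odd K -> j < K -> adv (j + j) f = f -> j = 0.
Proof.
move=> oddK jK; rewrite -adv_mod => E0.
have E : (j + j) %% K = 0 by apply: (@adv_inj _ _ _ f); rewrite ?ltn_pmod ?adv0.
have /dvdnP[q Eq] : K %| j + j by apply/eqP.
case: q Eq => [|[|q]] Eq; first by lia.
  by move: oddK; rewrite -(mul1n K) -Eq addnn odd_double.
by move: Eq; rewrite mulnC !mulnS; lia.
Qed.

(** The neighbours of the block lie outside it, as it does not contain all robots, and there is no
    other longest block to which they could belong. *)
Lemma longest_ends a w : wf a -> longest a w -> (run a).+1 < K -> nlong a == 2 ->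
  faces a (bwd w) /\ faces a (opp (adv (run a) w)).
Proof.
move=> wa mw bK m2.
have H z : longest a z -> faces a (bwd z).
  move=> mz; rewrite /faces longest_bwd_gap // adv1_bwd mz /=; apply/negP => H.
  case: (nlong2P m2 mz H) => [E|/(can_inj (@flipK _)) E].
    by have := congr1 snd E; rewrite flipE bwdE; case: z.2.
  by apply: (@adv_neq _ (run a).+1 z) => //; rewrite -add1n -advD -E adv1_bwd.
split; first exact: H.
have -> : opp (adv (run a) w) = bwd (flip (adv (run a) w)) by rewrite /bwd flipK.
by apply: H; rewrite longest_rev.
Qed.

Section JoinLegal.
Variables (a : I -> nat) (PD : I -> option bool) (f : flag).
Hypotheses (wa : wf a) (le : legal a PD) (pf : pending PD f).

Lemma pending_unpend_legal h : pending (unpend PD f.1) h ->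
  [/\ h.1 <> f.1, 1 < g a h, h <> opp f & ~~ pending (unpend PD f.1) (opp h)].
Proof.
move=> ph; have [n1 ph0 _ _ n2] := pending'P le pf ph; have [g1 l2 _] := le ph0; split=> //.
by apply: contra l2; rewrite pending_unpend => /andP[].
Qed.

Lemma pending_unpend_far h : 0 < run a -> g a f = 2 -> longest a (adv 1 f) -> (run a).+2 < K ->
  pending (unpend PD f.1) h -> h <> adv (run a).+1 f /\ ~~ R (upd a f) (flip h) (run a).
Proof.
move=> b0 g2 mf bK ph.
have [n1 ph0 _ _ n2] := pending'P le pf ph; have [gh l2 l3] := le ph0; split.
  by move=> E; case/negP: l3; rewrite E (advS (run a) f) longest_rev.
apply/negP => /(old_run_j wa g2)[|E|/(can_inj (@flipK _)) E]; first exact/negP.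
  by apply: n1; rewrite -E.
by move: gh; rewrite E gap_in.
Qed.
End JoinLegal.

Section JoinKT.
Variables (a : I -> nat) (PD : I -> option bool) (f : flag).
Hypotheses (wa : wf a) (kt : tracked a PD) (pf : pending PD f) (g2 : g a f = 2).
Let b0 : 0 < run a. Proof. by case: kt => -[]. Qed.
Let bK1 : (run a).+1 < K. Proof. by case: kt => -[]. Qed.
Let le : legal a PD. Proof. by case: kt => -[]. Qed.
Let nm : ~~ longest a (flip f). Proof. by have [] := le pf. Qed.
Let gf : 1 < g a f. Proof. by rewrite g2. Qed.
Let a' := upd a f.
Let PD' := unpend PD f.1.
Let pcl := pending_unpend_legal le pf.

Section Join.
Hypotheses (mf : longest a (adv 1 f)) (bK : (run a).+2 < K).
Let pcf h := pending_unpend_far wa le pf b0 g2 mf bK (h := h).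

(** When the unique longest block grows, no block of the former record length remains and no stray
    can tie with it; it suffices to follow the overtaken block. *)
Lemma tracked_join_two : nlong a == 2 -> tracked a' PD'.
Proof.
move=> m2; apply: tracked_join => //.
case: (boolP [exists h, stray a' PD' h]) => [/existsP[h0 bh0]|]; last first.
  by rewrite negb_exists => /forallP; left.
have obt h : stray a' PD' h -> [/\ stray a PD h, h <> f, h <> opp f & adv 1 h <> f].
  move=> /(stray_j wa bK g2 mf)[ph n1 n2]; have [n0 ph0 n3 _ n4] := pending'P le pf ph.
  split=> //; rewrite /stray ph0 /=; apply/negP => /(nlong2P m2 mf)[/adv1_inj //|].
  by rewrite -advS.
right; have [_ _ _ /(_ m2)[nb|[b1 B0 [x0 [m L]] G]]] := kt.
  by have [] := obt _ bh0; rewrite (negPf (nb h0)).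
have bE : run a' = (run a).+1 by apply: run_j.
split; rewrite ?bE /=.
- by [].
- by move=> h /(stray_j wa bK g2 mf)[/pcf[]].
- have vac : forall x, ~ block a' x (run a).
    move=> x /(block_j wa bK g2 mf)[mxx n1]; rewrite (advS (run a) f).
    by case: (nlong2P m2 mf mxx).
  suff [x1 [m1 [H1 H2]]] : exists x1 m1, block a' x1 m1 /\
      forall h, stray a' PD' h -> adv 1 h = x1 \/ adv 1 h = flip (adv m1 x1).
    exists x1, m1; split=> //; right=> x; rewrite bE /= => H; by case: (vac x).
  have exit x1 : loser a PD x1 m -> x1 = flip f -> exists x1 m1, block a' x1 m1 /\
      forall h, stray a' PD' h -> adv 1 h = x1 \/ adv 1 h = flip (adv m1 x1).
    case=> bl t _ E; rewrite E in bl t.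
    have [m0|m0] := posnP m.
      have [bh _ n3 n4] := obt _ bh0.
      case: (t h0 bh); rewrite ?m0 ?adv0 ?flipK => // E1; case: n3.
      by apply: adv1_inj; rewrite adv1_opp.
    exists (adv 1 (flip f)), m.-1; split.
      apply: block_exit => //; case/and3P: bl => HR _ _.
      by apply: leq_trans bK1; rewrite !ltnS; apply: run_max HR.
    move=> h /obt[bh _ n3 n4]; right; rewrite -advS prednK //.
    by case: (t h bh) => // E1; case: n3; apply: adv1_inj; rewrite adv1_opp.
  case: (eqVneq x0 (flip f)) => [E|/eqP n1]; first exact: exit E.
  case: (eqVneq (adv m x0) f) => [E|/eqP n2].
    by apply: (exit (flip (adv m x0))); [apply: loser_swap|rewrite E].
  have [bl t _] := L; exists x0, m; split; last by move=> h /obt[bh _ _ _]; apply: t.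
  have [bh nf _ _] := obt _ bh0; have /andP[_ /negP na] := bh.
  have key x1 : block a x1 m -> adv 1 h0 = x1 \/ adv 1 h0 = flip (adv m x1) -> adv 1 f <> x1.
    move=> bl1 [E1|E1] E2; first by apply: nf; apply: adv1_inj; rewrite E1.
    apply: na; have /and3P[HR _ _] := bl1.
    have Em : m = run a.
      by apply/eqP; rewrite eqn_leq (run_max wa HR) (block_max bl1) // -E2.
    by rewrite /aimed E1 Em longest_rev -E2.
  apply: block_upd => // _; split; first by apply: key (t _ bh).
  by apply: key; rewrite ?block_rev ?adv_flip ?flipK //; case: (t _ bh); [right|left].
move=> h bh _ HR; have [/andP[_ /negP na] _ _ _] := obt _ bh.
by case: na; apply: (target_j wa b0 bK g2 mf pcl).
Qed.

(** Two longest blocks leave one loser. With more of them [few] leaves one stray, and a robot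
    endangering its guard would be a third flag that is nearest or pending. *)
Lemma tracked_join_many : nlong a != 2 -> tracked a' PD'.
Proof.
move=> m2; apply: tracked_join => //.
have [_ /(_ m2) t2 t4 _] := kt.
case: (boolP [exists h, stray a' PD' h]) => [/existsP ex|]; last first.
  by rewrite negb_exists => /forallP; left.
right.
have Ht h : pending PD' h -> longest a (adv 1 h).
  by case/(pending'P le pf) => _ /t2.
have Hq h : pending PD' h -> adv (run a).+1 h <> f.
  by move=> /Ht mh E; case/negP: nm; rewrite -E (advS (run a) h) longest_rev.
have [m4|m4] := leqP (nlong a) 4.
  by apply: stale_two => //.
have [c2 _] := t4 m4.
have ob h : stray a' PD' h -> pending PD h /\ h <> f.
  by move=> /(stray_j wa bK g2 mf)[/(pending'P le pf)[_ ? ? _ _] _ _].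
apply: stale_one => //.
  move=> x h /ob[px nx] /ob[ph nh].
  have [//|//] : x = f \/ x = h.
  apply: (@card_flag_le2 _ (fun y => nearest a y || pending PD y) f h x c2); rewrite ?pf ?px ?ph ?orbT //.
  by move=> E; apply: nh.
move=> h bh g2h _ y cy ny; apply: contraT => nok.
have [ph nh] := ob h bh.
have [ct gt nt Et] := risky_free wa bK g2 mf nm cy nok.
move: (opp _) ct gt nt Et => t ct gt nt Et.
have mt : nearest a t.
  by apply: nearestI => // z /and3P[gz _ _]; rewrite gt.
have [//|E] : t = f \/ t = h.
  apply: (@card_flag_le2 _ (fun y => nearest a y || pending PD y) f h t c2); rewrite ?pf ?ph ?mt ?orbT //.
  by move=> E; apply: nh.
case: ny; rewrite (advS (run a) h) -E Et adv_flip flipK //.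
Qed.
End Join.

Section Tie.
Hypotheses (HR : R a (adv 1 f) (run a).-1) (nma : ~~ longest a (adv 1 f)) (oddK : odd K).

(** A second stray aimed at the other end of the same block, which is now a longest one, so it
    counts as aimed again; [guard] ensures that no pending robot is leaving the tied block. *)
Lemma tracked_tie : tracked a' PD'.
Proof.
have bf : stray a PD f by rewrite /stray pf.
have m2 : nlong a == 2.
  by case: kt => _ t2 _ _; case: eqP => // /eqP /t2 /(_ f pf); rewrite /aimed (negPf nma).
have [_ _ _ /(_ m2)[nb|[b1 B0 [x0 [m L]] G]]] := kt; first by move: (nb f); rewrite bf.
have bE : run a' = run a by apply: run_tie.
have mE x : longest a' x = [|| longest a x, x == f | x == flip (adv (run a) f)] by apply: longest_tie.
have [gd1 gd2] := G f bf g2 HR.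
have [v mv] := run_ex a.
have {}mE x : longest a' x -> [\/ x = v, x = flip (adv (run a) v), x = f | x = flip (adv (run a) f)].
  rewrite mE => /or3P[mxx|/eqP->|/eqP->]; last by apply: Or44.
    by case: (nlong2P m2 mv mxx) => ->; [apply: Or41|apply: Or42].
  by apply: Or43.
have mE' x : [|| longest a x, x == f | x == flip (adv (run a) f)] -> longest a' x.
  by move=> H; rewrite /a' longest_tie.
have c4 : nlong a' <= 4.
  have [s Es] : exists s : seq flag, s = [:: v; flip (adv (run a) v); f; flip (adv (run a) f)] by eexists.
  have <- : size s = 4 by rewrite Es.
  apply: leq_trans (card_size s); apply: subset_leq_card; apply/subsetP => x.
  by rewrite inE Es !inE => /mE[] ->; rewrite eqxx ?orbT.
have nf : ~~ longest a f := nmf gf b0.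
have c2 : nlong a' != 2.
  apply/negP => c2; case: (@nlong2P _ _ v f c2).
  - by apply: mE'; rewrite -/(longest a v) in mv; rewrite mv.
  - by apply: mE'; rewrite eqxx orbT.
  - by move=> E; move: nf; rewrite E -/(longest a v) in mv *; rewrite mv.
  by rewrite bE => E; move: nf; rewrite E longest_rev /longest mv.
have mfa : longest a' f by apply: mE'; rewrite eqxx orbT.
have legal' : legal a' PD'.
  move=> h ph; have [n1 ph0 n2 n3 n4] := pending'P le pf ph; have [gh l2 l3] := le ph0; split.
  - by apply: leq_trans gh (g_pending' le pf ph).
  - by apply: contra l2; rewrite pending_unpend => /andP[].
  rewrite /a' longest_tie //; apply/norP; split=> //; apply/norP; split; apply/eqP => E.
    by apply: n1; rewrite -E.
  by case/negP: gd1; have <- : h = adv (run a) f by apply: (can_inj (@flipK _)).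
split.
- split; rewrite ?bE //.
  (* If nobody were outside the two longest blocks, stepping twice over a block would lead back to
     [f], contrary to [dbl_id]. *)
  apply: contraT; rewrite negb_exists => /forallP nc.
  have wa' : wf a' by apply: wf_upd.
  have step w : longest a' w -> longest a' (adv (run a).+1 w).
    move=> mw; have := nc (opp (adv (run a) w)).
    rewrite /faces adv1_opp -bE longest_rev mw /= g_opp bE -{1}bE longest_gap //= negbK.
    by rewrite /opp flipK advD add1n.
  have mp := step f mfa; have mq := step _ mp.
  have dir x y i : x = flip (adv i y) -> x.2 = ~~ y.2 by move=> ->.
  have [v' Ev] : exists v', forall x, longest a' x -> x.2 = f.2 -> x = v' \/ x = f.
    have [Ed|Ed] := eqVneq v.2 f.2; [exists v|exists (flip (adv (run a) v))];
      move=> x /mE[] E dx; try (by left); try (by right).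
    - by move: dx; rewrite (dir _ _ _ E) Ed; case: f.2.
    - by move: dx; rewrite (dir _ _ _ E); case: f.2.
    - by case/eqP: Ed; rewrite -E.
    by move: dx; rewrite (dir _ _ _ E); case: f.2.
  case: (Ev _ mp) => // [Ep|/adv_neq]; last by case; rewrite ltnW.
  case: (Ev _ mq) => // [|Eq].
    by rewrite -Ep => /adv_neq; case; rewrite ltnW.
  rewrite advD in Eq; exfalso.
  by have := dbl_id oddK bK1 Eq.
- move=> _ h ph; have [n1 ph0 n2 n3 n4] := pending'P le pf ph.
  case: (boolP (aimed a h)) => [ah|na]; first by apply: mE'; rewrite -/(aimed a h) ah.
  have bh : stray a PD h by rewrite /stray ph0.
  have [x1 [L1 Ex]] : exists x1, loser a PD x1 m /\ adv 1 f = x1.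
    have [_ t _] := L; case: (t f bf) => E; first by exists x0.
    by exists (flip (adv m x0)); split=> //; apply: loser_swap.
  have [bl t _] := L1; have /and3P[HRm _ _] := bl.
  have Em : m = (run a).-1.
    apply/eqP; rewrite eqn_leq (block_max bl) ?andbT -?Ex //.
    rewrite -ltnS prednK // ltnNge; apply/negP => lebm.
    by case/negP: nma; rewrite Ex; apply: R_le lebm HRm.
  case: (t h bh) => E; first by case: n2; apply: adv1_inj; rewrite Ex.
  apply: mE'; rewrite E -Ex -advS Em prednK // eqxx !orbT //.
- by rewrite ltnNge c4.
by rewrite (negPf c2).
Qed.
End Tie.
End JoinKT.

Definition put PD f : I -> option bool := fun e => if e == f.1 then Some f.2 else PD e.

Lemma pending_put PD f h : PD f.1 = None -> pending (put PD f) h = (h == f) || pending PD h.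
Proof.
move=> N; rewrite /pending /put; case: (h.1 =P f.1) => [E|n]; last first.
  by case: (h =P f) => // E; case: n; rewrite E.
rewrite E N; have -> : (None == Some h.2) = false by [].
rewrite orbF; apply/eqP/eqP => [[E2]|->//].
by case: f h E E2 {N} => [? ?] [? ?] /= -> ->.
Qed.

Lemma tracked_fresh a PD : tracked a PD -> fresh a = false.
Proof.
case=> -[b0 _ ex _] _ t4 _; rewrite /fresh ex; move: b0; case: (run a) => // b _ /=.
apply/negP => /andP[/t4[c2 _] c3].
suff : 2 < 2 by [].
apply: leq_trans c3 _; apply: leq_trans c2; apply: subset_leq_card; apply/subsetP => x.
by rewrite !inE => ->.
Qed.

Lemma nearest_faces a f : nearest a f -> faces a f.
Proof. by case/andP => /andP[]. Qed.

Lemma tracked_look a PD f : wf a -> tracked a PD -> PD f.1 = None -> enabled a f -> tracked a (put PD f).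
Proof.
move=> wa kt N; rewrite /enabled (tracked_fresh kt) => mf.
have /and3P[gf m1 m3] := nearest_faces mf.
have PP h : pending (put PD f) h = (h == f) || pending PD h by apply: pending_put.
have bP h : stray a (put PD f) h = stray a PD h.
  rewrite /stray PP; case: eqP => [->|] //=; rewrite /aimed m1 /= andbF //.
case: kt => -[b0 bK ex le] t2 t4 t1.
have nopp : ~~ pending PD (opp f).
  by apply/negP => /le[_ _]; rewrite /opp flipK m1.
split.
- split=> // h; rewrite !PP => /orP[/eqP->|ph].
    by rewrite gf (negPf nopp) orbF; split=> //; apply/eqP/opp_neq.
  have [l1 l2 l3] := le h ph; rewrite l1 l3 (negPf l2) orbF; split=> //.
  by apply/eqP => E; move: nopp; rewrite -E oppK ph.
- by move=> m2 h; rewrite PP => /orP[/eqP->//|]; apply: t2.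
- move=> m4; have [c2 nds] := t4 m4; split.
    apply: leq_trans c2; apply: subset_leq_card; apply/subsetP => x; rewrite !inE PP.
    by case/or3P => [->|/eqP->|->]; rewrite ?mf ?orbT.
  have m2 : nlong a != 2 by apply/eqP => E; rewrite E in m4.
  move=> h; rewrite PP => /orP[/eqP->|]; last exact: nds.
  by have [cf H] := nearestP m2 mf; rewrite /direct cf /=; apply/implyP; apply: H.
move=> m2; case: (t1 m2) => [nb|[b1 B0 [x0 [m L]] G]].
  by left=> h; rewrite bP.
right; split=> //.
- by move=> h; rewrite bP; apply: B0.
- exists x0, m; case: L => bl t s; split=> //; first by move=> h; rewrite bP; apply: t.
  by case: s => s; [left=> h z; rewrite !bP; apply: s|right].
move=> h; rewrite bP => bh g2 HR; have [G1 G2] := G h bh g2 HR; split=> //.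
(* The danger is that the looking robot is the guarded far end. It is unsafe, while the neighbour at
   the other end of the unique longest block is safe; hence [cand] rejects it. *)
rewrite PP (negPf G1) orbF; apply/eqP => Ef.
have mx1 : longest a (adv (run a).+1 h) by move: m1; rewrite -Ef advD add1n.
have [c1 c2] := longest_ends wa m1 bK m2.
have Hother y : faces a y -> y <> f -> safe a y.
  by move=> cy ny; apply: G2 => // E; apply: ny; rewrite -Ef.
have oky : safe a (opp (adv (run a) (adv 1 f))).
  apply: Hother => //; move=> E.
  have := @adv_opp_neq _ (run a) (flip (adv 1 f)).
  by have := congr1 snd E => /=; case: f.2.
have nokx : ~~ safe a f.
  rewrite -Ef /safe negbK.
  have E1 : (run a) = (run a).-1.+1 by rewrite prednK.
  apply/and3P; split.
  - by rewrite E1 advS R_rev.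
  - rewrite {2}E1 (advS (run a).-1 h) adv_flip; have -> : flip (adv 1 h) = opp h by [].
    by rewrite g_opp g2.
  by rewrite adv_flip; apply: B0.
case/andP: mf => /andP[_ /implyP /(_ m2)] + _; rewrite (negPf nokx) /=.
by case/negP; apply/existsP; exists (opp (adv (run a) (adv 1 f))); rewrite c2.
Qed.

End KTsteps.

(** * Symmetric configurations *)

Section Readings.
Variable k' : nat.
Notation K := k'.+3.
Notation I := 'I_K.
Notation flag := (flag k').
Implicit Types (f x y h : flag) (a : I -> nat) (i j m : nat) (PD : I -> option bool).

Lemma wordP a f h : reflect (forall j, g a (adv j f) = g a (adv j h)) (word a f == word a h).
Proof.
apply: (iffP eqP) => [E j|E]; last exact: eq_mkseq.
rewrite -(adv_mod j f) -(adv_mod j h).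
move/(congr1 (fun s => nth 0 s (j %% K))): E; rewrite !nth_mkseq //; exact: ltn_pmod.
Qed.

Lemma word_adv a f h j : word a f = word a h -> word a (adv j f) = word a (adv j h).
Proof. by move/eqP/wordP=> E; apply/eqP/wordP => i; rewrite !advD. Qed.

Lemma adv_back2 j : exists i, forall f, adv j (flip f) = opp (adv i f).
Proof.
exists (K * j.+1 - j.+1) => f; have E : adv j.+1 (adv (K * j.+1 - j.+1) f) = f.
  by rewrite advD subnKC ?leq_pmull // -adv_mod modnMr adv0.
by rewrite -{1}E -addn1 -advD adv_flip.
Qed.

Lemma word_flip a f h : word a f = word a h -> word a (flip f) = word a (flip h).
Proof.
move/eqP/wordP=> E; apply/eqP/wordP => j; have [i Ei] := adv_back2 j.
by rewrite !Ei !g_opp.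
Qed.

(** Only flags with the same direction are compared: equal words in opposite directions mean a
    reflection, which is allowed. *)
Definition nonper a := forall f h, f.2 = h.2 -> word a f = word a h -> f = h.

Hypothesis oddK : odd K.

Lemma same_dir f h : f.2 = h.2 -> exists2 j, j < K & h = adv j f.
Proof.
move=> d; have [j jK [E|E]] := adv_surj f h; first by exists j.
by move: d; rewrite E /=; case: f.2.
Qed.

(** One of [j] and [j + K] is even. *)
Lemma half_turn j : exists i, forall f, adv j f = adv (i + i) f.
Proof.
have [e|e] := boolP (odd j).
  exists ((j + K)./2) => f; have : ~~ odd (j + K) by rewrite oddD e oddK.
  by move/even_halfK; rewrite -addnn => ->; rewrite -advD advK.
by exists j./2 => f; rewrite addnn even_halfK.
Qed.

(** Halving the rotation between the two flags moves the symmetry onto a robot. *)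
Lemma mirror_sym a f h : word a f = word a h -> f.2 <> h.2 -> mirrored a.
Proof.
move=> E d; have [j jK [Ej|Ej]] := adv_surj f h; first by case: d; rewrite Ej.
have [i Ei] := half_turn j.
apply/existsP; exists (adv i f); apply/eqP; rewrite (word_adv i E) Ej Ei.
by rewrite -advD adv_flip.
Qed.

Section Axis.
Variables (a : I -> nat) (tau : flag -> flag).
Hypotheses (np : nonper a) (tau_adv : forall j x, adv j (tau (adv j x)) = tau x).
Hypotheses (tau_dir : forall x, (tau x).2 = ~~ x.2) (tauK : involutive tau).

(** Two reflections compose to a rotation by twice the distance between their axes; non-periodicity
    makes it trivial and oddness makes the distance 0. The map [tau] is [flip] for an axis through a
    robot and [opp] for an axis through a gap. *)
Lemma axis_uniq x y : word a x = word a (tau x) -> word a y = word a (tau y) -> y = x \/ y = tau x.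
Proof.
move=> Ex.
have same z : z.2 = x.2 -> word a z = word a (tau z) -> z = x.
  move=> d Ez; have [j jK Ej] := same_dir (esym d).
  have E1 : word a (adv j z) = word a x by rewrite (word_adv j Ez) Ej tau_adv -Ex.
  have := np (f := adv j z) (h := x) d E1; rewrite Ej advD => /(dbl_id oddK jK) ->.
  exact: adv0.
move=> Ey; have [d|d] := eqVneq y.2 x.2; first by left; apply: same.
right; rewrite -(tauK y); congr tau; apply: same; rewrite ?tauK //.
by rewrite tau_dir; move: d; case: y.2; case: x.2.
Qed.
End Axis.

Lemma mirror_uniq a x y : nonper a -> mirror a x -> mirror a y -> y = x \/ y = flip x.
Proof.
move=> np /eqP Ex /eqP Ey; apply: (axis_uniq np (tau := @flip _)) => //.
  by move=> j z; rewrite adv_flip.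
exact: flipK.
Qed.

Lemma axial_uniq a x y : nonper a -> axial a x -> axial a y ->
  y = x \/ adv (run a).+1 y = opp (adv (run a).+1 x).
Proof.
move=> np /eqP Ex /eqP Ey.
have inj u v : adv (run a).+1 u = adv (run a).+1 v -> u = v.
  move=> E; apply: (can_inj (@flipK _)).
  by rewrite -(adv_flip (run a).+1 u) E adv_flip.
case: (axis_uniq np (tau := @opp _) _ _ _ Ex Ey).
- by move=> j z; rewrite /opp advD addnC -advD adv_flip.
- by [].
- exact: oppK.
- by move/inj; left.
by right.
Qed.

Lemma selected_word a f h : selected a f -> selected a h -> word a f = word a h.
Proof.
case/andP => gf /forallP Hf /andP[gh /forallP Hh].
apply: (pcan_inj pickleK); apply/eqP; rewrite eqn_leq.
by have := Hf h; have := Hh f; rewrite gf gh /= => -> ->.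
Qed.

(** Equal codes are equal words, and a non-periodic configuration has at most one flag with a given
    word in each direction. *)
Lemma selected_dir a f h : nonper a -> selected a f -> selected a h -> h = f \/ h.2 = ~~ f.2.
Proof.
move=> np sf sh; have [d|d] := eqVneq h.2 f.2.
  by left; apply: np => //; apply: selected_word.
by right; move: d; case: h.2; case: f.2.
Qed.

Lemma selected_le2 a f h x : nonper a -> selected a f -> selected a h -> selected a x -> h <> f -> x = f \/ x = h.
Proof.
move=> np sf sh sx n; have [|d] := selected_dir np sf sx; first by left.
have [//|d'] := selected_dir np sf sh.
by right; apply: np; [rewrite d d'|apply: selected_word].
Qed.

Lemma selected_ex a f : eligible a f -> exists h, selected a h.
Proof.
move=> gf; case: (arg_minnP (fun h => pickle (word a h)) gf) => h gh Hh.
by exists h; rewrite /selected gh; apply/forallP => x; apply/implyP; apply: Hh.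
Qed.

Lemma faces_run a f : wf a -> faces a f -> (run a).+1 < K.
Proof.
move=> wa /and3P[_ m1 m2]; have := run_lt wa; rewrite ltnS leq_eqVlt => /orP[/eqP E|//].
case/negP: m2; have := m1; rewrite -longest_rev -(advS (run a) f).
have -> : (run a).+1 = K by rewrite E.
by rewrite advK.
Qed.

Lemma cand_ex a : [exists h, faces a h] -> exists h, cand a h.
Proof.
move=> ex; case: (boolP [exists h, faces a h && safe a h]) => [/existsP[h /andP[ch oh]]|no].
  by exists h; rewrite /cand ch oh implybT.
by case/existsP: ex => h ch; exists h; rewrite /cand ch no orbT implybT.
Qed.

Lemma nearest_ex a : [exists h, faces a h] -> exists h, nearest a h.
Proof.
case/cand_ex => h0 c0; case: (arg_minnP (g a) c0) => h ch Hh.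
by exists h; rewrite /nearest ch; apply/forallP => x; apply/implyP; apply: Hh.
Qed.

(** Distances are minimised among candidates only, so [flip f] must be one if it faces a block. It
    is safe: behind it lies the gap in front of [f], which exceeds 1, and if [run a] is 1 the last
    condition in [safe] cannot hold. *)
Lemma nearest_direct a f : 0 < run a -> nearest a f -> direct a f.
Proof.
move=> b0 /andP[/andP[cf _] /forallP H]; rewrite /direct cf; apply/implyP => cff.
apply: (implyP (H (flip f))); rewrite /cand cff /=; apply/implyP => _; apply/orP; left.
rewrite /safe flipK; apply/negP => /and3P[]; have [|b1] := posnP (run a).-1.
  by move=> ->; rewrite R0.
move=> HR _ _; have /and3P[gf _ _] := cf; move: gf.
by move: HR; rewrite -(prednK b1) R_S => /andP[/eqP -> _].
Qed.
End Readings.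

(** * Isolated robots and equal blocks *)

Section Fresh.
Variable k' : nat.
Notation K := k'.+3.
Notation I := 'I_K.
Notation flag := (flag k').
Implicit Types (f x y h : flag) (a : I -> nat) (i j m : nat) (PD : I -> option bool).

Hypothesis oddK : odd K.

Definition sumsq a := \sum_e a e ^ 2.

(** For [p <= q], replacing [p], [q] by [p - 1], [q + 1] adds [2 (q - p) + 2] to the sum of
    squares. *)
Lemma sumsq_upd a f : 0 < g a f -> g a f <= g a (flip f) -> sumsq a < sumsq (upd a f).
Proof.
move=> g0 le; rewrite /sumsq (bigD1 (edge f)) //= (bigD1 (edge (flip f))) /=; last first.
  by rewrite eq_sym; apply: edge_flip.
rewrite [X in _ < X](bigD1 (edge f)) //= [X in _ < _ + X](bigD1 (edge (flip f))) /=; last first.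
  by rewrite eq_sym; apply: edge_flip.
rewrite [X in _ < _ + (_ + X)](eq_bigr (fun e => a e ^ 2)); last first.
  by move=> e /andP[/negPf n1 /negPf n2]; rewrite /upd n1 n2.
rewrite /upd eqxx [edge (flip f) == edge f]eq_sym (negPf (edge_flip f)) eqxx.
rewrite /g in g0 le *; move: (bigop _ _ _) (a (edge f)) (a (edge (flip f))) g0 le => s p q p0 pq.
rewrite !addnA ltn_add2r -(prednK p0); move: pq; rewrite -(prednK p0) => pq.
move: (p.-1) pq => r pq /=; nia.
Qed.

Lemma nonper_from a f : (forall j, j < K -> word a f = word a (adv j f) -> j = 0) -> nonper a.
Proof.
move=> H; have main x y : x.2 = f.2 -> x.2 = y.2 -> word a x = word a y -> x = y.
  move=> dx dxy E; have [i iK Ei] := same_dir dx; have [j jK Ej] := same_dir dxy.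
  have Hj : word a f = word a (adv j f) by rewrite Ei advD addnC -advD -Ej; apply: word_adv.
  by rewrite Ej (H j jK Hj) adv0.
move=> x y dxy E; have [d|d] := eqVneq x.2 f.2; first exact: main.
have dx : (flip x).2 = f.2 by move: d; rewrite flipE; case: x.2; case: f.2.
apply: (can_inj (@flipK _)); apply: main => //; first by rewrite !flipE dxy.
exact: word_flip.
Qed.

Lemma unpend_none PD f : (forall h, pending PD h -> h = f \/ h = flip f) -> forall h, ~~ pending (unpend PD f.1) h.
Proof.
by move=> H h; rewrite pending_unpend; apply/negP => /andP[/eqP n /H[] E]; apply: n; rewrite E.
Qed.

Lemma tracked_idle a PD : wf a -> 0 < run a -> (run a).+1 < K -> [exists h, faces a h] -> nlong a == 2 ->
  (forall h, ~~ pending PD h) -> tracked a PD.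
Proof.
move=> wa b0 bK ex m2 np; split.
- by split=> // h; rewrite (negPf (np h)).
- by rewrite m2.
- by rewrite (eqP m2).
by left=> h; rewrite /stray (negPf (np h)).
Qed.

Lemma adv_injl j x y : adv j x = adv j y -> x = y.
Proof.
move=> E; apply: (can_inj (@flipK _)).
by rewrite -(adv_flip j x) E adv_flip.
Qed.

Section Dust.
Variables (a : I -> nat) (f : flag).
Hypotheses (wa : wf a) (np : nonper a) (b0 : run a = 0) (sf : selected a f).
Let a' := upd a f.

Lemma dust_gap x : 1 < g a x.
Proof.
have := run_S x wa; rewrite b0 R1; case: wa => /(_ (edge x)) + _; rewrite -/(g a x).
by case: (g a x) => [|[]].
Qed.

Lemma dust_eligible : (if mirrored a then mirror a f else [forall h, g a f <= g a h]).
Proof. by case/andP: sf; rewrite /eligible b0. Qed.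

Lemma dust_le : g a f <= g a (flip f).
Proof.
have := dust_eligible; case: ifP => _; last by move/forallP/(_ (flip f)).
by move=> /wordP/(_ 0); rewrite !adv0 => ->.
Qed.

Lemma dust_sumsq : sumsq a < sumsq a'.
Proof. by apply: sumsq_upd dust_le; apply: ltnW; apply: dust_gap. Qed.

Lemma dust_alone h : selected a h -> h = f \/ h = flip f.
Proof.
move=> sh; have [|d] := selected_dir np sf sh; first by left.
have s : mirrored a.
  by apply: (mirror_sym oddK (selected_word sf sh)); rewrite d; case: f.2.
have := dust_eligible; case/andP: sh => + _; rewrite /eligible b0 /= s => Sh Sf.
exact: (mirror_uniq oddK np).
Qed.

(** A period would repeat elsewhere the two gaps around [f]. Without symmetry the gap in front is
    now strictly smallest. On an axis the two repeated gaps were equal before the move, yet one was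
    at most [g a f - 1] and the other at least [g a f + 1]. *)
Lemma dust_nonper : nonper a'.
Proof.
apply: (nonper_from (f := f)) => j jK E; case: j jK E => // j jK E; exfalso.
have /eqP/wordP/(_ 0) := E; rewrite !adv0 {1}/a' g_f_st.
have n1 : adv j.+1 f <> f by apply: adv_neq.
have n2 : adv j.+1 f <> opp f by move/(congr1 snd) => /=; case: f.2.
have gup : g a (adv j.+1 f) <= g a' (adv j.+1 f) by apply: g_up.
have gf := dust_gap f.
have := dust_eligible; case: ifP => _ H.
  have := word_adv j.+1 (word_flip E); rewrite adv_flip => /eqP/wordP/(_ 0).
  rewrite !adv0 {2}/a' g_flip_st.
  have Hs := wordP _ _ _ H; have E0 := Hs 0; rewrite !adv0 in E0; rewrite -E0.
  have : g a' (adv j.+1 (flip f)) <= g a (adv j.+1 (flip f)).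
    rewrite g_upd; case: ifP => _; first exact: leq_pred.
    case: ifP => // /orP[]/eqP E1; first by case: (@adv_neq _ j.+1 (flip f)).
    by have := congr1 snd E1; rewrite bwdE /=; case: f.2.
  rewrite -Hs; lia.
by have := forallP H (adv j.+1 f); lia.
Qed.

Lemma dust_wf : wf a'. Proof. exact: wf_upd (dust_gap f). Qed.

Lemma dust_stay : 2 < g a f -> run a' = 0.
Proof.
move=> g3; apply: (run_eq (x := f) dust_wf); first exact: R0.
move=> y; apply/negP => /(R_upd_from wa.1 (dust_gap f))[H|[g2 _ _ _]].
  by have := dust_gap y; move: H; rewrite R1 => /eqP->.
by rewrite g2 in g3.
Qed.

Lemma dust_tracked PD : (forall h, pending PD h -> enabled a h) -> g a f = 2 -> tracked a' (unpend PD f.1) /\ run a' = 1.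
Proof.
move=> HE g2.
have fr : fresh a by rewrite /fresh b0.
have mf : longest a (adv 1 f) by rewrite /longest b0.
have bK : (run a).+2 < K by rewrite b0.
have bE : run a' = 1 by rewrite /a' run_j // b0.
split=> //; have m2 : nlong a' == 2 by rewrite /a' nlong_j.
have [w mw] := run_ex a'.
have [c1 _] := longest_ends dust_wf mw ltac:(by rewrite bE) m2.
apply: tracked_idle => //; rewrite ?bE //; first exact: dust_wf.
  by apply/existsP; exists (bwd w).
by apply: unpend_none => h /HE; rewrite /enabled fr; apply: dust_alone.
Qed.
End Dust.

(* [nc] means that every robot belongs to a longest block *)
Section Equal.
Variable a : I -> nat.
Hypotheses (wa : wf a) (b0 : 0 < run a) (bK : (run a).+1 < K) (nc : ~~ [exists h, faces a h]).

(** Otherwise the robot after the block of [w] would face that block from outside. *)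
Lemma eq_next w : longest a w -> longest a (adv (run a).+1 w).
Proof.
move=> mw; apply: contraT => nm; case/negP: nc; apply/existsP; exists (opp (adv (run a) w)).
rewrite /faces g_opp longest_gap // adv1_opp longest_rev mw /=.
by rewrite /opp flipK advD add1n.
Qed.

Lemma eq_iter w q : longest a w -> longest a (adv (q * (run a).+1) w).
Proof.
elim: q => [|q IH] mw; first by rewrite mul0n adv0.
by rewrite mulSn -advD; apply: eq_next; apply: IH.
Qed.

Lemma eq_gap_dir w x : longest a w -> x.2 = w.2 -> 1 < g a x -> longest a (adv 1 x) /\ longest a (flip x).
Proof.
move=> mw d gx; have [j jK Ej] := same_dir (esym d).
have Eq := divn_eq j (run a).+1.
have mq := eq_iter (j %/ (run a).+1) mw.
have rl : j %% (run a).+1 <= run a by rewrite -ltnS ltn_pmod.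
move: (j %/ _) (j %% _) Eq mq rl => q r Eq mq rl.
have {}Ej : x = adv r (adv (q * (run a).+1) w) by rewrite advD Ej Eq addnC.
move: (adv _ w) mq Ej => v mv Ej.
have Er : r = run a.
  apply/eqP; rewrite eqn_leq rl leqNgt; apply/negP => lt.
  by move: gx; rewrite Ej; move/RP: mv => /(_ r lt) ->.
rewrite Ej Er; split; first by rewrite advD add1n; apply: eq_next.
by rewrite longest_rev.
Qed.

Lemma eq_gap x : 1 < g a x -> longest a (adv 1 x) /\ longest a (flip x).
Proof.
move=> gx; have [w mw] := run_ex a.
have [d|d] := eqVneq x.2 w.2; first exact: (eq_gap_dir mw d gx).
have dx : (opp x).2 = w.2 by move: d; rewrite /opp flipE advE; case: x.2; case: w.2.
have [//|H1 H2] := eq_gap_dir mw dx; first by rewrite g_opp.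
by move: H1 H2; rewrite adv1_opp /opp flipK.
Qed.

Lemma eq_orbit w x : longest a w -> longest a x -> x.2 = w.2 ->
  exists2 q, q * (run a).+1 < K & x = adv (q * (run a).+1) w.
Proof.
move=> mw mx1 d; have [j jK Ej] := same_dir (esym d).
have Eq := divn_eq j (run a).+1.
have mq := eq_iter (j %/ (run a).+1) mw.
have rl : j %% (run a).+1 <= run a by rewrite -ltnS ltn_pmod.
move: (j %/ _) (j %% _) Eq mq rl => q r Eq mq rl; exists q; first by lia.
case: r Eq rl => [|r] Eq rl; first by rewrite Ej Eq addn0.
have := longest_bwd_gap wa mx1; rewrite Ej Eq addnS bwd_adv addnC -advD.
by move/RP: mq => /(_ r rl) ->.
Qed.

Lemma eq_room : (run a).+2 < K.
Proof.
rewrite ltn_neqAle bK andbT; apply/eqP => E.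
have [e ge] := wa.2; have [m1 _] := @eq_gap (e, true) ge.
have := eq_next m1; rewrite advD addn1 E advK => /(longest_g b0) E1.
by move: ge; rewrite -/(g a (e, true)) E1.
Qed.

Section EqMove.
Variable f : flag.
Hypotheses (np : nonper a) (sf : selected a f).
Let a' := upd a f.
(** The other end of the block that [f] leaves, looking outwards: the mirror image of [f] whenever a
    second robot is selected. *)
Let s := adv (run a) (flip f).

Lemma eq_gf h : selected a h -> 1 < g a h.
Proof. by case/andP; rewrite /eligible (gtn_eqF b0) (negPf nc) => /andP[]. Qed.
Let gf : 1 < g a f := eq_gf sf.

Lemma eq_pend h : selected a h -> h = f \/ h = s.
Proof.
move=> sh; have [|d] := selected_dir np sf sh; first by left.
have sy : mirrored a by apply: (mirror_sym oddK (selected_word sf sh)); rewrite d; case: f.2.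
right; have := sf; case/andP; rewrite /eligible (gtn_eqF b0) (negPf nc) sy /= => /andP[_ /eqP E] _.
apply: np; first by rewrite d.
by rewrite -E; apply: selected_word.
Qed.

Lemma s_neq : [/\ s.1 <> f.1, s <> opp f, s <> f & flip s <> f].
Proof.
have dn : s.2 <> f.2 by rewrite /s /=; case: f.2.
have n1 : s.1 <> f.1.
  move=> E; have : adv (run a) (flip f) = flip f by rewrite -/s [s]surjective_pairing E.
  by apply: adv_neq; rewrite b0 ltnW.
split=> //; first exact: adv_opp_neq.
  by move=> E; apply: n1; rewrite E.
by move=> E; apply: n1; rewrite -E.
Qed.

Lemma s_gap : 1 < g a s.
Proof. by have [_ H] := eq_gap gf; apply: longest_gap. Qed.

Lemma s_gap' : g a s <= g a' s.
Proof. by have [n1 n2 n3 n4] := s_neq; apply: g_up. Qed.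

Lemma R_flip_f m : 0 < m -> ~~ R a' (flip f) m.
Proof.
by case: m => // m _; rewrite R_S g_flip_st; have := wa.1 (edge (flip f)); rewrite /g; case: (a _).
Qed.

Lemma R_flip_s : ~~ R a' (flip s) (run a).
Proof. by rewrite R_rev; apply: R_flip_f. Qed.

Section EqStay.
Hypothesis g3 : 2 < g a f.

Lemma eqs_window x : R a' x (run a) = [&& longest a x, x != flip f & x != flip s].
Proof.
apply/idP/and3P => [HR|[mx1 /eqP n1 /eqP n2]].
  split.
  - by case: (R_upd_from wa.1 gf HR) => // -[g2]; move: g3; rewrite g2.
  - by apply/eqP => E; move: HR; rewrite E; apply/negP/R_flip_f.
  - by apply/eqP => E; move: HR; rewrite E; apply/negP/R_flip_s.
apply: R_upd_to2 => // E; apply: n2.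
by rewrite /s -E adv_flip flipK.
Qed.

Lemma target_neq : adv 1 f <> flip f /\ adv 1 f <> flip s.
Proof.
split; first by move/(congr1 snd) => /=; case: f.2.
move=> E; have : adv (run a).+1 f = f; last by apply: adv_neq; rewrite bK.
by rewrite (advS (run a) f) E /s adv_flip flipK.
Qed.

Lemma eqs_run : run a' = run a.
Proof.
have [m1 _] := eq_gap gf; have [n1 n2] := target_neq.
apply: (run_eq (x := adv 1 f)); first exact: wf_upd.
  by rewrite eqs_window m1 andTb; apply/andP; split; apply/eqP.
move=> y; apply/negP => /(R_upd_from wa.1 gf)[|[g2]]; last by move: g3; rewrite g2.
exact/negP/run_S.
Qed.

Lemma eqs_longest x : longest a' x = [&& longest a x, x != flip f & x != flip s].
Proof. by rewrite /longest eqs_run eqs_window. Qed.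

Lemma eqs_faces y : faces a' y -> y = f \/ y = s.
Proof.
case/and3P => gy m1 m2.
case: (boolP (longest a (flip y))) => [my|ny].
  move: m2; rewrite eqs_longest my /= negb_and !negbK => /orP[]/eqP/(can_inj (@flipK _)); by [left|right].
have gy1 : g a y <= 1.
  by rewrite leqNgt; apply/negP => /eq_gap[_]; apply/negP.
move: gy m1; rewrite eqs_longest => gy /and3P[m1 n1 n2].
move: gy; rewrite g_upd; case: ifP => [_|_]; first by lia.
case: ifP => [/orP[]/eqP E _|]; last by lia.
  have [_ mff] := eq_gap gf.
  have := run_S (flip f) wa; rewrite R_S (longest_g b0 mff) -E -/(longest a (adv 1 y)) m1.
  by [].
move: m1; rewrite E adv1_bwd => /(longest_g b0) g1.
by move: gf; rewrite g1.
Qed.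

Lemma eqs_cndf : faces a' f.
Proof.
have [m1 _] := eq_gap gf; have [n1 n2] := target_neq.
apply/and3P; split.
- by rewrite g_f_st; move: g3; case: (g a f) => [|[|]].
- by rewrite eqs_longest m1 andTb; apply/andP; split; apply/eqP.
by rewrite eqs_longest eqxx andbF.
Qed.

Lemma target_s : longest a' (adv 1 s).
Proof.
have [m1 _] := eq_gap s_gap; have [n1 n2 n3 n4] := s_neq.
rewrite eqs_longest m1 andTb; apply/andP; split; apply/eqP.
  by rewrite -(adv1_opp f) => /adv1_inj.
by move/(congr1 snd) => /=; case: f.2.
Qed.

(** The targets of [f] and [s] are distinct blocks: otherwise the ring would consist of two equal
    blocks, which oddness forbids. *)
Lemma eqs_nlong : nlong a' != 2.
Proof.
apply/negP => m2; have [m1 _] := eq_gap gf; have [n1 n2] := target_neq.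
have mw : longest a' (adv 1 f) by rewrite eqs_longest m1 andTb; apply/andP; split; apply/eqP.
case: (nlong2P m2 mw target_s) => [/(congr1 snd) /=|]; first by case: f.2.
rewrite eqs_run -(advS (run a) f) /s advD add1n => E.
have : adv ((run a).+1 + (run a).+1) (flip f) = flip f by rewrite -advD E adv_flip.
by move/(dbl_id oddK bK).
Qed.

Lemma eqs_tracked PD : (forall h, pending PD h -> selected a h) -> tracked a' (unpend PD f.1).
Proof.
move=> HE; have [n1 n2 n3 n4] := s_neq.
have Hs h : pending (unpend PD f.1) h -> h = s.
  by rewrite pending_unpend => /andP[/eqP n /HE/eq_pend[] // E]; case: n; rewrite E.
split; rewrite ?eqs_run //.
- split=> //; first by apply/existsP; exists f; apply: eqs_cndf.
  move=> h /[dup] ph /Hs E; rewrite E; split; first exact: leq_trans s_gap s_gap'.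
    by apply/negP => /Hs /opp_neq.
  by rewrite eqs_longest eqxx !andbF.
- by move=> _ h /Hs ->; apply: target_s.
- move=> _; split.
    have [l El] : exists l : seq flag, l = [:: f; s] by eexists.
    have <- : size l = 2 by rewrite El.
    apply: leq_trans (card_size l); apply: subset_leq_card; apply/subsetP => x.
    rewrite El !inE => /orP[/nearest_faces/eqs_faces[] ->|/Hs->]; rewrite eqxx ?orbT //.
  move=> h ph; have Eh := Hs h ph; rewrite Eh /direct.
  have -> : faces a' (flip s) = false.
    apply/negP => /eqs_faces[] //; exact: flip_neq.
  rewrite /= andbT /faces target_s (leq_trans s_gap s_gap') /=.
  by rewrite eqs_longest eqxx !andbF.
by rewrite (negPf eqs_nlong).
Qed.
End EqStay.

Section EqJoin.
Hypothesis g2 : g a f = 2.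

(** Only [s] can become stray. Its guard could fail only in a ring of three blocks; of these one was
    joined by [f], one was left by [f] and one is the target of [s], so no block remains for an
    unsafe robot. *)
Lemma eqj_tracked PD : (forall h, pending PD h -> selected a h) -> tracked a' (unpend PD f.1).
Proof.
move=> HE; have [n1 n2 n3 n4] := s_neq; have bK2 := eq_room.
have [mf mff] := eq_gap gf.
have Hs h : pending (unpend PD f.1) h -> h = s.
  by rewrite pending_unpend => /andP[/eqP n /HE/eq_pend[] // E]; case: n; rewrite E.
have Hp h : pending (unpend PD f.1) h ->
    [/\ h.1 <> f.1, 1 < g a h, h <> opp f & ~~ pending (unpend PD f.1) (opp h)].
  move=> /Hs->; split=> //; first exact: s_gap.
  by apply/negP => /Hs/opp_neq.
have Hm h : pending (unpend PD f.1) h -> h <> adv (run a).+1 f /\ ~~ R (upd a f) (flip h) (run a).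
  move=> /Hs->; split; last exact: R_flip_s.
  by move/(congr1 snd) => /=; case: f.2.
apply: tracked_join => //.
case: (boolP [exists h, stray a' (unpend PD f.1) h]) => [/existsP ex|]; last first.
  by rewrite negb_exists => /forallP; left.
right.
have bs h : stray a' (unpend PD f.1) h -> h = s by case/andP => /Hs.
have [ms _] := eq_gap s_gap.
apply: stale_one => //.
- by move=> h /Hs-> /(congr1 snd) /=; case: f.2.
- by move=> h /Hs->.
- by move=> x h /bs-> /bs->.
move=> h bh _ mh y cy ny; have Eh := bs h bh; rewrite {}Eh in bh mh ny.
apply: contraT => nok.
have := safe_block cy nok; rewrite run_j //= => By.
have [my y1 y2] := block_j wa bK2 g2 mf By.
have /and3P[HRy _ _] := By.
have y3 : flip y <> flip f by move=> E; move: HRy; rewrite E; apply/negP/R_flip_f.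
have y4 : flip y <> flip s by move=> E; move: HRy; rewrite E; apply/negP/R_flip_s.
have ps : pending (unpend PD f.1) s by case/andP: bh.
have lj : legal a' (unpend PD f.1) by apply: legal_j.
have [_ _ ls] := lj s ps.
have y5 : flip y <> adv 1 s.
  move=> E; have Ey : y = opp s by rewrite -(flipK y) E.
  by move: cy; rewrite Ey /faces adv1_opp (negPf ls) andbF.
have y6 : flip y <> flip (adv (run a) (adv 1 s)).
  by move=> /(can_inj (@flipK _)); rewrite -(advS (run a) s).
(* the block of [s] has just been left by [f], and its target is one block further on each
   side of the ring, so there are only three blocks *)
have E3 : adv (3 * (run a).+1) f = f.
  move: mh; rewrite longest_j // => /orP[]/eqP E.
    by have := congr1 snd E => /=; case: f.2.
  have : adv (run a).+1 (adv (run a).+2 s) = flip f by rewrite E adv_flip.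
  rewrite /s !advD => E'; apply: (can_inj (@flipK _)).
  apply: (@adv_injl (3 * (run a).+1)); rewrite adv_flip -[LHS]E'; congr adv; clear; lia.
have E4 i j : i + j = 3 * (run a).+1 -> adv i (flip f) = flip (adv j f).
  by move=> E; rewrite -{1}E3 -E -advD adv_flip.
have leK3 : K <= 3 * (run a).+1.
  by rewrite leqNgt; apply/negP => lt; case: (@adv_neq _ (3 * (run a).+1) f).
have three v : longest a v -> v.2 = f.2 ->
    [\/ v = adv 1 f, v = flip (adv (run a) (adv 1 s)) | v = flip s].
  move=> mv dv; have [q qK ->] := eq_orbit mf mv dv.
  have q3 : q < 3 by rewrite -(ltn_pmul2r (ltn0Sn (run a))); apply: leq_trans qK leK3.
  case: q q3 {qK} => [|[|[|//]]] _.
  - by apply: Or31; rewrite mul0n adv0.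
  - apply: Or32; rewrite /s !advD (E4 _ ((run a).+2)) ?flipK; last by clear; lia.
    by congr adv; clear; lia.
  apply: Or33; rewrite /s !advD (E4 _ ((2 * (run a).+1).+1)) ?flipK; last by clear; lia.
  by congr adv; clear; lia.
have [d|d] := eqVneq (flip y).2 f.2.
  by case: (three _ my d).
have d' : (flip (adv (run a) (flip y))).2 = f.2 by move: d => /=; case: y.2; case: f.2.
have back v : flip (adv (run a) (flip y)) = v -> flip y = flip (adv (run a) v).
  by move=> <-; rewrite adv_flip flipK.
case: (three _ _ d') => [|/back|/back|/back]; first by rewrite longest_rev.
- by rewrite -(advS (run a) f).
- by rewrite adv_flip flipK.
by rewrite /s adv_flip flipK.
Qed.
End EqJoin.
End EqMove.
End Equal.
End Fresh.

(** * The complete invariant and the existence of an enabled robot *)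

Section Invariant.
Variable k' : nat.
Notation K := k'.+3.
Notation I := 'I_K.
Notation flag := (flag k').
Implicit Types (f x y h : flag) (a : I -> nat) (i j m : nat) (PD : I -> option bool).

Hypothesis oddK : odd K.

Section Tight.
Variables (a : I -> nat) (f : flag).
Hypotheses (wa : wf a) (b0 : 0 < run a) (bK : (run a).+2 = K).
Hypotheses (gf : 1 < g a f) (mf : longest a (adv 1 f)) (nm : ~~ longest a (flip f)).

Lemma tight_gap j : 0 < j <= run a -> g a (adv j f) = 1.
Proof. by case: j => // j jb; rewrite advS; move/RP: mf; apply. Qed.

Lemma tight_longest x : longest a x -> x = adv 1 f \/ x = flip (adv (run a) (adv 1 f)).
Proof.
move=> mx1; have [j jK [E|E]] := adv_surj f x; rewrite E in mx1 *.
  case: j jK E mx1 => [|[|j]] jK E mx1; [|by left|].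
    by move: gf; rewrite -(adv0 f) (longest_g b0 mx1).
  have := longest_bwd_gap wa mx1; rewrite bwd_adv tight_gap //.
  by move: jK; rewrite -bK !ltnS.
case: j jK E mx1 => [|j] jK E mx1; first by move: mx1 nm; rewrite adv0 => ->.
move: jK; rewrite -bK ltnS leq_eqVlt => /orP[/eqP->|jb]; first by right; rewrite (advS (run a) f).
by have := longest_bwd_gap wa mx1; rewrite /bwd flipK -/(opp _) g_opp (tight_gap (jb : 0 < j.+1 <= run a)).
Qed.

(** All robots but one form the longest block; its inner robots have no room and its ends may not
    leave. The last join therefore yields a single block with nothing pending. *)
Lemma tight_pending PD : legal a PD -> forall h, pending PD h -> h.1 <> f.1 -> False.
Proof.
move=> le h /le[gh _ nh] nf; have [j jK [E|E]] := adv_surj f h; rewrite E in gh nh nf.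
  case: j jK E gh nh nf => [|j] jK E gh nh nf; first by case: nf; rewrite adv0.
  move: jK; rewrite -bK ltnS leq_eqVlt => /orP[/eqP Ej|jb]; last by move: gh; rewrite (tight_gap (jb : 0 < j.+1 <= run a)).
  by case/negP: nh; rewrite Ej (advS (run a) f) longest_rev.
case: j jK E gh nh nf => [|[|j]] jK E gh nh nf.
- by case: nf; rewrite adv0.
- by case/negP: nh; rewrite flipK.
move: jK; rewrite -bK => jb.
by move: gh; rewrite g_flip_adv (tight_gap (jb : 0 < j.+1 <= run a)).
Qed.
End Tight.

Section Orbit.
Variables (a : I -> nat) (PD : I -> option bool) (f : flag).
Hypotheses (wa : wf a) (b0 : 0 < run a) (ex : [exists h, faces a h]) (np : nonper a).
Hypotheses (m4 : 4 < nlong a) (HS : forall h, pending PD h -> selected a h) (pf : pending PD f).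
Let a' := upd a f.
Let PD' := unpend PD f.1.

Lemma orb_selected h : selected a h -> nearest a h /\ ~~ axial a h.
Proof. by case/andP; rewrite /eligible (gtn_eqF b0) ex => /andP[]. Qed.

Let sf : selected a f := HS pf.
Let mf : nearest a f. Proof. by have [] := orb_selected sf. Qed.
Let cf : faces a f := nearest_faces mf.
Let m2 : nlong a != 2. Proof. by apply/eqP => E; move: m4; rewrite E. Qed.

Lemma orb_legal : legal a PD.
Proof.
move=> h /HS/orb_selected[/nearest_faces/and3P[g1 m1 m3] _]; split=> //.
by apply/negP => /HS/orb_selected[/nearest_faces/and3P[_ _]]; rewrite /opp flipK m1.
Qed.

Lemma orb_one x h : pending PD' x -> pending PD' h -> x = h.
Proof.
move=> /(pending'P orb_legal pf)[_ px nx _ _] /(pending'P orb_legal pf)[_ ph nh _ _].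
by have [//|//] := selected_le2 np sf (HS ph) (HS px) nh.
Qed.

(** A selected robot that has moved is strictly nearest, so the flags that are nearest or pending
    are this one and at most its mirror image: from here on [few] holds. *)
Lemma orb_stay : (2 < g a f) || ~~ R a (adv 1 f) (run a).-1 -> tracked a' PD'.
Proof.
move=> hd; have le := orb_legal; have [gf _ nm] := le f pf.
split; rewrite ?nlong_st //.
- rewrite run_st // face_st //; split=> //; [exact: faces_run cf | exact: legal_st].
- move=> _ h /(pending'P le pf)[_ /HS/orb_selected[/nearest_faces/and3P[_ m1 _] _] _ _ _].
  by rewrite (aimed_st wa b0 le pf hd).
- move=> _; split; last first.
    move=> h /(pending'P le pf)[ne /HS/orb_selected[mh _] _ _ _].
    by rewrite direct_st //; [apply: nearest_direct | apply/eqP].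
  case: (boolP [exists h, pending PD' h]) => [/existsP[h0 ph0]|]; last first.
    rewrite negb_exists => /forallP no.
    apply: (@leq_trans 1) => //; rewrite -(cards1 f) -cardsE; apply: subset_leq_card.
    apply/subsetP => x; rewrite !inE (negPf (no x)) orbF.
    by move/(nearest_st_min wa b0 le pf hd m2 mf)->.
  have [l El] : exists l : seq flag, l = [:: f; h0] by eexists.
  have <- : size l = 2 by rewrite El.
  apply: leq_trans (card_size l); apply: subset_leq_card; apply/subsetP => x.
  rewrite El !inE => /orP[/(nearest_st_min wa b0 le pf hd m2 mf)->|px]; rewrite ?eqxx //.
  by rewrite (orb_one px ph0) eqxx orbT.
by rewrite (negPf m2).
Qed.

Lemma orb_room : (run a).+2 < K.
Proof.
have bK := faces_run wa cf; rewrite ltn_neqAle bK andbT; apply/eqP => E.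
have /and3P[gf m1 nm] := cf.
have [l El] : exists l : seq flag, l = [:: adv 1 f; flip (adv (run a) (adv 1 f))] by eexists.
suff : nlong a <= size l by rewrite El leqNgt (ltn_trans _ m4).
apply: leq_trans (card_size l); apply: subset_leq_card; apply/subsetP => x.
by rewrite El !inE => /(tight_longest wa b0 E gf m1 nm)[] ->; rewrite eqxx ?orbT.
Qed.

Lemma orb_join : g a f = 2 -> tracked a' PD'.
Proof.
move=> g2; have le := orb_legal; have /and3P[gf m1 nm] := cf; have bK2 := orb_room.
have Hp := pending_unpend_legal le pf.
have Hm h : pending PD' h -> h <> adv (run a).+1 f /\ ~~ R a' (flip h) (run a) := pending_unpend_far wa le pf b0 g2 m1 bK2 (h := h).
apply: tracked_join => //.
case: (boolP [exists h, stray a' PD' h]) => [/existsP ex'|]; last first.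
  by rewrite negb_exists => /forallP; left.
right.
have Ht h : pending PD' h -> longest a (adv 1 h).
  by move=> /(pending'P le pf)[_ /HS/orb_selected[/nearest_faces/and3P[_ ? _] _]].
have Hq h : pending PD' h -> adv (run a).+1 h <> f.
  by move=> /Ht mh E; case/negP: nm; rewrite -E (advS (run a) h) longest_rev.
apply: stale_one => //.
  by move=> x h /andP[px _] /andP[ph _]; apply: orb_one px ph.
move=> h /andP[ph _] g2h mh.
have [_ ph0 nh _ _] := pending'P le pf ph; have [//|d] := selected_dir np sf (HS ph0).
(* The guard is at stake only if the far end of the target of [h] faces the extended block. Then [f]
   and [h] aim at neighbouring blocks with the axis between them, which is what [axial] rejects. *)
have [_ /negP[]] := orb_selected (HS ph0).
rewrite /axial; apply/eqP.
move: mh; rewrite longest_j // => /orP[]/eqP E.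
  by have := congr1 snd E; rewrite /= d; case: f.2.
have -> : opp (adv (run a).+1 h) = adv (run a).+1 f.
  by rewrite /opp advD add1n E flipK.
exact/word_adv/selected_word/sf/HS.
Qed.
End Orbit.

Definition fresh_ok a PD := [/\ nonper a, fresh a & forall f, pending PD f -> enabled a f].
Definition invariant a PD := [/\ wf a, (run a).+1 < K & tracked a PD \/ fresh_ok a PD].

Lemma invariant_look a PD f : invariant a PD -> PD f.1 = None -> enabled a f -> invariant a (put PD f).
Proof.
case=> wa bK [kt|[np fr HE]] N Ef; split=> //; first by left; apply: tracked_look.
by right; split=> // h; rewrite pending_put // => /orP[/eqP->|/HE].
Qed.

Lemma enabled_ex a PD : invariant a PD -> exists f, enabled a f.
Proof.
case=> wa bK; have [b0|b0] := posnP (run a).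
  move=> _; have fr : fresh a by rewrite /fresh b0.
  rewrite /enabled fr; case: (boolP (mirrored a)) => [/existsP[x sx]|ns].
    apply: (@selected_ex _ _ x); rewrite /eligible b0 /=; case: ifP => // /existsP[].
    by exists x.
  case: (arg_minnP (g a) (isT : (fun _ : flag => true) (ord0, true))) => x _ Hx.
  apply: (@selected_ex _ _ x); rewrite /eligible b0 /= (negPf ns); apply/forallP => h; exact: Hx.
case=> [kt|[np fr _]].
  rewrite /enabled (tracked_fresh kt); apply: nearest_ex; by case: kt => -[].
rewrite /enabled fr; case: (boolP [exists h, faces a h]) => [ex|nc].
  move: (fr); rewrite /fresh (gtn_eqF b0) ex /= => /andP[m4 c3].
  case: (boolP [exists f, nearest a f && ~~ axial a f]) => [/existsP[f Hf]|].
    by apply: (@selected_ex _ _ f); rewrite /eligible (gtn_eqF b0) ex.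
  (* The axis being unique, at most two flags are axial, whereas [fresh] provides more than two
     nearest ones. *)
  rewrite negb_exists => /forallP nf; exfalso.
  have Hfac f : nearest a f -> axial a f by move=> mf; have := nf f; rewrite mf negbK.
  have [f mf] : exists f, nearest a f.
    by apply: nearest_ex.
  have [h [mh hf]] : exists h, nearest a h /\ h <> f.
    have : 1 < #|[pred f | nearest a f]| by apply: ltnW.
    case/card_gt1P => u [v [mu mv nuv]]; rewrite !inE in mu mv.
    have [E|/eqP n] := eqVneq u f; last by exists u.
    by exists v; split=> // E'; move: nuv; rewrite E E' eqxx.
  suff : #|[pred f | nearest a f]| <= 2 by rewrite leqNgt c3.
  have [l El] : exists l : seq flag, l = [:: f; h] by eexists.
  have <- : size l = 2 by rewrite El.
  apply: leq_trans (card_size l); apply: subset_leq_card; apply/subsetP => x.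
  rewrite El !inE => mx1.
  case: (axial_uniq oddK np (Hfac f mf) (Hfac x mx1)) => [->|E1]; first by rewrite eqxx.
  case: (axial_uniq oddK np (Hfac f mf) (Hfac h mh)) => // E2.
  have -> : x = h by apply: (@adv_injl _ (run a).+1); rewrite E1 E2.
  by rewrite eqxx orbT.
case: (boolP (mirrored a)) => [sy|ns]; last first.
  have [e ge] := wa.2; apply: (@selected_ex _ _ (e, true)).
  by rewrite /eligible (gtn_eqF b0) (negPf nc) (negPf ns) /= andbT.
(* The robot [x] on the axis sees the two ends of its block at equal distances, so it is the middle
   of the block, and the ends are mirror images with the equal words that [eligible] asks for. *)
have /existsP[x /eqP Ex] := sy.
have [w mw] := run_ex a; rewrite -/(longest a w) in mw.
have [w' [mw' dw']] : exists w', longest a w' /\ w'.2 = x.2.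
  have [d|d] := eqVneq w.2 x.2; first by exists w.
  exists (flip (adv (run a) w)); rewrite longest_rev; split=> //=.
  by move: d; case: w.2; case: x.2.
have [j jK Ej] := same_dir dw'.
have Eq := divn_eq j (run a).+1.
have mq := eq_iter wa nc (j %/ (run a).+1) mw'.
have rl : j %% (run a).+1 <= run a by rewrite -ltnS ltn_pmod.
move: (j %/ _) (j %% _) Eq mq rl => q r Eq mq rl.
have {}Ej : x = adv r (adv (q * (run a).+1) w') by rewrite advD Ej Eq addnC.
move: (adv _ w') mq Ej => v mv Ej.
have Hx i : g a (adv i x) = g a (adv i (flip x)) by have /eqP/wordP := Ex; apply.
have back i : i <= r -> adv i (flip x) = flip (adv (r - i) v).
  by move=> ir; rewrite Ej adv_flip_le.
have gv i : i < run a -> g a (adv i v) = 1 by move/RP: mv; apply.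
have g1 : 1 < g a (adv (run a - r) x) by rewrite Ej advD subnK //; apply: longest_gap.
have g2 : 1 < g a (adv r (flip x)).
  by rewrite back // subnn adv0 -g_opp opp_flip; apply: longest_bwd_gap.
have h1 i : i < run a - r -> g a (adv i x) = 1.
  by move=> ir; rewrite Ej advD gv // -(subnK rl) ltn_add2r.
have h2 i : i < r -> g a (adv i (flip x)) = 1.
  move=> ir; rewrite back ?(ltnW ir) // -(prednK (n := r - i)) ?subn_gt0 // g_flip_adv gv //.
  by apply: leq_trans (leq_trans (leq_subr i r) rl); rewrite prednK ?subn_gt0.
have Er : r = run a - r.
  case: (ltngtP r (run a - r)) => // lt; first by move: g2; rewrite -Hx h1.
  by move: g1; rewrite Hx h2.
pose f := adv (run a - r) x.
have Ef : f = adv (run a) v by rewrite /f Ej advD subnK.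
apply: (@selected_ex _ _ f); rewrite /eligible (gtn_eqF b0) (negPf nc) g1 sy /=; apply/eqP.
rewrite {2}Ef adv_flip /f (word_adv _ Ex); congr word.
by rewrite -Er Ej adv_flip.
Qed.
End Invariant.

(** * Potential *)

Section Potential.
Variable k' : nat.
Notation K := k'.+3.
Notation I := 'I_K.
Notation flag := (flag k').
Implicit Types (f x y h : flag) (a : I -> nat) (i j m : nat) (PD : I -> option bool).

Hypothesis oddK : odd K.

Lemma sum_upd a f : 0 < g a f -> \sum_e upd a f e = \sum_e a e.
Proof.
move=> g0; rewrite (bigD1 (edge f)) //= (bigD1 (edge (flip f))) /=; last first.
  by rewrite eq_sym; apply: edge_flip.
rewrite [RHS](bigD1 (edge f)) //= [X in _ = _ + X](bigD1 (edge (flip f))) /=; last first.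
  by rewrite eq_sym; apply: edge_flip.
rewrite [X in _ + (_ + X) = _](eq_bigr a); last first.
  by move=> e /andP[/negPf n1 /negPf n2]; rewrite /upd n1 n2.
rewrite /upd eqxx [edge (flip f) == edge f]eq_sym (negPf (edge_flip f)) eqxx.
by rewrite !addnA addnS -addSn prednK.
Qed.

Variable N : nat.
Definition B2 := (6 * N).+1.
Definition B1 := 2 * B2.
Definition slow a PD := nearsum a + 2 * ndetour a PD.
(* [slow] counts single steps; [B2] pays for leaving a state with a unique longest block or with
   equal blocks only, [B1] for a join.  Before the first join, the sum of squares increases. *)
Definition potential a PD :=
  if run a == 0 then K.+1 * B1 + (N ^ 2 - sumsq a)
  else (K - run a) * B1 +
    (if [exists h, faces a h] then (if nlong a == 2 then B2 else 0) + slow a PD else B2).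

Lemma shift_sum a : \sum_(o : I) g a (o, false) = \sum_o a o.
Proof.
rewrite [RHS](reindex_inj (h := fun o : I => (o - 1)%R)) //.
by move=> x y /GRing.addIr.
Qed.

(** Each robot contributes at most its two adjacent gaps to [nearsum], in all [2 * N]; there are
    [2 * K] flags, at most [2 * N], and they count twice. This gives the [6 * N] of [B2]. *)
Lemma slow_le a PD : wf a -> \sum_e a e = N -> slow a PD < B2.
Proof.
move=> wa Na; have KN : K <= N.
  rewrite -Na -[X in X <= _](card_ord K) -sum1_card; apply: leq_sum => e _; exact: wa.1.
have s2 : nearsum a <= N + N.
  rewrite -{1}Na -{1}Na -[X in _ + X]shift_sum /nearsum -big_split /=.
  apply: leq_sum => o _; rewrite /near -[a o]/(g a (o, true)).
  case: ifP => _; case: ifP => _ //; rewrite ?leq_addr ?leq_addl //.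
  exact: leq_trans (geq_minl _ _) (leq_addr _ _).
have d2 : ndetour a PD <= K + K.
  have -> : K + K = #|{: flag}| by rewrite card_prod card_ord card_bool muln2 addnn.
  exact: max_card.
rewrite /slow /B2 ltnS; apply: (@leq_trans ((N + N) + 2 * (N + N))).
  apply: leq_add s2 _; rewrite leq_mul2l /=; apply: leq_trans d2 _; exact: leq_add.
by clear; lia.
Qed.

Lemma sumsq_le a : \sum_e a e = N -> sumsq a <= N ^ 2.
Proof.
move=> <-; rewrite /sumsq expnS expn1 big_distrl /=; apply: leq_sum => e _.
by rewrite expnS expn1 leq_mul2l (bigD1 e) //= leq_addr orbT.
Qed.

(** Besides the multiple of [B1] there is at most [B2] plus a value below [B2], which is less than
    [B1]. *)
Lemma potential_late a PD : wf a -> \sum_e a e = N -> 0 < run a ->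
  potential a PD < (K - run a).+1 * B1.
Proof.
move=> wa Na b0; rewrite /potential (gtn_eqF b0) mulSn addnC ltn_add2r.
have := slow_le PD wa Na; rewrite /B1; move: (slow a PD) B2 => s b; clear.
case: ifP => _; first case: ifP => _; lia.
Qed.

Lemma potential_le a PD : wf a -> \sum_e a e = N -> potential a PD <= K.+1 * B1 + N ^ 2.
Proof.
move=> wa Na; case: (posnP (run a)) => b0.
  by rewrite /potential b0 /= leq_add2l leq_subr.
apply: leq_trans (ltnW (potential_late PD wa Na b0)) _.
apply: leq_trans (leq_addr _ _); rewrite leq_mul2r ltnS leq_subr orbT //.
Qed.

Lemma potential_grow a a' PD PD' : wf a' -> \sum_e a' e = N -> 0 < run a -> run a' = (run a).+1 ->
  run a' < K -> potential a' PD' < potential a PD.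
Proof.
move=> wa' Na' b0 E bK; apply: leq_trans (potential_late PD' wa' Na' _) _; first by rewrite E.
rewrite /potential (gtn_eqF b0); apply: leq_trans (leq_addr _ _).
by rewrite leq_mul2r E subnSK ?leqnn ?orbT //; apply: ltnW; rewrite -E.
Qed.

Lemma potential_sub a a' PD PD' : wf a' -> \sum_e a' e = N -> 0 < run a -> run a' = run a ->
  [exists h, faces a' h] -> nlong a' != 2 -> (nlong a == 2) || ~~ [exists h, faces a h] ->
  potential a' PD' < potential a PD.
Proof.
move=> wa' Na' b0 E ex /negPf m2 H.
rewrite /potential E (gtn_eqF b0) ex m2 ltn_add2l add0n.
apply: leq_trans (slow_le PD' wa' Na') _.
by case: ifP H => [_|_ _] //; rewrite orbF => ->; apply: leq_addr.
Qed.

Lemma potential_slow a a' PD PD' : 0 < run a -> run a' = run a ->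
  [exists h, faces a h] -> [exists h, faces a' h] = [exists h, faces a h] -> nlong a' = nlong a ->
  slow a' PD' < slow a PD -> potential a' PD' < potential a PD.
Proof. by move=> b0 E ex ex' m H; rewrite /potential E (gtn_eqF b0) ex' ex m !ltn_add2l. Qed.

(** A newly computed move is direct, so [ndetour] does not change. *)
Lemma potential_look a PD f : invariant a PD -> PD f.1 = None -> enabled a f -> potential a (put PD f) = potential a PD.
Proof.
case=> wa bK Hi Nf Ef; rewrite /potential; case: eqP => // /eqP; rewrite -lt0n => b0.
case: ifP => // ex; congr (_ + (_ + _)); rewrite /slow; congr (_ + 2 * _).
have mf : nearest a f.
  case: Hi => [kt|[np fr _]]; first by move: Ef; rewrite /enabled (tracked_fresh kt).
  by move: Ef; rewrite /enabled fr => /andP[]; rewrite /eligible (gtn_eqF b0) ex => /andP[].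
apply: eq_card => h; rewrite !inE pending_put //; case: eqP => [->|//] /=.
by rewrite (nearest_direct b0 mf) andbF.
Qed.

Definition full a := run a = K.-1.

(** A tie is paid by [B2] because it ends the uniqueness of the longest block, and the first
    departure from equal blocks is paid in the same way; the single block arises only from the last
    join. *)
Theorem invariant_step a PD f : invariant a PD -> \sum_e a e = N -> pending PD f ->
  let a' := upd a f in let PD' := unpend PD f.1 in
  [/\ wf a', \sum_e a' e = N &
      invariant a' PD' /\ potential a' PD' < potential a PD \/ full a' /\ forall h, ~~ pending PD' h].
Proof.
move=> [wa bK Hi] Na pf; set a' := upd a f; set PD' := unpend PD f.1; move=> /=.
have gf : 1 < g a f.
  case: Hi => [[[_ _ _ le] _ _ _]|[np fr HE]]; first by have [] := le f pf.
  have := HE f pf; rewrite /enabled fr; have [b0|b0] := posnP (run a).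
    by move=> _; apply: dust_gap.
  by case/andP; rewrite /eligible (gtn_eqF b0); case: ifP => _ /andP[//] /nearest_faces/and3P[].
have wa' : wf a' by apply: wf_upd.
have Na' : \sum_e a' e = N by rewrite sum_upd // ltnW.
split=> //.
have bKl : (run a).+2 < K \/ (run a).+2 = K by move: bK; rewrite leq_eqVlt => /orP[/eqP|]; [right|left].
case: Hi => [kt|[np fr HE]].
  have [[b0 _ ex le] t2 t4 t1] := kt; have [_ _ nm] := le f pf.
  case: (boolP ((2 < g a f) || ~~ R a (adv 1 f) (run a).-1)) => [hd|]; last first.
    rewrite negb_or negbK -leqNgt => /andP[g2' HR].
    have g2 : g a f = 2 by apply/eqP; rewrite eqn_leq g2'.
    case: (boolP (longest a (adv 1 f))) => [mf|nma].
      case: bKl => [bK2|bK2].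
        left; have kt' : tracked a' PD'.
          by case: (boolP (nlong a == 2)) => m2; [apply: tracked_join_two|apply: tracked_join_many].
        have bE : run a' = (run a).+1 by apply: run_join.
        split; first by split; [|rewrite bE|left].
        by apply: potential_grow; rewrite ?bE.
      right; split; first by rewrite /full /a' run_join // -bK2.
      move=> h; rewrite pending_unpend; apply/negP => /andP[/eqP n ph].
      by case: (tight_pending bK2 mf le ph n).
    left; have kt' : tracked a' PD' by apply: tracked_tie.
    have bE : run a' = run a by apply: run_tie.
    split; first by split; [|rewrite bE|left].
    have m2 : nlong a == 2 by apply: contraT => /t2/(_ f pf); rewrite /aimed (negPf nma).
    have [[_ _ ex' _] _ _ _] := kt'.
    apply: potential_sub => //; last by rewrite m2.
    apply/eqP => m2'.
    have mf' : longest a' f by rewrite /a' longest_tie // eqxx orbT.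
    have [v mv] := run_ex a; rewrite -/(longest a v) in mv.
    have mv' : longest a' v by rewrite /a' longest_tie // mv.
    have nf := nmf gf b0.
    case: (@nlong2P _ a' v f _ mv' mf'); first by rewrite m2'.
      by move=> Efv; rewrite Efv mv in nf.
    by rewrite bE => Efv; rewrite Efv longest_rev mv in nf.
  left; have bE : run a' = run a by apply: run_st.
  split; first by split; [|rewrite bE|left; apply: tracked_stay].
  apply: potential_slow => //; [exact: face_st|exact: nlong_st|exact: potential_st].
have [b0|b0] := posnP (run a).
  have sf : selected a f by have := HE f pf; rewrite /enabled fr.
  left; have [g2|g3] : g a f = 2 \/ 2 < g a f.
    by move: gf; rewrite leq_eqVlt => /orP[/eqP|]; [left|right].
    have [kt bE] := dust_tracked oddK wa np b0 sf HE g2.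
    split; first by split=> //; [rewrite bE|left].
    apply: (@leq_trans ((K - run a').+1 * B1)); first by apply: potential_late; rewrite ?bE.
    rewrite /potential b0 /= bE; apply: leq_trans (leq_addr _ _).
    by rewrite leq_mul2r ltnS leq_subr orbT.
  have bE : run a' = 0 by apply: dust_stay.
  split.
    split=> //; first by rewrite bE.
    right; split; first exact: dust_nonper.
      by rewrite /fresh bE.
    move=> h; have /negPf -> // : ~~ pending PD' h.
    by apply: unpend_none => z /HE; rewrite /enabled fr; apply: dust_alone.
  rewrite /potential b0 bE /= ltn_add2l; apply: ltn_sub2l (dust_sumsq oddK wa b0 sf).
  apply: leq_trans (dust_sumsq oddK wa b0 sf) (sumsq_le Na').
have HS h : pending PD h -> selected a h by move=> /HE; rewrite /enabled fr.
have sf := HS f pf.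
case: (boolP [exists h, faces a h]) => [ex|nc].
  have m4 : 4 < nlong a by move: fr; rewrite /fresh (gtn_eqF b0) ex => /andP[].
  have le := orb_legal b0 ex HS; have [_ _ nm] := le f pf.
  have [/nearest_faces/and3P[_ mf _] _] := orb_selected b0 ex sf.
  case: (boolP ((2 < g a f) || ~~ R a (adv 1 f) (run a).-1)) => [hd|]; last first.
    rewrite negb_or negbK -leqNgt => /andP[g2' HR].
    have g2 : g a f = 2 by apply/eqP; rewrite eqn_leq g2'.
    have bK2 := orb_room wa b0 ex m4 HS pf.
    have bE : run a' = (run a).+1 by apply: run_join.
    left; split; first by split; [|rewrite bE|left; apply: orb_join].
    by apply: potential_grow; rewrite ?bE.
  left; have bE : run a' = run a by apply: run_st.
  split; first by split; [|rewrite bE|left; apply: orb_stay].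
  apply: potential_slow => //; [exact: face_st|exact: nlong_st|exact: potential_st].
have bK2 := eq_room wa b0 bK nc.
have [g2|g3] : g a f = 2 \/ 2 < g a f.
  by move: gf; rewrite leq_eqVlt => /orP[/eqP|]; [left|right].
  have [mf _] := eq_gap wa nc gf.
  have bE : run a' = (run a).+1 by apply: run_join.
  left; split; first by split; [|rewrite bE|left; apply: eqj_tracked].
  by apply: potential_grow; rewrite ?bE.
have bE : run a' = run a by apply: eqs_run.
have kt : tracked a' PD' by apply: eqs_tracked.
left; split; first by split; [|rewrite bE|left].
have [[_ _ ex' _] _ _ _] := kt.
apply: potential_sub => //; last by rewrite nc orbT.
exact: eqs_nlong.
Qed.
End Potential.

(** * Rounds *)

Lemma lex_lt_total s t : ~~ lex_lt s t -> ~~ lex_lt t s -> s = t.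
Proof.
elim: s t => [|x s IH] [|y t] //=.
rewrite !negb_or !negb_and -!leqNgt => /andP[le1 H1] /andP[le2 H2].
have E : x = y by apply/eqP; rewrite eqn_leq le1 le2.
by move: H1 H2; rewrite E eqxx /= => H1 H2; rewrite (IH t).
Qed.

Lemma lex_lt_asym s t : lex_lt s t -> ~~ lex_lt t s.
Proof.
elim: s t => [|x s IH] [|y t] //=; case: (ltngtP x y) => //= _; exact: IH.
Qed.

Section Rounds.
Variables (n k : nat) (P : protocol).
Variable D : seq nat -> bool -> bool.
Hypothesis PE : forall v t, P v t = if D v t then Front else if D (rev v) t then Back else Stay.

Definition robot_view (c : config n k) r (p : bool) :=
  if p then cw_segs c (c r) else rev (cw_segs c (c r)).

(** The rule tests both readings, so the lexicographic maximum and the scheduler only choose between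
    directions that are accepted anyway. *)
Lemma compute_spec (c : config n k) r b :
  match compute_move P c r b with
  | Some p => D (robot_view c r p) (is_tower c r)
  | None => ~~ D (robot_view c r true) (is_tower c r) && ~~ D (robot_view c r false) (is_tower c r)
  end.
Proof.
rewrite /compute_move /view /=; move: (is_tower c r) => t; rewrite !PE /robot_view.
move: (cw_segs c (c r)) => s.
case: (boolP (lex_lt s (rev s))) => lt.
  rewrite (negPf (lex_lt_asym lt)) revK.
  by case: (boolP (D (rev s) t)) => D1; case: (boolP (D s t)) => D2.
case: (boolP (lex_lt (rev s) s)) => lt'.
  by case: (boolP (D s t)) => D2; case: (boolP (D (rev s) t)) => D1.
have E := lex_lt_total lt lt'; rewrite -E.
by case: (boolP (D s t)) => D2 /=; case: b; rewrite -?E ?D2.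
Qed.

Definition effective (st : state n k) r := exists p, spend st r = Some (Some p).

(** An invariant together with the value of a measure that only moves to another node decrease; both
    stages are instances. *)
Variable Inv : state n k -> nat -> Prop.
Hypothesis Inv_idle : forall st mu r b, Inv st mu -> ~ effective st r -> Inv (step P st (r, b)) mu.
Hypothesis Inv_move : forall st mu r b, Inv st mu -> effective st r ->
  exists2 mu', mu' < mu & Inv (step P st (r, b)) mu'.

Definition met (st : state n k) := forall r r', spos st r = spos st r'.
Hypothesis Inv_progress : forall st mu, Inv st mu ->
  met st \/ exists r, forall b, compute_move P (spos st) r b <> None.
Hypothesis Inv_met : forall st mu r, Inv st mu -> met st -> ~ effective st r.

Lemma effectiveP st r : {effective st r} + {~ effective st r}.
Proof.
rewrite /effective; case: (spend st r) => [[p|]|]; last by right; case.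
  by left; exists p.
by right; case.
Qed.

Lemma spos_idle st r b : ~ effective st r -> spos (step P st (r, b)) =1 spos st.
Proof.
move=> ne r'; rewrite /step; case E: (spend st r) => [[p|]|] //=.
  by case: ne; exists p.
by case: eqP => [->|].
Qed.

Lemma met_step st mu rb : Inv st mu -> met st ->
  Inv (step P st rb) mu /\ spos (step P st rb) =1 spos st.
Proof.
case: rb => r b iv mt; have ne := Inv_met (r := r) iv mt.
by split; [apply: Inv_idle|apply: spos_idle].
Qed.

Variables (c0 : config n k) (sc : schedule k).
Notation X := (exec P c0 sc).

Lemma exec_le t d mu : Inv (X t) mu -> exists2 mu', mu' <= mu & Inv (X (t + d)) mu'.
Proof.
move=> iv; elim: d => [|d [mu' le iv']]; first by exists mu; rewrite ?addn0.
rewrite addnS /=; case: (sc _) => r b; case: (effectiveP (X (t + d)) r) => e.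
  by have [m2 lt H] := Inv_move b iv' e; exists m2 => //; apply: leq_trans le; apply: ltnW.
by exists mu' => //; apply: Inv_idle.
Qed.

Lemma met_exec t d mu : Inv (X t) mu -> met (X t) ->
  Inv (X (t + d)) mu /\ spos (X (t + d)) =1 spos (X t).
Proof.
move=> iv mt; elim: d => [|d [iv' E]]; first by rewrite addn0.
rewrite addnS /=; have mt' : met (X (t + d)) by move=> r r'; rewrite !E.
by have [H1 H2] := met_step (sc (t + d)) iv' mt'; split=> // r; rewrite H2 E.
Qed.

Definition quiet t0 t1 := forall t, t0 <= t < t1 -> ~ effective (X t) (sc t).1.

Lemma quiet_spos t0 t1 t : quiet t0 t1 -> t0 <= t <= t1 -> spos (X t) =1 spos (X t0).
Proof.
move=> q; elim: t => [|t IH] /andP[le1 le2]; first by move: le1; rewrite leqn0 => /eqP->.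
move: le1; rewrite leq_eqVlt => /orP[/eqP<- //|le1] r.
rewrite ltnS in le1; rewrite -IH ?le1 ?(ltnW le2) //=.
have := q t; rewrite le1 le2 => /(_ isT); case: (sc t) => r0 b ne.
exact: spos_idle.
Qed.

Lemma quiet_dec t0 t1 : quiet t0 t1 \/ exists2 t, t0 <= t < t1 & effective (X t) (sc t).1.
Proof.
elim: t1 => [|t1 [q|[t /andP[le1 le2] e]]].
- by left=> t; rewrite ltn0 andbF.
- case: (effectiveP (X t1) (sc t1).1) => [e|ne].
    have [le|lt] := leqP t0 t1; first by right; exists t1; rewrite ?le /=.
    by left=> t /andP[le1]; rewrite ltnS => le2; move: (leq_trans lt le1); rewrite ltnNge le2.
  left=> t /andP[le1]; rewrite ltnS leq_eqVlt => /orP[/eqP->//|lt].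
  by apply: q; rewrite le1.
by right; exists t; rewrite // le1 ltnW.
Qed.

(** If no robot changes node during two rounds, every snapshot is the same. A robot that must move
    in it empties an older decision in the first round, so the Move phase of the second round is
    effective, a contradiction. *)
Lemma two_rounds t0 t1 t2 mu : covers P c0 sc t0 t1 -> covers P c0 sc t1 t2 -> Inv (X t0) mu ->
  (exists2 mu', mu' < mu & Inv (X t2) mu') \/ met (X t0).
Proof.
move=> cv1 cv2 iv; case: (quiet_dec t0 t2) => [q|[t /andP[le1 le2] e]]; last first.
  left; have [m1 le iv1] := exec_le (t - t0) iv; rewrite subnKC // in iv1.
  have iv1' : exists2 m2, m2 < m1 & Inv (X t.+1) m2.
    rewrite /=; move: e; case: (sc t) => r b /= e; exact: Inv_move.
  have [m2 lt iv2] := iv1'.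
  have [m3 le3 iv3] := exec_le (t2 - t.+1) iv2; rewrite subnKC // in iv3.
  by exists m3 => //; apply: leq_ltn_trans le3 (leq_trans lt le).
case: (Inv_progress iv) => [|[r Hr]]; first by right.
have [ta [/andP[a1 a2] [ra sa]]] := cv1 r.
have [tb [/andP[b1 b2] [rb sb]]] := cv2 r.
have lt_ab : ta < tb := leq_trans a2 b1.
(* After its first Move phase the robot [r] is idle or holds a decision to move, since any further
   Look sees the unchanged positions. *)
have late d : ta.+1 + d <= tb ->
    spend (X (ta.+1 + d)) r = None \/ exists p, spend (X (ta.+1 + d)) r = Some (Some p).
  elim: d => [|d IH].
    rewrite addn0 => _; left; rewrite /=; move: ra; case: (sc ta) => r0 b /= E0.
    by rewrite E0 /step; case: (spend (X ta) r) sa => //= m _; rewrite eqxx.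
  rewrite addnS => lt; have {IH} := IH (ltnW lt).
  move: (ta.+1 + d) lt (leq_addr d ta.+1) => t lt le IH.
  have tq : t0 <= t < t2 by rewrite (leq_trans a1 (ltnW le)) (leq_trans lt (ltnW b2)).
  have := q t tq; rewrite /=; case E : (sc t) => [r0 b] /= ne.
  rewrite /step; case E1 : (spend (X t) r0) => [m|] /=.
    case: eqP => [_|_]; [by left|exact: IH].
  case: eqP => [Er|_]; last exact: IH.
  right; have sp : spos (X t) = spos (X t0).
    apply: FunctionalExtensionality.functional_extensionality => z.
    by apply: (quiet_spos q); case/andP: tq => -> /ltnW ->.
  by have := Hr b; rewrite -sp Er; case: (compute_move _ _ _ _) => // p _; exists p.
have := late (tb - ta.+1); rewrite subnKC // => /(_ (leqnn _))[//|[p Ep]].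
have [] := q tb; first by rewrite b2 (leq_trans a1) // ltnW.
by rewrite rb; exists p.
Qed.

Lemma covers_lt t0 t1 : 0 < k -> covers P c0 sc t0 t1 -> t0 < t1.
Proof.
by move=> k0 /(_ (Ordinal k0))[t [/andP[le lt] _]]; apply: leq_ltn_trans le lt.
Qed.

(** Each pair of rounds costs a unit of the measure until the robots have met, so [M.+1] pairs are
    too many. *)
Theorem rounds_gather M R t : 0 < k -> Inv (X 0) M -> 2 * M.+1 <= R ->
  rounds_done_by P c0 sc R t -> gathered_from P c0 sc t.
Proof.
move=> k0 iv0 MR [ts [ts0 [tsR cov]]].
have mono i j : i <= j <= R -> ts i <= ts j.
  elim: j => [|j IH] /andP[le1 le2]; first by move: le1; rewrite leqn0 => /eqP->.
  move: le1; rewrite leq_eqVlt => /orP[/eqP-> //|le1].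
  apply: leq_trans (IH _) _; first by rewrite -ltnS le1 ltnW.
  by apply: ltnW; apply: covers_lt k0 (cov j le2).
have key m : m <= M.+1 -> (exists2 mu, mu + m <= M & Inv (X (ts (2 * m))) mu) \/
    exists s mu, [/\ s <= ts (2 * m), Inv (X s) mu & met (X s)].
  elim: m => [|m IH] le; first by left; exists M; rewrite ?addn0 // muln0 ts0.
  have leR : (2 * m).+2 <= R.
    by apply: leq_trans MR; rewrite -[(2 * m).+2]/(2 + 2 * m) -mulnS leq_mul2l.
  have le2 : 2 * m.+1 = (2 * m).+2 by rewrite mulnS.
  have leT : ts (2 * m) <= ts (2 * m.+1) by apply: mono; rewrite le2 leR andbT; do 2!apply: ltnW.
  case: (IH (ltnW le)) => [[mu Hm iv]|[s [mu [H1 H2 H3]]]]; last first.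
    by right; exists s, mu; split=> //; apply: leq_trans leT.
  case: (two_rounds (cov _ (ltnW leR)) (cov _ leR) iv) => [[mu' lt iv']|mt].
    left; exists mu'; last by rewrite le2.
    by rewrite addnS; apply: leq_trans Hm; rewrite -addSn leq_add2r.
  by right; exists (ts (2 * m)), mu.
case: (key M.+1 (leqnn _)) => [[mu le _]|[s [mu [le iv mt]]]].
  by move: le; rewrite addnS ltnNge leq_addl.
have st : s <= t.
  apply: leq_trans le (leq_trans _ tsR); apply: mono; by rewrite MR leqnn.
exists (spos (X s) (Ordinal k0)) => t' lt r.
have [_ E] := met_exec (t' - s) iv mt; rewrite subnKC in E; last exact: leq_trans lt.
by rewrite E.
Qed.
End Rounds.

(** * Folding a single block *)

Section Segments.
Variables (n k : nat) (c : config n k).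
Implicit Types (s : seq nat) (u v : nat).

(* [s] lists the segments of [c] read clockwise from the node [u] *)
Definition segments u s :=
  [/\ all (fun x => 0 < x) s, sumn s = n, 0 < size s,
      forall m, m < size s -> exists r, c r = (u + sumn (take m s)) %% n :> nat
    & forall r, exists2 m, m < size s & c r = (u + sumn (take m s)) %% n :> nat].

Lemma segs_mod u v s : u = v %[mod n] -> segments u s -> segments v s.
Proof.
move=> E [H1 H2 H3 H4 H5]; have E' x : (v + x) %% n = (u + x) %% n by rewrite -modnDml -E modnDml.
split=> //; first by move=> m /H4[r Er]; exists r; rewrite E'.
by move=> r; have [m ms Em] := H5 r; exists m; rewrite ?E'.
Qed.

Lemma segs_rot1 u x s : segments u (x :: s) -> segments (u + x) (rcons s x).
Proof.
case=> /= /andP[x0 H1] H2 _ H4 H5; split.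
- by rewrite all_rcons x0.
- by rewrite -cats1 sumn_cat /= addn0 addnC.
- by rewrite size_rcons.
- move=> m; rewrite size_rcons ltnS leq_eqVlt => /orP[/eqP->|lt].
    have [r Er] := H4 0 isT; exists r; rewrite Er take0 addn0.
    by rewrite -cats1 take_size_cat // -addnA H2 modnDr.
  have [r Er] := H4 m.+1 lt; exists r; rewrite Er /= addnA -cats1 takel_cat //.
  exact: ltnW.
move=> r; have [[|m] lt Er] := H5 r.
  exists (size s); rewrite ?size_rcons // Er take0 addn0.
  by rewrite -cats1 take_size_cat // -addnA H2 modnDr.
exists m; first by rewrite size_rcons ltnS; apply: ltnW.
by rewrite Er /= addnA -cats1 takel_cat // ltnW.
Qed.

Lemma segs_rot u s m : m <= size s -> segments u s -> segments (u + sumn (take m s)) (rot m s).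
Proof.
elim: m => [|m IH] lt arm; first by rewrite take0 rot0 addn0.
rewrite rotS // (take_nth 0) // -cats1 sumn_cat /= addn0 addnA.
have := IH (ltnW lt) arm; rewrite /(rot m s) (drop_nth 0) //= => /segs_rot1.
by rewrite rot1_cons.
Qed.

Lemma scanl_mem x s j :
  (j \in x :: scanl addn x s) = [exists m : 'I_(size s).+1, j == x + sumn (take m s)].
Proof.
elim: s x => [|y s IH] x.
  rewrite inE; apply/eqP/existsP => [->|[m /eqP->]]; last by rewrite addn0.
  by exists ord0; rewrite addn0.
rewrite /= inE IH; apply/orP/existsP => [[/eqP->|/existsP[m /eqP->]]|[[m lt] /eqP->]].
- by exists ord0; rewrite take0 addn0.
- have lt : m.+1 < (size s).+2 by rewrite ltnS; apply: ltn_ord.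
  by exists (Ordinal lt); rewrite /= addnA.
case: m lt => [|m] lt; first by left; rewrite take0 addn0.
by right; apply/existsP; exists (Ordinal (lt : m < (size s).+1)); rewrite /= addnA.
Qed.

Lemma scanl_sorted x s : all (fun y => 0 < y) s -> path ltn x (scanl addn x s).
Proof. by elim: s x => //= y s IH x /andP[y0 /IH->]; rewrite -{1}(addn0 x) ltn_add2l y0. Qed.

Lemma sumn_take_lt s m : all (fun y => 0 < y) s -> m < size s -> sumn (take m s) < sumn s.
Proof.
move=> al lt; rewrite -{2}(cat_take_drop m s) sumn_cat -{1}[sumn _]addn0 ltn_add2l.
rewrite (drop_nth 0) //= addn_gt0; move/allP: al => /(_ (nth 0 s m)) -> //.
exact: mem_nth.
Qed.

(** The distances of the occupied nodes, closed by [n], and the partial sums of [s] are strictly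
    increasing lists with the same elements, hence equal. *)
Lemma cw_segsE (u : 'I_n) s : segments u s -> cw_segs c u = s.
Proof.
case=> al near s0 H1 H2; have n0 : 0 < n := leq_ltn_trans (leq0n u) (ltn_ord u).
suff E : rcons (occ_dists c u) n = 0 :: scanl addn 0 s.
  rewrite /cw_segs /=; case: (occ_dists c u) E => [|x d] /= [].
    by case: (s) s0.
  by move=> _ ->; rewrite scanlK // => x' y; rewrite addKn.
have psum_mod x y : x < n -> y < n -> (u + x) %% n = (u + y) %% n -> x = y.
  by move=> xn yn /eqP; rewrite eqn_modDl !modn_small // => /eqP.
have so1 : sorted ltn (occ_dists c u).
  apply: sorted_filter; [exact: ltn_trans|exact: iota_ltn_sorted].
apply: (irr_sorted_eq ltn_trans ltnn).
- have bd : all (fun x => x < n) (occ_dists c u).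
    by apply/allP => x; rewrite mem_filter mem_iota => /andP[_].
  case: (occ_dists c u) so1 bd => [//|x d] /= so1 /andP[xn bd].
  rewrite rcons_path so1 /=; case/lastP: d bd {so1} => [|d y]; first by [].
  by rewrite all_rcons last_rcons => /andP[].
- exact: scanl_sorted.
move=> j; rewrite scanl_mem mem_rcons inE mem_filter mem_iota /= add0n.
apply/orP/existsP => [[/eqP->|/andP[/existsP[r /eqP Er] jn]]|[[m lt] /eqP-> /=]].
- by exists ord_max; rewrite add0n take_size near.
- have [m ms Em] := H2 r; have lt : m < (size s).+1 by apply: ltnW.
  exists (Ordinal lt); rewrite add0n /=; apply/eqP/psum_mod => //.
    by rewrite -near; apply: sumn_take_lt.
  by rewrite -Er Em.
rewrite add0n; move: lt; rewrite ltnS leq_eqVlt => /orP[/eqP->|lt].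
  by left; rewrite take_size near.
right; rewrite -{2}near sumn_take_lt // andbT; have [r Er] := H1 m lt.
by apply/existsP; exists r; rewrite Er.
Qed.
End Segments.

(** * Two arms around a centre and the rule that folds them *)

Section Line.
Implicit Types (A h : bool -> nat) (p q : bool) (x : bool * nat) (l s : seq nat).

(* An arm has its robots of rank at most [h] packed against the centre, the others one node further
   away; [h] equals the length of the arm when there is no hole. *)
Definition pos (h i : nat) := if i <= h then i else i.+1.
Definition arm (A h : nat) := mkseq (fun j => if j == h then 2 else 1) A.
Definition line A h p := rev (arm (A (~~ p)) (h (~~ p))) ++ arm (A p) (h p).
(* rank of the robot [x] on the line read in direction [p] *)
Definition idx A p x := if x.1 == p then A (~~ p) + x.2 else A (~~ p) - x.2.

Lemma size_arm (A h : nat) : size (arm A h) = A. Proof. exact: size_mkseq. Qed.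

Lemma nth_arm (A h j : nat) : j < A -> nth 0 (arm A h) j = if j == h then 2 else 1.
Proof. exact: nth_mkseq. Qed.

Lemma sumn_arm (A h i : nat) : i <= A -> sumn (take i (arm A h)) = pos h i.
Proof.
elim: i => [|i IH] lt; first by rewrite take0.
rewrite (take_nth 0) ?size_arm // -cats1 sumn_cat IH ?(ltnW lt) //= addn0 nth_arm //.
by rewrite /pos; case: (ltngtP i h); rewrite ?addn1 ?addn2.
Qed.

Lemma sumn_arm_all (A h : nat) : sumn (arm A h) = pos h A.
Proof. by rewrite -(sumn_arm h (leqnn A)) take_oversize // size_arm. Qed.

Lemma pos_le (h i j : nat) : i <= j -> pos h i <= pos h j.
Proof. rewrite /pos; case: (leqP i h); case: (leqP j h); lia. Qed.

Lemma arm_small (A h : nat) : all (fun y => (0 < y) && (y <= 2)) (arm A h).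
Proof. by apply/allP => y /mapP[j _ ->]; case: ifP. Qed.

Lemma arm_ones (A h : nat) : all (pred1 1) (arm A h) = (A <= h).
Proof.
apply/allP/idP => [H|le y /mapP[j]].
  rewrite leqNgt; apply/negP => lt; have := H 2; rewrite /= => /(_ _)/eqP.
  suff -> : 2 \in arm A h by move=> /(_ isT).
  apply/mapP; exists h; rewrite ?mem_iota ?eqxx //.
by rewrite mem_iota /= add0n => lt ->; rewrite (ltn_eqF (leq_trans lt le)).
Qed.

Lemma size_line A h p : size (line A h p) = A (~~ p) + A p.
Proof. by rewrite size_cat size_rev !size_arm. Qed.

Lemma line_rev A h p : line A h (~~ p) = rev (line A h p).
Proof. by rewrite /line rev_cat revK negbK. Qed.

Lemma line_small A h p : all (fun y => (0 < y) && (y <= 2)) (line A h p).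
Proof. by rewrite all_cat all_rev !arm_small. Qed.

Lemma idx_le A p x : x.2 <= A x.1 -> idx A p x <= A (~~ p) + A p.
Proof.
rewrite /idx; case: eqP => [->|_] le; first by rewrite leq_add2l.
exact: leq_trans (leq_subr _ _) (leq_addr _ _).
Qed.

Lemma idx_rev A p x : x.2 <= A x.1 -> idx A (~~ p) x = A (~~ p) + A p - idx A p x.
Proof.
case: x => q i /=; rewrite /idx negbK /=; case: p; case: q => /= le; lia.
Qed.

(** [l] is the line read in the direction of the move, [m] the index of the robot on it. An odd
    number of nodes means equal arms with the centre at index [B]: without holes the robot before
    the centre merges, otherwise a robot before a hole closes it. An even number means that one arm
    has merged first: its hole just after index [B] identifies the centre. With two nodes left the
    tower bit does. *)
Definition core l m t :=
  let B := (size l).+1./2 in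
  if odd (size l).+1 then
    if all (pred1 1) l then m.+1 == B else (m < B) && (nth 0 l m == 2)
  else if size l == 1 then (m == 0) && ~~ t else (nth 0 l B == 2) && (m.+1 == B).

(* the largest segment, the only one longer than 2, separates the two ends of the line *)
Definition Dec4 (v : seq nat) (t : bool) :=
  let i := find (fun y => 2 < y) v in
  core (drop i.+1 v ++ take i v) (size v - i.+1) t.

Lemma Dec4E l m G t : all (fun y => (0 < y) && (y <= 2)) l -> 2 < G -> m <= size l ->
  Dec4 (drop m l ++ G :: take m l) t = core l m t.
Proof.
move=> al G2 ml; rewrite /Dec4.
have -> : find (fun y => 2 < y) (drop m l ++ G :: take m l) = size (drop m l).
  rewrite find_cat /= G2 addn0 ifF //; apply/negbTE/hasPn => y /mem_drop yl.
  by move/allP: al => /(_ y yl)/andP[_]; rewrite -leqNgt.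
rewrite take_size_cat // -cat_rcons drop_size_cat ?size_rcons // cat_take_drop.
congr core; rewrite size_cat size_rcons size_take_min (minn_idPl ml) size_drop; lia.
Qed.

(** The second alternative is the moment between the two merges of a layer: the merged arm has its
    hole at the centre, the longer arm has none. *)
Definition shape A h :=
  (A true = A false /\ forall p, h p <= A p) \/
  exists q, [/\ A q = (A (~~ q)).+1, h q = A q & h (~~ q) = 0].

Definition closing A h q i :=
  if A q == A (~~ q) then
    if (h q == A q) && (h (~~ q) == A (~~ q)) then (i == 1) && (0 < A q)
    else (i == (h q).+1) && (h q < A q)
  else (A q == (A (~~ q)).+1) && (i == 1).

(** Two occupied nodes look alike from both sides; the last hypothesis says that the tower bit then
    marks the centre. *)
Lemma core_line A h p x t : shape A h -> x.2 <= A x.1 ->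
  (A true + A false = 1 -> t = (x.2 == 0)) ->
  core (line A h p) (idx A p x) t = (x.1 == ~~ p) && closing A h (~~ p) x.2.
Proof.
move=> sh le Ht; rewrite /core size_line.
have Hs : A (~~ p) + A p = A true + A false by case: (p); rewrite // addnC.
rewrite -Hs in Ht; rewrite /closing negbK.
case: sh => [[Et Hh]|[q [Aq hq hq']]].
  have Ep : A (~~ p) = A p by case: (p).
  have ones : all (pred1 1) (line A h p) = (h (~~ p) == A (~~ p)) && (h p == A p).
    by rewrite all_cat all_rev !arm_ones !eqn_leq !Hh.
  rewrite ones -Ep addnn /= odd_double /= uphalf_double eqxx.
  case: ifP => _; rewrite /idx.
    case: x le {Ht} => s i /=; case: (s =P p) => [->|/eqP ns].
      by case: (p) => _; apply/negbTE; rewrite neq_ltn ltnS leq_addr orbT.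
    have -> : s = ~~ p by case: (s) ns; case: (p).
    rewrite eqxx /= => le; move: (A (~~ p)) le => b le; clear -le.
    apply/eqP/andP => [|[/eqP->]]; [move=> E; split; [apply/eqP|]|]; lia.
  case: x le {Ht} => s i /=; case: (s =P p) => [->|/eqP ns].
    by rewrite ltnNge leq_addr /=; case: (p).
  have -> : s = ~~ p by case: (s) ns; case: (p).
  rewrite eqxx /= => le; case: i le => [|i] le; first by rewrite subn0 ltnn.
  have lt : A (~~ p) - i.+1 < A (~~ p) by lia.
  rewrite lt nth_cat size_rev size_arm lt nth_rev ?size_arm //.
  have -> : A (~~ p) - (A (~~ p) - i.+1).+1 = i by lia.
  by rewrite nth_arm // eqSS; case: (i =P h (~~ p)) => [E|_] //=; rewrite -E le.
have ne : (A (~~ p) == A p) = false.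
  by apply/negbTE; move: Aq; case: (p); case: (q) => /= ->; rewrite neq_ltn ltnSn ?orbT.
rewrite ne.
have [Eq|Eq] : q = ~~ p \/ q = p by case: (q); case: (p); [right|left|left|right].
  rewrite {}Eq negbK in Aq hq hq'.
  have Eo : odd (A (~~ p) + A p).+1 = false by rewrite Aq addSn addnn /= odd_double.
  have EB : (A (~~ p) + A p).+1./2 = (A p).+1.
    by rewrite Aq addSn addnn; exact: (doubleK (A p).+1).
  rewrite Eo EB Aq eqxx andTb.
  rewrite /idx; case: ifP => [/eqP[] E|E].
    have A0 : A p = 0 by lia.
    case: x le Ht => s i /=; rewrite A0 Aq A0 => le /(_ erefl) ->.
    case: (s =P p) => [Es|/eqP ns]; first by rewrite Es; case: (p).
    have Es : s = ~~ p by case: (s) ns; case: (p).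
    rewrite Es Aq A0 eqxx /= in le *; by case: i le => [|[|]].
  have Ap : 0 < A p by lia.
  rewrite nth_cat size_rev size_arm Aq ltnn subnn nth_arm // hq' eqxx /=.
  case: x le {Ht} => s i /=; case: (s =P p) => [->|/eqP ns] le.
    by case: (p) le => le; lia.
  have Es : s = ~~ p by case: (s) ns; case: (p).
  by rewrite Es Aq eqxx in le *; lia.
rewrite {}Eq in Aq hq hq'.
have Eo : odd (A (~~ p) + A p).+1 = false by rewrite Aq addnS addnn /= odd_double.
have EB : (A (~~ p) + A p).+1./2 = (A (~~ p)).+1.
  by rewrite Aq addnS addnn; exact: (doubleK (A (~~ p)).+1).
have nA : (A (~~ p) == (A (~~ p)).+2) = false by rewrite ltn_eqF // ltnW.
rewrite Eo EB Aq nA andbF /idx; case: ifP => [/eqP[] E|E].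
  have A0 : A (~~ p) = 0 by lia.
  case: x le Ht => s i /=; rewrite A0 Aq A0 => le /(_ erefl) ->.
  case: (s =P p) le => [_ _|/eqP ns]; first by case: i.
  have -> : s = ~~ p by case: (s) ns; case: (p).
  by rewrite A0; case: i.
rewrite nth_cat size_rev size_arm ltnNge leqnSn /= subSnn nth_arm ?Aq; last by lia.
by rewrite hq Aq ifF //; apply/negbTE; rewrite neq_ltn; apply/orP; left; lia.
Qed.
End Line.

(** * Folded configurations and what their robots see *)

Section Fold.
Variables (n k : nat) (P : protocol) (D : seq nat -> bool -> bool).
Hypothesis PE : forall v t, P v t = if D v t then Front else if D (rev v) t then Back else Stay.
Hypothesis DE : forall v t, (size v == k) && (count_mem 1 v < k.-1) = false -> D v t = Dec4 v t.
Hypotheses (k2 : 2 < k) (kn : k + 3 < n).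
Implicit Types (st : state n k) (A h : bool -> nat) (pl : 'I_k -> bool * nat).

(** [folded] takes [z] at least [n], so the truncated subtraction is exact for all distances
    used. *)
Definition node z (s : bool) d := (if s then z + d else z - d) %% n.

(** [pl r] is the arm and the rank of [r], rank 0 being the centre. Positive ranks carry one robot
    each, so only the centre can be a tower. With [k.-1] outer robots nothing has merged and there
    are no holes. *)
Definition folded st z A h pl :=
  [/\ [/\ n <= z, forall r, spos st r = node z (pl r).1 (pos (h (pl r).1) (pl r).2) :> nat
        & forall r, (pl r).2 <= A (pl r).1],
      [/\ forall q i, 0 < i <= A q -> exists r, pl r = (q, i),
          forall r r', pl r = pl r' -> 0 < (pl r).2 -> r = r' & exists r, (pl r).2 = 0],
      [/\ shape A h, A true + A false < k & A true + A false = k.-1 -> forall q, h q = A q]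
    & forall r p, spend st r = Some (Some p) -> (pl r).1 = ~~ p /\ closing A h (~~ p) (pl r).2].

Section Static.
Variables (st : state n k) (z : nat) (A h : bool -> nat) (pl : 'I_k -> bool * nat).
Hypothesis fo : folded st z A h pl.
Let nz : n <= z. Proof. by case: fo => -[]. Qed.
Let Ak : A true + A false < k. Proof. by case: fo => _ _ []. Qed.
Let le r : (pl r).2 <= A (pl r).1. Proof. by case: fo => -[]. Qed.

Lemma pos_small b i j : i <= j -> pos b i <= j.+1.
Proof. by move=> ij; rewrite /pos; case: ifP => _; [apply: leqW|]. Qed.

Lemma line_sum : sumn (line A h true) = pos (h false) (A false) + pos (h true) (A true).
Proof. by rewrite sumn_cat sumn_rev !sumn_arm_all. Qed.

Definition gapG := n - sumn (line A h true).

(** At most [k - 1] segments with at most one hole in each arm measure at most [k + 1]; as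
    [k + 3 < n], the outer gap exceeds 2 and cannot be taken for a hole. *)
Lemma line_lt : sumn (line A h true) + 2 < n.
Proof.
rewrite line_sum; have := pos_small (h false) (leqnn (A false)).
have := pos_small (h true) (leqnn (A true)).
move: (pos (h false) (A false)) (pos (h true) (A true)) => x y H1 H2.
by have := Ak; move: H1 H2 kn; clear; lia.
Qed.

Lemma gap_big : 2 < gapG. Proof. by rewrite ltn_subRL line_lt. Qed.

Lemma pos_z q i : i <= A q -> pos (h q) i <= z.
Proof.
move=> iA; apply: leq_trans (leq_trans (pos_le (h q) iA) _) nz.
have := line_lt; rewrite line_sum; case: q {iA}; lia.
Qed.

Lemma line_prefix x : x.2 <= A x.1 ->
  z - pos (h false) (A false) + sumn (take (idx A true x) (line A h true)) =
  (if x.1 then z + pos (h x.1) x.2 else z - pos (h x.1) x.2).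
Proof.
case: x => s i; rewrite /idx /line take_cat size_rev size_arm; case: s => /= iA.
  rewrite ltnNge leq_addr /= addKn sumn_cat sumn_rev sumn_arm_all sumn_arm // addnA subnK //.
  exact: pos_z.
have := pos_le (h false) iA; have := pos_z (leqnn (A false)).
have E : sumn (take i (arm (A false) (h false))) + sumn (drop i (arm (A false) (h false))) =
    pos (h false) (A false) by rewrite -sumn_cat cat_take_drop sumn_arm_all.
rewrite sumn_arm // in E; case: ifP => [lt|ge].
  rewrite take_rev size_arm sumn_rev subKn //; move: E; clear; lia.
have -> : i = 0 by move: ge iA; clear; lia.
rewrite subn0 subnn take0 cats0 sumn_rev sumn_arm_all /pos /=; clear; lia.
Qed.

Lemma folded_segs :
  segments (spos st) (z - pos (h false) (A false)) (rcons (line A h true) gapG).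
Proof.
have [[_ posE _] [rank _ [r0 rank0]] _ _] := fo.
have szl : size (line A h true) = A false + A true by rewrite size_line.
have tk m : m <= A false + A true ->
    take m (rcons (line A h true) gapG) = take m (line A h true).
  by move=> mA; rewrite -cats1 takel_cat // szl.
have at_ r : spos st r = (z - pos (h false) (A false) +
    sumn (take (idx A true (pl r)) (line A h true))) %% n :> nat.
  by rewrite posE line_prefix //; case: (pl r) => -[].
split.
- rewrite all_rcons (ltn_trans _ gap_big) //=; apply/allP => y yl.
  by have /allP/(_ y yl)/andP[] := line_small A h true.
- by rewrite -cats1 sumn_cat /= addn0 subnKC // (leq_trans (leq_addr 2 _)) // ltnW // line_lt.
- by rewrite size_rcons.
- move=> m; rewrite size_rcons szl ltnS => mA; rewrite tk //.
  suff [r <-] : exists r, idx A true (pl r) = m by exists r.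
  case: (ltngtP m (A false)) => [lt|gt|->].
  + have [|r Er] := rank false (A false - m); first by rewrite subn_gt0 lt leq_subr.
    by exists r; rewrite Er /idx /= subKn // ltnW.
  + have [|r Er] := rank true (m - A false); first by rewrite subn_gt0 gt leq_subLR.
    by exists r; rewrite Er /idx /= subnKC // ltnW.
  by exists r0; rewrite /idx rank0 addn0 subn0; case: ifP.
move=> r; have iA : idx A true (pl r) <= A false + A true := idx_le true (le r).
by exists (idx A true (pl r)); rewrite ?size_rcons ?szl ?ltnS ?tk.
Qed.

Lemma folded_view r p : robot_view (spos st) r p =
  drop (idx A p (pl r)) (line A h p) ++ gapG :: take (idx A p (pl r)) (line A h p).
Proof.
have iA q : idx A q (pl r) <= size (line A h q).
  by rewrite size_line; apply: idx_le.
have E : robot_view (spos st) r true =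
    drop (idx A true (pl r)) (line A h true) ++ gapG :: take (idx A true (pl r)) (line A h true).
  have -> : drop (idx A true (pl r)) (line A h true) ++ gapG :: take (idx A true (pl r)) (line A h true)
      = rot (idx A true (pl r)) (rcons (line A h true) gapG).
    by rewrite /rot drop_rcons ?iA // cat_rcons -cats1 takel_cat ?iA.
  apply: cw_segsE; have := segs_rot (m := idx A true (pl r)) _ folded_segs.
  rewrite size_rcons => /(_ (leqW (iA true))); apply: segs_mod.
  rewrite -cats1 takel_cat ?iA // line_prefix ?le //.
  by case: fo => -[_ -> _] _ _ _; rewrite modn_mod.
case: p; first exact: E.
have -> : robot_view (spos st) r false = rev (robot_view (spos st) r true) by [].
rewrite E rev_cat rev_cons cat_rcons -[false]/(~~ true) line_rev idx_rev ?le //.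
rewrite drop_rev take_rev size_line.
have := iA true; rewrite size_line => H; rewrite subKn //.
Qed.

Lemma folded_D r p : D (robot_view (spos st) r p) (is_tower (spos st) r) =
  ((pl r).1 == ~~ p) && closing A h (~~ p) (pl r).2.
Proof.
have [[_ posE _] [rank inj [r0 rank0]] [sh _ full] _] := fo.
have iA : idx A p (pl r) <= size (line A h p) by rewrite size_line; apply: idx_le.
(* A reading with [k] segments comes before any merge, hence from arms without holes: it has [k - 1]
   segments equal to 1 and is not handled by the rule of the first stage. *)
rewrite folded_view DE; last first.
  apply/negbTE/negP => /andP[/eqP E]; rewrite ltnNge => /negP; apply.
  have E' : A true + A false = k.-1.
    rewrite -E -cat_rcons size_cat size_rcons size_drop size_takel // addSn subnK //= size_line.
    by case: (p); rewrite // addnC.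
  have : all (pred1 1) (line A h p) by rewrite all_cat all_rev !arm_ones !full ?leqnn.
  have -> : k.-1 = size (line A h p) by rewrite size_line -E'; case: (p); rewrite // addnC.
  rewrite all_count => /eqP <-.
  have -> : count (pred1 1) (line A h p) = count (pred1 1) (take (idx A p (pl r)) (line A h p)) +
      count (pred1 1) (drop (idx A p (pl r)) (line A h p)) by rewrite -count_cat cat_take_drop.
  by rewrite count_cat addnC leq_add2l leq_addl.
rewrite Dec4E ?line_small ?gap_big // core_line // => A1.
have center r1 : (pl r1).2 = 0 -> spos st r1 = (z %% n) :> nat.
  by move=> E; rewrite posE E /node /pos addn0 subn0; case: (pl r1).1.
have one q i : 0 < i <= A q -> i = 1 /\ A (~~ q) = 0.
  by move: A1; case: (q) => /=; lia.
have two r1 r2 : 0 < (pl r1).2 -> 0 < (pl r2).2 -> r1 = r2.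
  move=> h1 h2; apply: inj => //; have := le r1; have := le r2.
  move: h1 h2; case: (pl r1) (pl r2) => [q1 i1] [q2 i2] /= h1 h2 l2 l1.
  have [E1 z1] := one q1 i1 ltac:(by rewrite h1).
  have [E2 z2] := one q2 i2 ltac:(by rewrite h2).
  rewrite E1 E2; congr pair; move: l1 l2 z1 z2 h1 h2; case: (q1); case: (q2) => //=; lia.
(* On two nodes exactly one robot is outside the centre, and [k > 2] puts at least two on the
   centre; so the tower bit is true exactly there. *)
case: (posnP (pl r).2) => [z0|g0].
  have : 1 < #|predC1 r| by rewrite cardC1 card_ord; case: (k) k2 => [|[|[|]]].
  case/card_gt1P => r1 [r2 [n1 n2 n12]]; rewrite !inE in n1 n2.
  apply/existsP; case: (posnP (pl r1).2) => [z1|g1].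
    by exists r1; rewrite n1; apply/eqP/val_inj; rewrite /= !center.
  case: (posnP (pl r2).2) => [z2|g2]; last by rewrite (two _ _ g1 g2) eqxx in n12.
  by exists r2; rewrite n2; apply/eqP/val_inj; rewrite /= !center.
apply/negbTE/negP => /existsP[r' /andP[/eqP n1 /eqP E]].
case: (posnP (pl r').2) => [z1|g1]; last by apply: n1; apply: two.
have := center r' z1; rewrite E posE.
have [i1 _] := one (pl r).1 (pl r).2 ltac:(by rewrite g0 le).
have dn : 0 < pos (h (pl r).1) (pl r).2 < n.
  rewrite i1 /pos; case: ifP => _; move: kn; clear; lia.
have dz : pos (h (pl r).1) (pl r).2 <= z by apply: leq_trans nz; apply: ltnW; case/andP: dn.
move: (pos _ _) dn dz => d /andP[d0 dn] dz; rewrite /node; case: ifP => _ /eqP.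
  by rewrite -[X in _ == X %% _]addn0 eqn_modDl mod0n modn_small // gtn_eqF.
rewrite -[X in _ == X %% _](subnK dz) -[X in X %% _ == _]addn0 eqn_modDl mod0n modn_small //.
by rewrite ltn_eqF.
Qed.

End Static.
End Fold.

(** * Moves of the folding stage *)

Section FoldStep.
Variables (n k : nat) (P : protocol) (D : seq nat -> bool -> bool).
Hypothesis PE : forall v t, P v t = if D v t then Front else if D (rev v) t then Back else Stay.
Hypothesis DE : forall v t, (size v == k) && (count_mem 1 v < k.-1) = false -> D v t = Dec4 v t.
Hypotheses (k2 : 2 < k) (kn : k + 3 < n).
Implicit Types (st : state n k) (A h : bool -> nat) (pl : 'I_k -> bool * nat).

(** A merge removes one outer node but may reopen all ranks, fewer than [k]; the weight [k + 2]
    covers this. *)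
Definition fold_measure A h := (A true + A false) * (k + 2) + (A true - h true) + (A false - h false).

Lemma node_move z (u : 'I_n) p d : d < z -> u = node n z (~~ p) d.+1 :> nat ->
  apply_move u (Some p) = node n z (~~ p) d :> nat.
Proof.
move=> dz; have n0 : 0 < n := leq_ltn_trans (leq0n u) (ltn_ord u).
rewrite /node; case: p => /= ->.
  by rewrite -[(_ %% n).+1]addn1 modnDml -(subnSK dz) addn1.
have -> : (((z + d.+1) %% n + n).-1 = (z + d.+1) %% n + n.-1)%N by rewrite -(prednK n0) addnS.
rewrite modnDml -addnA addSnnS prednK // addnA modnDr //.
Qed.

Lemma folded_idle st z A h pl r b : folded st z A h pl -> ~ effective st r ->
  folded (step P st (r, b)) z A h pl.
Proof.
move=> fo ne; have FD := folded_D DE k2 kn fo; case: (fo) => -[nz posE le] R S pend.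
split=> //.
  by split=> // r'; rewrite -posE spos_idle.
move=> r' p; rewrite /step; case E: (spend st r) => [m|] /=.
  by case: eqP => // _ /pend.
case: eqP => [->|_]; last exact: pend.
case=> Ec; have := compute_spec PE (spos st) r b; rewrite Ec FD => /andP[/eqP-> ->] //.
Qed.

Section Move.
Variables (st : state n k) (z : nat) (A h : bool -> nat) (pl : 'I_k -> bool * nat).
Variables (r : 'I_k) (p : bool) (b : bool).
Hypotheses (fo : folded st z A h pl) (pr : spend st r = Some (Some p)).
Let st' := step P st (r, b).

Lemma step_spend r' : spend st' r' = if r' == r then None else spend st r'.
Proof. by rewrite /st' /step pr. Qed.

Lemma step_spos r' : spos st' r' = if r' == r then apply_move (spos st r) (Some p) else spos st r'.
Proof. by rewrite /st' /step pr. Qed.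

Let q := ~~ p.
Let side : (pl r).1 = q. Proof. by case: fo => _ _ _ /(_ r p pr)[]. Qed.
Let enr : closing A h q (pl r).2. Proof. by case: fo => _ _ _ /(_ r p pr)[]. Qed.
Let inj : forall r r', pl r = pl r' -> 0 < (pl r).2 -> r = r'. Proof. by case: fo => _ []. Qed.

Lemma same_place r' i : 0 < i -> (pl r).2 = i -> (pl r').1 = q -> (pl r').2 = i -> r' = r.
Proof.
move=> i0 E1 S' E2; apply: inj; last by rewrite E2.
by rewrite [pl r]surjective_pairing [pl r']surjective_pairing S' E2 E1 side.
Qed.

Definition A_merge s := if s == q then (A q).-1 else A s.
Definition h_merge s := if s == q then 0 else h s.
Definition pl_merge r0 := if (pl r0).1 == q then (q, (pl r0).2.-1) else pl r0.

(** The ranks on the merged arm drop by one while the nodes stay, so its hole is now next to the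
    centre; hence the value 0 in [h_merge]. *)
Lemma folded_merge : (pl r).2 = 1 -> 0 < A q -> h q = A q ->
  shape A_merge h_merge ->
  (forall r' p', r' <> r -> spend st r' = Some (Some p') ->
     (pl r').1 <> q /\ closing A_merge h_merge (~~ p') (pl r').2) ->
  folded st' z A_merge h_merge pl_merge /\ fold_measure A_merge h_merge < fold_measure A h.
Proof.
move=> r1 A0 hA sh' pend'; case: fo => -[nz posE le] [rank _ [r0 rank0]] [sh Ak full] pend.
have nq : (~~ q == q) = false by case: (q).
have sumA : (A_merge true + A_merge false).+1 = A true + A false.
  rewrite /A_merge; move: A0; by case: (q) => /= A0; [rewrite -addSn|rewrite -addnS]; rewrite prednK.
split; last first.
  have E1 : fold_measure A_merge h_merge < (A_merge true + A_merge false).+1 * (k + 2).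
    rewrite /fold_measure mulSn -addnA [X in _ < X]addnC ltn_add2l.
    apply: (@leq_ltn_trans (A_merge true + A_merge false)).
      by apply: leq_add; apply: leq_subr.
    apply: (@leq_ltn_trans k); last by rewrite addn2.
    by apply: ltnW; apply: leq_trans Ak; rewrite -sumA.
  by apply: leq_trans E1 _; rewrite sumA /fold_measure -addnA leq_addr.
split=> //.
- split=> // r'.
    rewrite step_spos /h_merge /pl_merge; case: (eqVneq r' r) => [->|/eqP nr].
      rewrite side eqxx /= eqxx r1 /=; apply: (@node_move z _ p 0); last first.
        by rewrite posE side r1 hA /pos A0.
      apply: leq_trans nz; apply: leq_ltn_trans kn; exact: leq0n.
    rewrite posE; case: (eqVneq (pl r').1 q) => [E|ne] /=; last by rewrite (negPf ne).
    rewrite eqxx E hA /pos -E le E; case: (posnP (pl r').2) => [->//|g].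
    case: (posnP (pl r').2.-1) => [g1|g1]; last by rewrite leqNgt g1 /= prednK.
    case: nr; apply: (same_place (i := 1)) => //.
    by rewrite -(prednK g) g1.
  rewrite /A_merge /pl_merge; case: (eqVneq (pl r').1 q) => [E|ne] /=.
    by rewrite eqxx -!subn1 leq_sub2r // -E.
  by rewrite (negPf ne).
- split.
  + move=> s i; rewrite /A_merge /pl_merge; case: (eqVneq s q) => [->|ns] /andP[i0 iA].
      have [|r' Er] := rank q i.+1; first by rewrite /= -(prednK A0) ltnS.
      by exists r'; rewrite Er eqxx.
    have [|r' Er] := rank s i; first by rewrite i0.
    by exists r'; rewrite Er (negPf ns).
  + move=> x y; rewrite /pl_merge.
    case: (eqVneq (pl x).1 q) => [Ex|nx]; case: (eqVneq (pl y).1 q) => [Ey|ny].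
    * move=> [E] /= x0; apply: inj; last by apply: leq_trans x0 (leq_pred _).
      have y0 : 0 < (pl y).2.-1 by rewrite -E.
      rewrite [pl x]surjective_pairing [pl y]surjective_pairing Ex Ey; congr pair.
      rewrite -(prednK (leq_trans x0 (leq_pred _))) -(prednK (leq_trans y0 (leq_pred _))) E //.
    * by move=> E; case/eqP: ny; rewrite -E.
    * by move=> E; case/eqP: nx; rewrite E.
    * exact: inj.
  by exists r0; rewrite /pl_merge; case: ifP => _ //=; rewrite rank0.
- split=> //; first by apply: leq_trans Ak; rewrite -sumA ltnW.
  move=> E; exfalso; move: Ak; rewrite -sumA E; case: (k) k2 => // k0 _.
  by rewrite ltnn.
move=> r' p'; rewrite step_spend; case: (eqVneq r' r) => // /eqP nr sp.
have [n1 e1] := pend' r' p' nr sp; have [s1 _] := pend r' p' sp.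
by rewrite /pl_merge; move/eqP/negPf: n1 => ->.
Qed.

Definition h_close s := if s == q then (h q).+1 else h s.

(** The hole moves one rank outwards. A move pending on the other arm closes the hole of that arm,
    which is thus not full, so its rule does not change. *)
Lemma folded_close : A q = A (~~ q) -> (pl r).2 = (h q).+1 -> h q < A q ->
  folded st' z A h_close pl /\ fold_measure A h_close < fold_measure A h.
Proof.
move=> AE r1 hq; case: fo => -[nz posE le] [rank _ [r0 rank0]] [sh Ak full] pend.
have nq : (~~ q == q) = false by case: (q).
have Atf : A true = A false by move: AE; case: (q).
have Hh s : h s <= A s.
  by case: sh => [[_]//|[s' [E _ _]]]; move: E; case: (s') => /= E; move: Atf; rewrite E => /eqP;
    rewrite ?[_.+1 == _]gtn_eqF ?ltn_eqF.
split; last first.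
  rewrite /fold_measure -!addnA ltn_add2l /h_close; move: hq (Hh true) (Hh false).
  by case: (q) => /= hq H1 H2; [rewrite ltn_add2r|rewrite ltn_add2l]; apply: ltn_sub2l.
split=> //.
- split=> // r'; rewrite step_spos /h_close; case: (eqVneq r' r) => [->|/eqP nr].
    rewrite side eqxx r1 /pos leqnn; apply: node_move; last first.
      by rewrite posE side r1 /pos ltnn.
    apply: leq_trans nz; apply: leq_ltn_trans kn; apply: (leq_trans hq).
    by apply: leq_trans (leq_trans (leq_addr (A (~~ q)) _) _) (leq_addr 3 k); apply: ltnW; move: Ak; case: (q); rewrite // addnC.
  rewrite posE; case: (eqVneq (pl r').1 q) => [E|ne] //=; rewrite E /pos; congr (node _ _ _ _).
  case: (ltngtP (pl r').2 (h q).+1) => [lt|gt|E'].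
  + by rewrite -ltnS lt.
  + by rewrite leqNgt (ltnW gt).
  by case: nr; apply: (same_place (i := (h q).+1)).
- by split=> //; exists r0.
- split=> //.
  + left; split=> // s; rewrite /h_close; case: eqP => [->|_] //.
  by move=> E s; move: hq; rewrite full // ltnn.
move=> r' p'; rewrite step_spend; case: (eqVneq r' r) => // /eqP nr sp.
have [s1 e1] := pend r' p' sp; split=> //; move: e1; rewrite /closing /h_close.
have -> : A (~~ p') == A (~~ ~~ p') by case: (p'); rewrite /= Atf eqxx.
have nf : (h q == A q) = false by rewrite ltn_eqF.
have [E|E] : ~~ p' = q \/ ~~ p' = ~~ q by case: (p'); case: (q); [right|left|left|right].
  rewrite E nf /= => /andP[/eqP E2 _]; case: nr; apply: (same_place (i := (h q).+1)) => //.
  by rewrite s1.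
by rewrite E (negbK q) nq nf eqxx andbF => /andP[-> lt]; rewrite (ltn_eqF lt) /= lt.
Qed.

Lemma folded_move : exists A' h' pl', folded st' z A' h' pl' /\ fold_measure A' h' < fold_measure A h.
Proof.
case: (fo) => -[nz posE le] [rank _ [r0 rank0]] [sh Ak full] pend.
have nq : (~~ q == q) = false by case: (q).
have nq' : (q == ~~ q) = false by case: (q).
have q_or s : s = q \/ s = ~~ q by case: (s); case: (q); [left|right|right|left].
have := enr; rewrite /closing; case: (eqVneq (A q) (A (~~ q))) => [AE|AN].
  case: ifP => [/andP[/eqP hq /eqP hq'] /andP[/eqP r1 A0]|nc /andP[/eqP r1 lt]]; last first.
    by exists A, h_close, pl; apply: folded_close.
  exists A_merge, h_merge, pl_merge; apply: folded_merge => //.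
    right; exists (~~ q); rewrite /A_merge /h_merge (negbK q) eqxx nq; split=> //.
    by rewrite -AE prednK.
  move=> r' p' nr sp; have [s1 e1] := pend r' p' sp.
  have r1' : (pl r').2 = 1.
    move: e1; have -> s i : closing A h s i = (i == 1) && (0 < A s).
      by rewrite /closing; case: (q_or s) => ->; rewrite ?(negbK q) hq hq' -AE !eqxx.
    by case/andP => /eqP.
  have n1 : (pl r').1 <> q.
    by move=> E; apply: nr; apply: (same_place (i := 1)).
  split=> //; rewrite s1 in n1; case: (q_or (~~ p')) => // ->.
  rewrite /closing /A_merge (negbK q) eqxx nq r1' -AE.
  case: eqP => [E|_]; last by rewrite prednK // eqxx.
  by move: A0; rewrite E -{1}E; case: (A q) E => // m E; move/eqP: E; rewrite gtn_eqF.
move=> /andP[/eqP AS /eqP r1].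
have hq : h q = A q /\ h (~~ q) = 0.
  case: sh => [[Et _]|[s [E1 E2 E3]]].
    by case/eqP: AN; case: (q); rewrite /= Et.
  case: (q_or s) => Es; rewrite Es ?(negbK q) in E1 E2 E3; first by [].
  by move: AS; rewrite E1 => /eqP; rewrite ltn_eqF // ltnW.
case: hq => hq hq'.
exists A_merge, h_merge, pl_merge; apply: folded_merge => //; first by rewrite AS.
  left; have E : A_merge q = A_merge (~~ q) by rewrite /A_merge eqxx nq AS.
  split; first by move: E; case: (q).
  by move=> s; rewrite /h_merge; case: (q_or s) => ->; rewrite ?eqxx // nq hq'.
move=> r' p' nr sp; have [s1 e1] := pend r' p' sp; exfalso.
move: e1; rewrite /closing; case: (q_or (~~ p')) => Ep; rewrite Ep ?(negbK q).
  rewrite (negPf AN) => /andP[_ /eqP r1']; apply: nr; apply: (same_place (i := 1)) => //.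
  by rewrite s1.
rewrite eq_sym (negPf AN) AS => /andP[/eqP E]; move/eqP: E; rewrite ltn_eqF // ltnW //.
Qed.
End Move.

Definition Folded st mu := exists z A h pl, folded st z A h pl /\ mu = fold_measure A h.

Lemma Folded_idle st mu r b : Folded st mu -> ~ effective st r -> Folded (step P st (r, b)) mu.
Proof.
by case=> z [A [h [pl [fo E]]]] ne; exists z, A, h, pl; split=> //; apply: folded_idle.
Qed.

Lemma Folded_move st mu r b : Folded st mu -> effective st r ->
  exists2 mu', mu' < mu & Folded (step P st (r, b)) mu'.
Proof.
case=> z [A [h [pl [fo ->]]]] [p pr].
have [A' [h' [pl' [fo' lt]]]] := folded_move b fo pr.
by exists (fold_measure A' h') => //; exists z, A', h', pl'.
Qed.

Lemma Folded_progress st mu : Folded st mu ->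
  met st \/ exists r, forall b, compute_move P (spos st) r b <> None.
Proof.
case=> z [A [h [pl [fo _]]]]; have FD := folded_D DE k2 kn fo.
case: (fo) => -[nz posE le] [rank _ [r0 rank0]] [sh Ak full] pend.
have enx q i : 0 < i <= A q -> closing A h q i ->
    exists r, forall b, compute_move P (spos st) r b <> None.
  move=> iA e; have [r Er] := rank q i iA; exists r => b E.
  have := compute_spec PE (spos st) r b; rewrite E !FD Er /=.
  by case: q e {iA Er} => /= ->.
case: sh => [[Et Hh]|[q [Aq hq hq']]]; last first.
  right; apply: (enx q 1); first by rewrite Aq.
  by rewrite /closing Aq eqxx andbT ifF // gtn_eqF.
case: (posnP (A true)) => [A0|A0].
  left=> r r'; apply: val_inj; rewrite /= !posE /node /pos.
  have := le r; have := le r'.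
  case: (pl r) (pl r') => [[] i] [[] j] /=; rewrite -?Et A0 !leqn0 => /eqP-> /eqP->;
    by rewrite /= ?addn0 ?subn0.
right; case: (eqVneq (h true) (A true)) => [h1|h1].
  case: (eqVneq (h false) (A false)) => [h2|h2].
    by apply: (enx true 1) => //; rewrite /closing /= Et eqxx -{1}Et h1 h2 !eqxx /= -Et.
  have lt : h false < A false by rewrite ltn_neqAle h2 Hh.
  apply: (enx false (h false).+1) => //; rewrite /closing /= Et eqxx (negPf h2) /= eqxx //.
have lt : h true < A true by rewrite ltn_neqAle h1 Hh.
by apply: (enx true (h true).+1) => //; rewrite /closing /= -Et eqxx (negPf h1) /= eqxx.
Qed.

Lemma Folded_met st mu r : Folded st mu -> met st -> ~ effective st r.
Proof.
case=> z [A [h [pl [fo _]]]] mt [p pr].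
case: (fo) => -[nz posE le] [rank _ [r0 rank0]] [sh Ak full] pend.
have [s1 e1] := pend r p pr.
have g : 0 < (pl r).2.
  move: e1; rewrite /closing; case: ifP => _; last by case/andP=> _ /eqP->.
  by case: ifP => _ /andP[/eqP-> _].
have := posE r; rewrite (mt r r0) posE.
have dn : 0 < pos (h (pl r).1) (pl r).2 < n.
  rewrite (leq_trans g) /pos; last by case: ifP.
  apply: leq_ltn_trans (pos_small _ (le r)) _; apply: leq_ltn_trans kn.
  apply: (leq_trans _ (leq_addr 3 k)); apply: leq_trans Ak.
  by rewrite ltnS; case: (pl r).1; rewrite ?leq_addr ?leq_addl.
have dz : pos (h (pl r).1) (pl r).2 <= z by apply: leq_trans nz; apply: ltnW; case/andP: dn.
have -> : node n z (pl r0).1 (pos (h (pl r0).1) (pl r0).2) = z %% n.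
  by rewrite rank0 /node /pos /= addn0 subn0; case: (pl r0).1.
move: (pos _ _) dn dz => d /andP[d0 dn] dz; rewrite /node; case: ifP => _ /eqP.
  by rewrite -[X in X == _ %[mod _]]addn0 eqn_modDl mod0n modn_small // ltn_eqF.
rewrite -[X in X == _ %[mod _]](subnK dz) -[X in _ == X %[mod _]]addn0 eqn_modDl mod0n modn_small //.
by rewrite gtn_eqF.
Qed.
End FoldStep.

(** * Executions *)

Section Realisation.
Variables (n k' : nat).
Notation K := k'.+3.
Notation I := 'I_K.
Notation flag := (flag k').
Implicit Types (f x y h : flag) (a : I -> nat) (i j : I) (m : nat) (p : bool).
Hypotheses (oddK : odd K) (Kn : K + 3 < n).
Let n0 : 0 < n. Proof. exact: leq_ltn_trans Kn. Qed.

(** A reading of [K] segments has no tower, and [n > K] makes it a single block exactly when [K - 1]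
    segments are 1. Every other tower-free reading belongs to the first stage. *)
Definition rule (v : seq nat) (t : bool) : bool :=
  if (size v == K) && (count_mem 1 v < K.-1) then Dec k' v else Dec4 v t.
Definition prot : protocol := fun v t =>
  if rule v t then Front else if rule (rev v) t then Back else Stay.
Notation stepP := (step prot).

(* [w] lists the robots in clockwise order, [a i] being the gap after [w i] *)
Definition ringed (c : config n K) (w : I -> I) a :=
  [/\ injective w, forall i, c (w (i + 1)%R) = (c (w i) + a i) %% n :> nat,
      \sum_e a e = n & forall e, 0 < a e].

Definition pend (st : state n K) (w : I -> I) : I -> option bool := fun i =>
  if spend st (w i) is Some m then m else None.

Section Read.
Variables (c : config n K) (w : I -> I) (a : I -> nat).
Hypothesis rg : ringed c w a.
Let w_inj : injective w. Proof. by case: rg. Qed.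

Lemma ring_pos i m : c (w (adv m (i, true)).1) = (c (w i) + sumn (take m (word a (i, true)))) %% n :> nat
  \/ K < m.
Proof.
have [le|] := leqP m K; last by right.
left; elim: m le => [|m IH] lt; first by rewrite adv0 take0 addn0 modn_small.
have E : (adv m.+1 (i, true)).1 = ((adv m (i, true)).1 + 1)%R.
  exact: (congr1 fst (esym (advD 1 m (i, true)))).
rewrite E; case: rg => _ -> _ _; rewrite (take_nth 0) ?size_mkseq // -cats1 sumn_cat /= addn0.
by rewrite nth_mkseq // IH ?(ltnW lt) // modnDml addnA.
Qed.

Lemma word_sum i : sumn (word a (i, true)) = n.
Proof.
case: rg => _ _ <- _; rewrite sumnE big_map -val_enum_ord big_map.
rewrite big_enum /= [RHS](reindex_inj (GRing.addrI i)); apply: eq_bigr => o _.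
by rewrite /g /edge advE place1.
Qed.

Lemma ring_segs i : segments c (c (w i)) (word a (i, true)).
Proof.
have [_ _ _ a0] := rg; split.
- by apply/allP => y /mapP[m _ ->]; apply: a0.
- exact: word_sum.
- by rewrite size_mkseq.
- move=> m; rewrite size_mkseq => mK; exists (w (adv m (i, true)).1).
  by case: (ring_pos i m) => // /ltnW; rewrite leqNgt mK.
move=> r; rewrite size_mkseq; pose o : I := (invF w_inj r - i)%R.
have Eo : (adv o (i, true)).1 = invF w_inj r.
  by rewrite place1 -[LHS]/((i + o)%R) /o GRing.addrC GRing.subrK.
exists (val o); first exact: ltn_ord.
have := ring_pos i (val o); rewrite Eo f_invF; case=> // /ltnW.
by rewrite leqNgt ltn_ord.
Qed.

Lemma word_rev i : rev (word a (i, true)) = word a (i, false).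
Proof.
apply: (@eq_from_nth _ 0); rewrite size_rev !size_mkseq // => m mK.
rewrite nth_rev ?size_mkseq // !nth_mkseq //; last by rewrite ltn_subrL.
have -> : (i, false) = flip (adv m (adv (K - m) (i, true))) :> flag.
  by rewrite advD subnKC ?advK // ltnW.
by rewrite adv_flip -[K - m]subnSK // g_flip_adv.
Qed.

Lemma ring_view i p : robot_view c (w i) p = word a (i, p).
Proof. by rewrite /robot_view (cw_segsE (ring_segs i)); case: p; rewrite // word_rev. Qed.

Lemma count_ones f : count_mem 1 (word a f) = \sum_e (a e == 1).
Proof.
have H i : count_mem 1 (word a (i, true)) = \sum_e (a e == 1).
  rewrite -sumn_count -map_comp sumnE big_map -val_enum_ord big_map big_enum /=.
  rewrite [RHS](reindex_inj (GRing.addrI i)); apply: eq_bigr => o _.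
  by rewrite /g /edge advE place1.
case: f => i p; case: p; first exact: H.
by rewrite -word_rev count_rev H.
Qed.

(** If only one gap differed from 1, the others would form a run of length [K - 1]. *)
Lemma few_ones : wf a -> (run a).+1 < K -> \sum_e (a e == 1) < K.-1.
Proof.
move=> wa bK; rewrite ltnNge; apply/negP => big; have [e ge] := wa.2.
move: bK; apply/negP; rewrite -leqNgt; suff HR : R a (adv 1 (e, true)) K.-1.
  exact: (run_max wa HR).
apply/RP => m mK; rewrite advD addn1.
apply/eqP; apply: contraT => ne.
have nE : edge (adv m.+1 (e, true)) != e.
  apply/eqP => E; case: (@adv_neq k' m.+1 (e, true)); first by [].
  by rewrite [adv _ _]surjective_pairing -[X in (X, _)]/(edge (adv m.+1 (e, true))) E.
move: big; rewrite (bigD1 e) //= (gtn_eqF ge) add0n (bigD1 (edge (adv m.+1 (e, true)))) //=.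
rewrite -/(g a _) (negPf ne) add0n leqNgt => /negP[].
have : \sum_(x : I) 1 = K by rewrite sum1_card card_ord.
rewrite (bigD1 e) //= (bigD1 (edge (adv m.+1 (e, true)))) //= !add1n => -[E].
apply: (@leq_ltn_trans k'.+1); last exact: ltnSn.
by rewrite -[X in _ <= X]E; apply: leq_sum => x _; case: eqP.
Qed.

Lemma rule_E i p t : wf a -> (run a).+1 < K -> rule (robot_view c (w i) p) t = enabled a (i, p).
Proof.
move=> wa bK; rewrite ring_view /rule size_mkseq eqxx count_ones few_ones //; exact: DecE.
Qed.
End Read.

Lemma ringed_move c w a i p r : ringed c w a -> 1 < g a (i, p) -> r = w i ->
  ringed (fun r' => if r' == r then apply_move (c r) (Some p) else c r') w (upd a (i, p)).
Proof.
move=> [w_inj cE Na a0] gf ->; split=> //; first last.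
- by move=> e; rewrite /upd; case: eqP => [->|_]; [rewrite -ltnS prednK // ltnW|case: eqP].
- by rewrite sum_upd // ltnW.
move=> j; rewrite !(inj_eq w_inj).
have si : (i + 1 == i)%R = false.
  by apply/negbTE; rewrite -[X in _ != X]GRing.addr0 (inj_eq (GRing.addrI i)).
have sub (u : I) : (u == i - 1)%R = (u + 1 == i)%R by rewrite eq_sym GRing.subr_eq eq_sym.
have a1 : 0 < a j := a0 j.
case: p gf => /=; rewrite /g /edge /= => gf; rewrite /upd /edge /= !sub.
- case: (eqVneq j i) => [->|ne].
    by rewrite si cE /= modnDml addSnnS prednK // ltnW.
  case: (eqVneq (j + 1)%R i) => [E|ne'] /=; last exact: cE.
  by rewrite -E cE -addn1 modnDml addn1 addnS.
case: (eqVneq (j + 1)%R i) => [E|ne].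
  have -> : (j == i) = false by rewrite -E eq_sym -[X in _ == X]GRing.addr0 (inj_eq (GRing.addrI j)).
  rewrite -E /= cE -subn1 -addnBA // modnDml subn1 -addnA -[in RHS](modnDr _ n).
  by congr (_ %% n); rewrite -addnA; congr (_ + _); move: n0 a1; clear; lia.
case: (eqVneq j i) => [->|ne'] /=; last exact: cE.
rewrite cE modnDml -[in LHS](modnDr _ n); congr (_ %% n); move: n0; clear; lia.
Qed.

(** The summand [K * (K + 2)] exceeds the measure [(K - 1) * (K + 2)] with which the folding
    starts. *)
Definition SInv st mu :=
  (exists w a, [/\ ringed (spos st) w a, invariant a (pend st w)
     & mu = potential n a (pend st w) + K * (K + 2)]) \/ Folded st mu.

Lemma prot_rule v t : prot v t = if rule v t then Front else if rule (rev v) t then Back else Stay.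
Proof. by []. Qed.

Lemma rule_folded v t : (size v == K) && (count_mem 1 v < K.-1) = false -> rule v t = Dec4 v t.
Proof. by rewrite /rule => ->. Qed.

Lemma full_folded st w a : ringed (spos st) w a -> full a -> (forall h, ~~ pending (pend st w) h) ->
  exists2 mu, mu < K * (K + 2) & Folded st mu.
Proof.
move=> rg fu np; have [w_inj cE Na a0] := rg.
have [i Hi] : exists i, R a (i, true) K.-1.
  have [x Hx] := run_ex a; rewrite fu in Hx.
  have [d|d] : x.2 = true \/ x.2 = false by case: x.2; [left|right].
    by exists x.1; rewrite -d -surjective_pairing.
  have := R_rev a x K.-1; rewrite Hx; case: x d {Hx} => i p /= -> H.
  by exists (adv K.-1 (i, false)).1.
pose H := K./2; have KH : (H + H).+1 = K.
  by rewrite addnn -[RHS](odd_double_half K) oddK.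
have HK : H < K by rewrite -KH ltnS leq_addr.
pose jv (r : I) : nat := val ((invF w_inj r - i)%R : I).
have jK r : jv r < K by apply: ltn_ord.
have ones m : m <= K.-1 -> sumn (take m (word a (i, true))) = m.
  elim: m => [|m IH] lt; first by rewrite take0.
  have mK : m < K by apply: leq_trans lt (leq_pred _).
  rewrite (take_nth 0) ?size_mkseq // -cats1 sumn_cat IH ?(ltnW lt) //= addn0.
  by rewrite nth_mkseq //; move/RP: Hi => /(_ m lt) ->; rewrite addn1.
have at_ r : spos st r = (spos st (w i) + jv r) %% n :> nat.
  have := ring_pos rg i (jv r).
  have -> : (adv (jv r) (i, true)).1 = invF w_inj r.
    by rewrite place1 -[LHS]/((i + (invF w_inj r - i))%R) GRing.addrC GRing.subrK.
  rewrite f_invF ones; last exact: jK.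
  by case=> // /ltnW; rewrite leqNgt jK.
have jv_at m : m < K -> exists r, jv r = m.
  move=> mK; exists (w (i + Ordinal mK)%R); rewrite /jv invF_f.
  by rewrite GRing.addrC GRing.addKr.
have jv_inj r r' : jv r = jv r' -> r = r'.
  move=> /ord_inj/GRing.addIr E; by rewrite -(f_invF w_inj r) E f_invF.
pose pl (r : I) := if H <= jv r then (true, jv r - H) else (false, H - jv r).
pose hh (q : bool) := H.
exists (fold_measure K hh hh).
  rewrite /fold_measure /hh subnn !addn0 ltn_pmul2r ?addn2 //.
  by rewrite -[X in _ < X]KH.
(* The centre is the middle robot, [H] nodes after the first one of the block; adding [n] meets the
   requirement [n <= z]. *)
exists (spos st (w i) + H + n), hh, hh, pl; split=> //.
have le r : (pl r).2 <= H.
  rewrite /pl; case: (leqP H (jv r)) => _ /=; last exact: leq_subr.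
  by rewrite leq_subLR -ltnS KH.
split.
- split; [exact: leq_addl| |].
    move=> r; rewrite at_ /pos; have := le r; rewrite /pl; case: (leqP H (jv r)) => lt /= le'.
      rewrite le' /node; rewrite -[in LHS](modnDr _ n); congr (_ %% n); move: lt; clear; lia.
    rewrite le' /node; rewrite -[in LHS](modnDr _ n); congr (_ %% n); move: lt; clear; lia.
  by move=> r; have := le r; case: (pl r) => q m.
- split.
  + move=> q m /andP[m0 mH']; have {mH'} mH : m <= H := mH'.
    have [|r Er] := jv_at (if q then H + m else H - m).
      case: q => /=; last exact: leq_ltn_trans (leq_subr _ _) HK.
      by rewrite -KH ltnS leq_add2l.
    exists r; rewrite /pl Er; case: q {Er} => /=; first by rewrite leq_addr addKn.
    by rewrite leqNgt ltn_subrL m0 (leq_trans m0 mH) /= subKn.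
  + move=> r r'; rewrite /pl => E _; apply: jv_inj; move: E.
    case: (leqP H (jv r)) => l1; case: (leqP H (jv r')) => l2 [] //; move: l1 l2; clear; lia.
  have [r Er] := jv_at H HK; exists r; by rewrite /pl Er leqnn subnn.
- split=> //; first by left.
  by rewrite -[X in _ < X]KH.
move=> r p E; have := np (invF w_inj r, p).
by rewrite /pending /pend /= f_invF E eqxx.
Qed.

Lemma pend_put st w i p b : injective w -> spend st (w i) = None ->
  compute_move prot (spos st) (w i) b = Some p ->
  pend (stepP st (w i, b)) w = put (pend st w) (i, p).
Proof.
move=> w_inj N Ec; apply: functional_extensionality => j.
by rewrite /pend /put /step N /= (inj_eq w_inj) Ec; case: eqP.
Qed.

Lemma pend_stay st w i b : injective w ->
  (spend st (w i) = None /\ compute_move prot (spos st) (w i) b = None) \/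
  spend st (w i) = Some None ->
  pend (stepP st (w i, b)) w = pend st w.
Proof.
move=> w_inj E; apply: functional_extensionality => j.
rewrite /pend /step; case: E => [[N Ec]|N]; rewrite N /= (inj_eq w_inj) ?Ec; case: eqP => [->|//].
  by rewrite N.
by rewrite N.
Qed.

Lemma pend_unpend st w i p b : injective w -> spend st (w i) = Some (Some p) ->
  pend (stepP st (w i, b)) w = unpend (pend st w) i.
Proof.
move=> w_inj N; apply: functional_extensionality => j.
by rewrite /pend /unpend /step N /= (inj_eq w_inj); case: eqP.
Qed.

Lemma ringed_eq c c' w a : c =1 c' -> ringed c w a -> ringed c' w a.
Proof. by move=> E [H1 H2 H3 H4]; split=> // i; rewrite -!E. Qed.

Lemma SInv_idle st mu r b : SInv st mu -> ~ effective st r -> SInv (stepP st (r, b)) mu.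
Proof.
case=> [[w [a [rg iv ->]]]|fo] ne; last first.
  by right; apply: (Folded_idle prot_rule rule_folded).
have [w_inj _ _ _] := rg; have [wa bK _] := iv.
left; exists w, a; have Er : r = w (invF w_inj r) by rewrite f_invF.
move: (invF _ r) Er => i Er; rewrite {}Er in ne *.
have rg' : ringed (spos (stepP st (w i, b))) w a.
  by apply: ringed_eq rg => r'; rewrite spos_idle.
case Es: (spend st (w i)) ne => [[p|]|] ne; first by case: ne; exists p.
  by rewrite pend_stay //; right.
case Ec: (compute_move prot (spos st) (w i) b) => [p|]; last by rewrite pend_stay //; left.
have Ei : enabled a (i, p).
  by have := compute_spec prot_rule (spos st) (w i) b; rewrite Ec (rule_E rg).
have N : pend st w (i, p).1 = None by rewrite /pend /= Es.
rewrite (pend_put w_inj Es Ec); split=> //; first exact: invariant_look.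
by rewrite potential_look.
Qed.

Lemma SInv_move st mu r b : SInv st mu -> effective st r ->
  exists2 mu', mu' < mu & SInv (stepP st (r, b)) mu'.
Proof.
case=> [[w [a [rg iv ->]]]|fo] e; last first.
  by have [mu' lt H] := Folded_move prot (isT : 2 < K) Kn b fo e; exists mu' => //; right.
have [w_inj cE Na a0] := rg.
have Er : r = w (invF w_inj r) by rewrite f_invF.
move: (invF _ r) Er => i Er; rewrite {}Er in e *; case: e => p Ep.
have pf : pending (pend st w) (i, p) by rewrite /pending /pend /= Ep.
have [wa' Na' res] := invariant_step oddK iv Na pf.
have gf : 1 < g a (i, p).
  have [_ a0'] := (wa', wa'.1 (edge (i, p))); move: a0'; rewrite /upd eqxx /g.
  by case: (a _) => [|[]].
have rg' : ringed (spos (stepP st (w i, b))) w (upd a (i, p)).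
  have H := ringed_move rg gf (erefl (w i)).
  by apply: ringed_eq H => r'; rewrite /step Ep.
have pc := pend_unpend b w_inj Ep.
case: res => [[iv' lt]|[fu np]].
  exists (potential n (upd a (i, p)) (pend (stepP st (w i, b)) w) + K * (K + 2)).
    by rewrite ltn_add2r pc.
  by left; exists w, (upd a (i, p)); split=> //; rewrite pc.
have [|mu' lt fo] := full_folded rg' fu; first by rewrite pc.
by exists mu'; [apply: leq_trans lt (leq_addl _ _)|right].
Qed.

Lemma SInv_progress st mu : SInv st mu ->
  met st \/ exists r, forall b, compute_move prot (spos st) r b <> None.
Proof.
case=> [[w [a [rg iv _]]]|fo]; last exact: (Folded_progress prot_rule rule_folded (isT : 2 < K) Kn fo).
right; have [wa bK _] := iv; have [[i p] Ef] := enabled_ex oddK iv; exists (w i) => b Ec.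
have := compute_spec prot_rule (spos st) (w i) b; rewrite Ec !(rule_E rg) //.
by case: p Ef => ->; rewrite ?andbF.
Qed.

Lemma SInv_met st mu r : SInv st mu -> met st -> ~ effective st r.
Proof.
case=> [[w [a [rg _ _]]]|fo] mt; last exact: (Folded_met Kn fo).
have [w_inj cE Na a0] := rg.
have := cE 0%R; rewrite (mt (w (0 + 1)%R) (w 0%R)) => /eqP.
rewrite -[X in X == _](modn_small (ltn_ord (spos st (w 0%R)))) -[X in X == _ %[mod _]]addn0.
rewrite eqn_modDl mod0n modn_small ?ltn_eqF //.
rewrite -Na (bigD1 0%R) //= (bigD1 1%R) //= addnA.
by apply: leq_trans (leq_addr _ _); rewrite -addn1 leq_add2l.
Qed.

(** * The initial configuration *)

Section Initial.
Variables (c0 : config n K).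
Hypotheses (c0_inj : injective c0) (c0_np : ~ periodic c0).

Let le_c r r' := c0 r <= c0 r'.
Let order := sort le_c (enum 'I_K).

Lemma order_size : size order = K.
Proof. by rewrite size_sort size_enum_ord. Qed.

Definition first_w (i : I) : I := nth ord0 order i.

Lemma first_inj : injective first_w.
Proof.
move=> i j /eqP; rewrite nth_uniq ?order_size ?ltn_ord //; last by rewrite sort_uniq enum_uniq.
by move/eqP/ord_inj.
Qed.

Lemma first_lt (i j : I) : i < j -> c0 (first_w i) < c0 (first_w j).
Proof.
move=> lt; rewrite ltn_neqAle; apply/andP; split.
  apply/eqP => /ord_inj/c0_inj/first_inj E; by rewrite E ltnn in lt.
have so : sorted le_c order by apply: sort_sorted => x y; apply: leq_total.
have tr : transitive le_c by move=> y x z; apply: leq_trans.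
by apply: (sorted_ltn_nth tr ord0 so) => //; rewrite inE order_size.
Qed.

(** Robots are numbered by increasing node, so only the gap after the last one passes node 0. *)
Definition first_gap (i : I) : nat :=
  if i == ord_max then n - c0 (first_w i) + c0 (first_w (i + 1)%R)
  else c0 (first_w (i + 1)%R) - c0 (first_w i).

Lemma first_gap_pos i : 0 < first_gap i.
Proof.
rewrite /first_gap; case: eqP => [_|/eqP ne].
  by rewrite addn_gt0 subn_gt0 ltn_ord.
rewrite subn_gt0; apply: first_lt; rewrite /= [1 %% _]modn_small // modn_small addn1 //.
by rewrite ltnS ltn_neqAle -ltnS ltn_ord andbT; move: ne; rewrite -val_eqE.
Qed.

Lemma first_ringed : ringed c0 first_w first_gap.
Proof.
have S (i : I) : i != ord_max -> (i + 1)%R = i.+1 :> nat.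
  move=> ne; rewrite /= [1 %% _]modn_small // modn_small addn1 //.
  by rewrite ltnS ltn_neqAle -ltnS ltn_ord andbT; move: ne; rewrite -val_eqE.
split; [exact: first_inj| | |exact: first_gap_pos].
  move=> i; rewrite /first_gap; case: eqP => [_|/eqP ne].
    rewrite addnA subnKC ?modnDl ?modn_small //; exact: ltnW.
  rewrite subnKC ?modn_small //; apply/ltnW/first_lt; rewrite S //.
pose u m : nat := c0 (nth ord0 order m).
have tele m : m < K -> \sum_(i < m) (u i.+1 - u i) + u 0 = u m.
  elim: m => [|m IH] lt; first by rewrite big_ord0.
  rewrite big_ord_recr /= addnAC IH ?(ltnW lt) // subnKC //.
  exact: ltnW (first_lt (i := Ordinal (ltnW lt)) (j := Ordinal lt) (ltnSn m)).
rewrite big_ord_recr /= {2}/first_gap eqxx.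
have -> : first_w (ord_max + 1)%R = nth ord0 order 0.
  by rewrite /first_w /= [1 %% _]modn_small // addn1 modnn.
rewrite (eq_bigr (fun i : 'I_k'.+2 => u i.+1 - u i)); last first.
  move=> i _; have ne : widen_ord (leqnSn k'.+2) i != ord_max.
    by rewrite -val_eqE /= ltn_eqF.
  by rewrite /first_gap (negPf ne) /first_w S.
have := tele k'.+2 (ltnSn _).
have : u k'.+2 <= n := ltnW (ltn_ord _).
rewrite -[nat_of_ord (c0 (first_w ord_max))]/(u k'.+2) -/(u 0).
move: (u k'.+2) (u 0) (\sum_(_ < _) _) => x y s xn; move: xn; clear; lia.
Qed.

Lemma first_nonper : nonper first_gap.
Proof.
have rg := first_ringed.
have main (i : I) m : 0 < m < K -> word first_gap (i, true) <> word first_gap (adv m (i, true)).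
  move=> /andP[m0 mK] E; apply: c0_np; exists (first_w i).
  pose u (j : nat) := g first_gap (adv j (i, true)).
  have per (j : nat) : u (j + m) = u j.
    by rewrite /u; move/eqP/wordP: E => /(_ j); rewrite advD => ->.
  have perK (j : nat) : u (j + K) = u j by rewrite /u -advD advK.
  have pern q (j d : nat) : (forall j : nat, u (j + d) = u j) -> u (j + q * d) = u j.
    by move=> H; elim: q j => [|q IH] j; rewrite ?addn0 // mulSn addnA IH.
  (* [periodic] asks for a whole number of copies: the periods [m] and [K] give the period
     [gcdn m K], which divides [K] and is less than [K], hence at least two copies. *)
  pose d := gcdn m K.
  have perd (j : nat) : u (j + d) = u j.
    have [q1 q2 Eq _] := egcdnP K m0.
    by rewrite -(pern q2 _ K perK) -addnA [d + _]addnC -Eq pern.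
  have [q Eq] : exists q, K = q * d by apply/dvdnP; apply: dvdn_gcdr.
  have dm : d <= m by apply: dvdn_leq m0 (dvdn_gcdl _ _).
  exists q, (mkseq u d); split.
    case: q Eq => [|[|q]] // Eq; move: mK; rewrite Eq mul1n ltnNge dm //.
  have Es : word first_gap (i, true) = mkseq u (q * d) := congr1 (mkseq u) Eq.
  rewrite (cw_segsE (ring_segs rg i)) Es; elim: q {Eq Es} => [//|q IH].
  rewrite mulSn /mkseq iotaD map_cat /= -IH; congr (_ ++ _).
  rewrite -[X in iota X _](addn0 d) iotaDl -map_comp; apply: eq_map => j /=.
  by rewrite addnC perd.
move=> f h dfh E; have [m mK Em] := same_dir dfh; rewrite Em in E *.
have [->|m0] := posnP m; first by rewrite adv0.
exfalso; case: f dfh E {Em} => i [] _ E.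
  by apply: (main i m); rewrite ?m0.
apply: (main (adv m (i, false)).1 m); first by rewrite m0.
have := word_flip E; rewrite -[flip (adv m (i, false))]/((adv m (i, false)).1, true) => <-.
by rewrite -[X in adv m X]/(flip (adv m (i, false))) adv_flip.
Qed.

Lemma SInv_init : exists2 mu, mu <= K.+1 * B1 n + n ^ 2 + K * (K + 2)
   & SInv (State c0 (fun _ => None)) mu.
Proof.
have rg := first_ringed; have [_ _ Na a0] := rg.
have wa : wf first_gap.
  split=> //; apply/existsP; apply: contraT; rewrite negb_exists => /forallP all1.
  have : n <= K.
    rewrite -Na -[X in _ <= X](card_ord K) -sum1_card; apply: leq_sum => e _.
    by rewrite leqNgt all1.
  by rewrite leqNgt (leq_ltn_trans (leq_addr 3 K) Kn).
have np h : pending (pend (State c0 (fun _ => None)) first_w) h = false by [].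
have [bK|fu] : (run first_gap).+1 < K \/ full first_gap.
  by have := run_lt wa; rewrite leq_eqVlt => /orP[/eqP[E]|]; [right|left].
- exists (potential n first_gap (pend (State c0 (fun _ => None)) first_w) + K * (K + 2)).
    by rewrite leq_add2r; apply: potential_le.
  left; exists first_w, first_gap; split=> //; split=> //.
  case: (boolP (fresh first_gap)) => [fr|nfr].
    by right; split=> //; exact: first_nonper.
  move: nfr; rewrite /fresh !negb_or negbK -lt0n => /and3P[b0 ex nm].
  left; split.
  + by split=> // h; rewrite np.
  + by move=> _ h; rewrite np.
  + move=> m4; split; last by move=> h; rewrite np.
    move: nm; rewrite m4 /= -leqNgt; apply: leq_trans; apply: subset_leq_card.
    by apply/subsetP => x; rewrite !inE np orbF.
  by left=> h; rewrite /stray np.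
have [|mu lt fo] := full_folded (st := State c0 (fun _ => None)) rg fu.
  by move=> h; rewrite np.
by exists mu; [apply: leq_trans (ltnW lt) (leq_addl _ _)|right].
Qed.

End Initial.
End Realisation.

Theorem mainTheorem1 :
  exists C : nat, forall n k : nat, odd k -> 2 < k -> k < n - 3 ->
  exists P : protocol,
    forall c0 : config n k, injective c0 -> ~ periodic c0 ->
    forall sc : schedule k, fair sc ->
    forall t, rounds_done_by P c0 sc (C * n ^ 2) t -> gathered_from P c0 sc t.
Proof.
(* As [k + 1 <= n] and [B1 n] is [12 n + 2], the initial measure is at most [14 n^2 + 2 n]; twice
   its successor is below [40 n^2]. *)
exists 40 => n [|[|[|k']]] // oddK _ Kn'.
have Kn : k'.+3 + 3 < n by rewrite addnC -ltn_subRL.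
exists (prot k') => c0 c0_inj c0_np sc _ t.
have [mu le iv] := SInv_init oddK Kn c0_inj c0_np.
apply: (rounds_gather (SInv_idle Kn) (SInv_move oddK Kn) (SInv_progress oddK Kn) (SInv_met Kn) isT iv).
have K2 : k'.+3 * (k'.+3 + 2) <= n ^ 2.
  rewrite expnS expn1; apply: leq_mul; first exact: leq_trans (leq_addr _ _) (ltnW Kn).
  by apply: ltnW; apply: leq_ltn_trans Kn; rewrite leq_add2l.
have K3 : k'.+4 * B1 n <= n * (2 * (6 * n).+1).
  rewrite leq_mul2r; apply/orP; right; apply: leq_trans (ltnW Kn).
  by rewrite -addn1 leq_add2l.
have n1 : 0 < n by apply: leq_ltn_trans Kn.
move: le K2 K3 n1; rewrite -!mulnn; move: (k'.+4 * B1 n) (k'.+3 * _) => x y; clear; nia.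
Qed.
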